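(* There is a universal constant $C>0$ such that the following holds. Let $\delta\in(0,1)$ and let $X\sim N(0,\Sigma)$ be a $\kappa$-nondegenerate attractive Gaussian graphical model on $n$ nodes with maximum degree $d$. If the number of i.i.d. samples satisfies $m\ge C\left(\frac{\log(n)}{\kappa^2}+\frac{\log(2/\delta)}{\kappa^2}\right)$, then with probability at least $1-\delta$, for every node $i$ the algorithm \textsc{SearchAndValidate}$(i,d,\nu)$ with $\nu=\kappa^2/2$ returns exactly the set of neighbors of $i$.
   Context: A Gaussian graphical model (GGM) on $n$ nodes is a Gaussian vector $X=(X_1,\dots,X_n)\sim N(0,\Sigma)$ with invertible covariance $\Sigma$ and precision matrix $\Theta=\Sigma^{-1}$. Its graph has vertex set $\{1,\dots,n\}$, with distinct $i,j$ adjacent (neighbors) iff $\Theta_{ij}\neq0$. For $\kappa\in(0,1]$, the GGM is $\kappa$-nondegenerate if $|\Theta_{ij}|/\sqrt{\Theta_{ii}\Theta_{jj}}\ge\kappa$ for all $i\ne j$ with $\Theta_{ij}\ne0$. It is attractive if $\Theta_{ij}\le0$ for all $i\neq j$. The $m$ samples are split into two equally sized sample sets 1 and 2. $\hat{\mathbb E}_1$ denotes the empirical expectation over sample set 1. $\widehat{\mathrm{Var}}_2(X_i\mid X_S)$ denotes the ordinary least squares estimate of the conditional variance computed from sample set 2: if set 2 has $m_2$ samples forming the rows of the matrix $\mathbb X$ with columns $\mathbb X_k$, it equals $\frac{1}{m_2-|S|}\min_{w:\,\mathrm{supp}(w)\subset S}\|\mathbb X_i-\mathbb Xw\|_2^2$.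 \textsc{SearchAndValidate}$(i,d,\nu)$: (1) For each $d'=0,\dots,d$, let $w_{d'}$ be a minimizer of $\hat{\mathbb E}_1[(X_i-w\cdot X)^2]$ over $w\in\mathbb R^n$ with $w_i=0$ and $|\mathrm{supp}(w)|\le d'$. (2) For $d'=0,1,\dots,d$ (outer loop): for each $d''\in\{0,\dots,d\}\setminus\{d'\}$, let $S_{d',d''}=\mathrm{supp}(w_{d'})\cup\mathrm{supp}(w_{d''})$; if for some $j\in\mathrm{supp}(w_{d''})\setminus\mathrm{supp}(w_{d'})$ we have $\widehat{\mathrm{Var}}_2(X_i\mid X_{S_{d',d''}\setminus\{j\}})-\widehat{\mathrm{Var}}_2(X_i\mid X_{S_{d',d''}})>\nu\,\widehat{\mathrm{Var}}_2(X_i\mid X_{S_{d',d''}})$, go on to the next value of $d'$ in the outer loop. If this happens for no $d''$, stop and return $\mathrm{supp}(w_{d'})$. *)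

(* Defs.v *)
From HB Require Import structures.
From mathcomp Require Export all_boot all_order all_algebra.
From mathcomp Require Export all_classical all_reals all_analysis.
Set Implicit Arguments.
Unset Strict Implicit.
Unset Printing Implicit Defensive.
Export Order.TTheory GRing.Theory Num.Theory.
Export numFieldNormedType.Exports.
Local Open Scope classical_set_scope.
Local Open Scope ring_scope.

Section gaussian_vectors.
Context {R : realType} {d : measure_display} {T : measurableType d}.
Variable P : probability T R.

Definition mutually_independent {I : finType} {d' : measure_display}
    {T' : measurableType d'} (X : I -> {RV P >-> T'}) : Prop :=
  forall (J : {set I}) (B : I -> set T'),
    (forall i, i \in J -> measurable (B i)) ->
    P (\bigcap_(i in [set` J]) (X i @^-1` B i)) =
    (\prod_(i in J) P (X i @^-1` B i))%E.

Definition standard_normal (Z : {RV P >-> R}) : Prop :=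
  forall B : set R, measurable B -> distribution P Z B = normal_prob 0 1 B.

(* X = A Z with A A^T = Sigma and Z a vector of i.i.d. standard normals. Taking
   A square and Z on the same probability space as X loses no generality when
   Sigma is invertible, the only case of interest: then Z = A^-1 X. *)
Definition centered_gaussian {n : nat} (Sigma : 'M[R]_n)
    (X : {RV P >-> n.-tuple R}) : Prop :=
  exists (A : 'M[R]_n) (Z : 'I_n -> {RV P >-> R}),
    [/\ A *m A^T = Sigma,
        mutually_independent Z,
        forall k, standard_normal (Z k)
      & forall t (i : 'I_n), tnth (X t) i = \sum_(k < n) A i k * Z k t].

End gaussian_vectors.

Section graphical_models.
Context {R : realType} {n : nat}.
Implicit Types (Sigma Theta : 'M[R]_n).

Definition precision Sigma : 'M[R]_n := invmx Sigma.

Definition neighbors Theta (i : 'I_n) : {set 'I_n} :=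
  [set j | (j != i) && (Theta i j != 0)].

Definition max_degree Theta : nat := (\max_(i < n) #|neighbors Theta i|)%N.

Definition nondegenerate (kappa : R) Theta : Prop :=
  forall i j : 'I_n, i != j -> Theta i j != 0 ->
    kappa <= `|Theta i j| / Num.sqrt (Theta i i * Theta j j).

Definition attractive Theta : Prop :=
  forall i j : 'I_n, i != j -> Theta i j <= 0.

End graphical_models.

(* The rows of a data matrix are the samples. *)
Section search_and_validate.
Context {R : realType} {m n : nat}.
Implicit Types (XX : 'M[R]_(m, n)) (w : 'cV[R]_n) (i : 'I_n) (S : {set 'I_n}).

Definition supp w : {set 'I_n} := [set j | w j ord0 != 0].

Definition rss XX i w : R :=
  \sum_(s < m) (XX s i - \sum_(j < n) w j ord0 * XX s j) ^+ 2.

Definition emp_risk XX i w : R := m%:R^-1 * rss XX i w.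

(* The infimum is that of a least-squares problem, hence a minimum. *)
Definition ols_var XX i S : R :=
  (m%:R - #|S|%:R)^-1 *
  inf [set rss XX i w | w in [set w : 'cV[R]_n | supp w \subset S]].

Definition sparse_minimizer XX i (d' : nat) w : Prop :=
  [/\ w i ord0 = 0, (#|supp w| <= d')%N
    & forall v : 'cV[R]_n, v i ord0 = 0 -> (#|supp v| <= d')%N ->
        emp_risk XX i w <= emp_risk XX i v].

Definition rejects XX2 i (d : nat) (nu : R) (w : nat -> 'cV[R]_n) (d' : nat)
    : bool :=
  has (fun d'' =>
         let S := supp (w d') :|: supp (w d'') in
         (d'' != d') &&
         [exists j in supp (w d'') :\: supp (w d'),
            ols_var XX2 i (S :\ j) - ols_var XX2 i S > nu * ols_var XX2 i S])
      (iota 0 d.+1).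

(* [None] if all of d' = 0, ..., d are rejected. *)
Definition validate XX2 i (d : nat) (nu : R) (w : nat -> 'cV[R]_n)
    : option {set 'I_n} :=
  ohead [seq supp (w d') | d' <- iota 0 d.+1 & ~~ rejects XX2 i d nu w d'].

(* The minimizers in step (1) need not be unique, so the possible outputs form
   a relation: one output for each choice of minimizers. *)
Definition search_and_validate XX1 XX2 i (d : nat) (nu : R)
    (out : option {set 'I_n}) : Prop :=
  exists2 w : nat -> 'cV[R]_n,
    forall d', (d' <= d)%N -> sparse_minimizer XX1 i d' (w d')
    & out = validate XX2 i d nu w.

End search_and_validate.

Definition data_matrix {R : realType} {m n : nat} (x : 'I_m -> n.-tuple R)
    : 'M[R]_(m, n) := \matrix_(s < m, j < n) tnth (x s) j.

(* Main.v *)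
(* Let rho_S be the residual sum of squares of the regression of X_i on X_S and
   let N be the set of neighbors of i. In a sample of h Gaussian vectors, one may
   replace the component of each vector along a fixed direction p by a fresh draw
   from its conditional law given the rest without changing the joint law.
   With p the i-th unit vector this shows that Theta_ii rho_W is of order h for
   N \subset W, and that Theta_ii (rho_A - rho_W) is of order 1 if moreover
   N \subset A \subset W and W has one element more than A. If S misses a set K
   of neighbors, take p supported in K with p_j = - Theta_ij / Theta_jj. Since
   the model is attractive, the part of the regression function of X_i along p,
   which is invisible to X_S, has variance at least |K| kappa^2 / Theta_ii;
   the same computation gives |K| kappa^2 < 1, so d kappa^2 <= 1. Hence
   rho_S <= rho_W has probability at most 2^|S \ W| exp(- c |K| kappa^2 h), for
   all W containing N.
   Taking W = N and summing over the S with |S| <= |N|, where |S \ N| <= |K|,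
   the best support of size |N| in the first sample is N, with high probability.
   For the validation, supports are selected by the first sample only, so that
   they may be treated as fixed in the second one. Almost surely there are no
   ties, hence for given i and d' the events that S is selected are disjoint and
   the union over S costs nothing; only the union over i, d' and the removed
   column j remains. *)
Require Import Defs.
From HB Require Import structures.
From mathcomp Require Import measurable_realfun ring lra.
Set Implicit Arguments.
Unset Strict Implicit.
Unset Printing Implicit Defensive.
Local Open Scope classical_set_scope.
Local Open Scope ring_scope.

(** * The standard Gaussian measure on the line *)

(** A plain union bound over supports of size d would need d log n / kappa^2 samples. In the
    selection the loss is compensated by the exponent, which grows with the number of missed
    neighbors just as the logarithm of the number of candidate supports does: the bounds for all
    supports add up to a binomial expansion of (1 + y)^n with n y small. The sample size hypothesis
    does not mention d. It is the inequality d kappa^2 <= 1 that turns it into h >= 200 (d + 1), so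
    that the dimensions lost to a regression are a small fraction of h. Resampling stands in for
    conditional distributions. It is an identity between integrals of nonnegative functions,
    obtained from the Cameron-Martin shift formula. Given the old data, a residual becomes a
    quadratic function of a standard Gaussian vector, and every tail bound follows from an explicit
    exponential moment by Markov's inequality. *)

Section gauss1.
Context {R : realType}.
Local Notation mu := (@lebesgue_measure R).

(** The identity between two copies of the Borel line; pushing forward along it turns [normal_prob]
    into a probability on [R] itself. *)
Definition borelR (x : measurableTypeR R) : R := x.

Lemma measurable_borelR : measurable_fun setT borelR.
Proof. by move=> _ A mA; rewrite setTI. Qed.

HB.instance Definition _ := isMeasurableFun.Build _ _ _ _ borelR measurable_borelR.

(* Opaque, since unification would otherwise unfold the density. *)
Lemma gam_sig :
  {p : probability R R | forall A, p A = distribution (@normal_prob R 0 1) borelR A}.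
Proof. by exists (distribution (@normal_prob R 0 1) borelR). Qed.

Definition gam : probability R R := sval gam_sig.

Lemma gamE A : gam A = normal_prob 0 1 A.
Proof. exact: (svalP gam_sig). Qed.

Definition gpdf (x : measurableTypeR R) : R := normal_pdf 0 1 x.

Lemma gpdfE x : gpdf x = (Num.sqrt (pi *+ 2))^-1 * expR (- x ^+ 2 / 2).
Proof.
rewrite /gpdf normal_pdfE ?oner_neq0// /normal_peak /normal_fun.
by rewrite !expr1n subr0 mul1r.
Qed.

Lemma measurable_gpdf : measurable_fun setT gpdf.
Proof. exact: measurable_normal_pdf. Qed.

Lemma measurable_egpdf : measurable_fun setT (fun x => (gpdf x)%:E).
Proof. exact: (measurableT_comp (@EFin_measurable R _) measurable_gpdf). Qed.

(** The Radon-Nikodym derivative is an abstract function; its identification with the explicit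
    density makes integrals against [gam] computable. *)
Lemma gpdf_density : ae_eq mu setT
  (Radon_Nikodym_SigmaFinite.f (@normal_prob R 0 1) mu) (fun x => (gpdf x)%:E).
Proof.
have dom := @normal_prob_dominates R 0 1.
apply: integral_ae_eq => //.
- exact: Radon_Nikodym_SigmaFinite.f_integrable.
- exact: measurable_egpdf.
- by move=> A _ mA; rewrite -Radon_Nikodym_SigmaFinite.f_integral.
Qed.

Lemma integral_gam (f : R -> \bar R) : measurable_fun setT f ->
  (forall x, 0 <= f x)%E -> (\int[gam]_x f x = \int[mu]_x (f x * (gpdf x)%:E))%E.
Proof.
move=> mf f0; have dom := @normal_prob_dominates R 0 1.
have mfb : measurable_fun setT (f \o borelR) by apply: (measurableT_comp mf).
rewrite (eq_measure_integral (distribution (@normal_prob R 0 1) borelR)); last first.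
  by move=> A _ _; exact: gamE.
rewrite ge0_integral_pushforward// preimage_setT.
rewrite -(Radon_Nikodym_SigmaFinite.change_of_variables dom)//.
apply: ae_eq_integral => //.
- apply: emeasurable_funM => //.
  exact: measurable_int (Radon_Nikodym_SigmaFinite.f_integrable dom).
- by apply: emeasurable_funM => //; exact: measurable_egpdf.
- by apply: ae_eqe_mul2l; exact: gpdf_density.
Qed.

Lemma lebesgue_shift (f : measurableTypeR R -> \bar R) a : measurable_fun setT f ->
  (forall x, 0 <= f x)%E -> (\int[mu]_x f (x + a)%R = \int[mu]_x f x)%E.
Proof.
move=> mf f0.
have ms : measurable_fun setT (fun x : measurableTypeR R => x + a : measurableTypeR R).
  exact: measurable_funD.
transitivity (\int[pushforward mu (fun x : measurableTypeR R => (x + a)%R : measurableTypeR R)]_x f x)%E.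
  by rewrite ge0_integral_pushforward.
apply: eq_measure_integral => //= A mA _; apply/esym.
apply: lebesgue_measure_unique => //= _ [[u v]] _ <-.
rewrite /pushforward /=.
rewrite (_ : _ @^-1` _ = `]u - a, v - a]%classic).
  by rewrite !lebesgue_measure_itv/= !lte_fin ltrD2r -!EFinB opprB addrA subrK.
by apply/seteqP; split => x /=; rewrite !in_itv/= ltrBlDr lerBrDr.
Qed.

Lemma measurable_comp_borelR (f : R -> \bar R) : measurable_fun setT f ->
  measurable_fun [set: measurableTypeR R] (f : measurableTypeR R -> \bar R).
Proof. by move=> mf; apply: (measurableT_comp mf measurable_borelR). Qed.

(** The Cameron-Martin formula in dimension one: translating the Gaussian density multiplies it by
    this exponential. *)
Lemma gam_shift (f : R -> \bar R) a : measurable_fun setT f ->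
  (forall x, 0 <= f x)%E ->
  (\int[gam]_x f (x + a)%R = \int[gam]_x (f x * (expR (a * x - a ^+ 2 / 2))%:E))%E.
Proof.
move=> mf f0.
have mD b : measurable_fun setT (fun x : R => x + b) by exact: measurable_funD.
have mexp : measurable_fun setT (fun x : R => expR (a * x - a ^+ 2 / 2)).
  by apply: measurableT_comp => //; apply: measurable_funB => //; apply: measurable_funM.
rewrite !integral_gam//; last 3 first.
- by apply: emeasurable_funM => //; apply/measurable_EFinP.
- by move=> x; rewrite mule_ge0// lee_fin expR_ge0.
- exact: (measurableT_comp mf (mD a)).
rewrite -(@lebesgue_shift _ (- a)).
- apply: eq_integral => x _; rewrite subrK -[RHS]muleA -EFinM; congr (_ * _%:E)%E.
  rewrite !gpdfE mulrCA -expRD; congr (_ * expR _).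
  by field.
- apply: emeasurable_funM; first exact: (measurable_comp_borelR (measurableT_comp mf (mD a))).
  exact: measurable_egpdf.
- by move=> x; rewrite mule_ge0// lee_fin normal_pdf_ge0.
Qed.

Lemma gam_set1 (x : R) : gam [set x] = 0%E.
Proof.
rewrite gamE; have /null_content_dominatesP := @normal_prob_dominates R 0 1.
by apply => //; exact: lebesgue_measure_set1.
Qed.

(** Completing the square leaves a constant times the normal density of mean c / D and variance 1 /
    D, where D = 1 + 2 s. *)
Lemma gam_quad (s c : R) : 0 < 1 + 2 * s ->
  (\int[gam]_x (expR (- s * x ^+ 2 + c * x))%:E =
   ((Num.sqrt (1 + 2 * s))^-1 * expR (c ^+ 2 / (2 * (1 + 2 * s))))%:E)%E.
Proof.
move=> s0.
pose D := 1 + 2 * s.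
have sD : 0 < Num.sqrt D by rewrite sqrtr_gt0.
have mf : measurable_fun setT (fun x : R => expR (- s * x ^+ 2 + c * x)).
  by apply: measurableT_comp => //; apply: measurable_funD => //; apply: measurable_funM => //; exact: measurable_funX.
rewrite integral_gam//; last by exact/measurable_EFinP.
transitivity (\int[mu]_x (((Num.sqrt D)^-1 * expR (c ^+ 2 / (2 * D)))%:E *
   (normal_pdf (c / D) (Num.sqrt D)^-1 x)%:E))%E.
  apply: eq_integral => x _; rewrite gpdfE -!EFinM; congr EFin.
  rewrite normal_pdfE ?gt_eqF ?invr_gt0// /normal_peak /normal_fun.
  rewrite exprVn sqr_sqrtr ?ltW//.
  have -> : Num.sqrt (D^-1 * pi *+ 2) = (Num.sqrt D)^-1 * Num.sqrt (pi *+ 2).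
    by rewrite -mulrnAr sqrtrM ?invr_ge0 ?ltW// sqrtrV ?ltW.
  set q := Num.sqrt D; set z := Num.sqrt (pi *+ 2).
  have -> : (q^-1 * z)^-1 = q * z^-1 by rewrite invfM invrK.
  rewrite mulrCA -expRD [RHS]mulrACA [q^-1 * _]mulrA mulVf ?gt_eqF// mul1r -expRD.
  congr (_ * expR _).
  by rewrite /D; field; rewrite gt_eqF.
rewrite ge0_integralZl//.
- by rewrite integral_normal_pdf mule1.
- by apply/measurable_EFinP; exact: measurable_normal_pdf.
- by move=> x _; rewrite lee_fin normal_pdf_ge0.
Qed.

End gauss1.

(** * Laws of independent families *)

Section prodP.
Context {d} {V : measurableType d} {R : realType}.

Definition cons_pair n (x : V * n.-tuple V) : n.+1.-tuple V := [tuple of x.1 :: x.2].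

Lemma measurable_cons_pair n : measurable_fun setT (@cons_pair n).
Proof. exact: measurable_cons. Qed.

HB.instance Definition _ n :=
  isMeasurableFun.Build _ _ _ _ (@cons_pair n) (@measurable_cons_pair n).

Definition consP n (p : probability V R) (q : probability (n.-tuple V) R) :
  probability (n.+1.-tuple V) R := distribution (p \x q)%E (@cons_pair n).

(** Built coordinate by coordinate, so that Tonelli peels off the head. The factors may differ: the
    samples have equal laws, but the distributions of the [X s] are different terms. *)
Fixpoint prodP n : ('I_n -> probability V R) -> probability (n.-tuple V) R :=
  if n is n'.+1 then fun nu => consP (nu ord0) (prodP (fun i => nu (lift ord0 i)))
  else fun=> \d_([tuple]).

Lemma integral_prodP0 (nu : 'I_0 -> probability V R) f : measurable_fun setT f ->
  (forall x, 0 <= f x)%E -> (\int[prodP nu]_x f x = f [tuple])%E.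
Proof. by move=> mf f0; rewrite integral_dirac// diracE in_setT mul1e. Qed.

Lemma prodPS n (nu : 'I_n.+1 -> probability V R) :
  prodP nu = consP (nu ord0) (prodP (fun i => nu (lift ord0 i))).
Proof. by []. Qed.

Lemma integral_prodPS n (nu : 'I_n.+1 -> probability V R) f : measurable_fun setT f ->
  (forall x, 0 <= f x)%E ->
  (\int[prodP nu]_x f x = \int[nu ord0]_x
     \int[prodP (fun i => nu (lift ord0 i))]_xs f [tuple of x :: xs])%E.
Proof.
move=> mf f0; rewrite prodPS ge0_integral_pushforward// fubini_tonelli1//.
  exact: (measurableT_comp mf (@measurable_cons_pair n)).
by move=> x; exact: f0.
Qed.

Definition box n (B : 'I_n -> set V) : set (n.-tuple V) :=
  [set t | forall i, B i (tnth t i)].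

Lemma measurable_box n (B : 'I_n -> set V) :
  (forall i, measurable (B i)) -> measurable (box B).
Proof.
move=> mB; rewrite (_ : box B = \bigcap_i ((@tnth n V)^~ i @^-1` B i)).
  apply: fin_bigcap_measurable => // i _.
  by rewrite -[X in measurable X]setTI; exact: measurable_tnth.
by apply/seteqP; split => t /= h i; [move=> _; exact: h|exact: (h i I)].
Qed.

Lemma sigma_algebra_box n :
  @measurable _ (n.-tuple V) = <<s [set box B | B in [set B | forall i, measurable (B i)]] >>.
Proof.
apply/seteqP; split.
  apply: smallest_sub; first exact: smallest_sigma_algebra.
  move=> A; rewrite -bigcup_seq => -[i _ [C mC <-]].
  apply: sub_sigma_algebra.
  exists (fun j => if j == i then C else setT).
    by move=> j /=; case: ifP.
  rewrite setTI; apply/seteqP; split => t /=.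
    by move=> /(_ i); rewrite eqxx.
  by move=> Ct j; case: eqP => // ->.
apply: smallest_sub; first exact: sigma_algebra_measurable.
by move=> A [B mB <-]; exact: measurable_box.
Qed.

Lemma tuple_measure_unique n (m1 m2 : {measure set (n.-tuple V) -> \bar R}) :
  (m1 setT < +oo)%E ->
  (forall B : 'I_n -> set V, (forall i, measurable (B i)) -> m1 (box B) = m2 (box B)) ->
  forall A, measurable A -> m1 A = m2 A.
Proof.
move=> m1T m12 A mA.
apply: (measure_unique [set box B | B in [set B | forall i, measurable (B i)]] (fun=> setT)) => //.
- exact: sigma_algebra_box.
- move=> _ _ [B mB <-] [C mC <-]; exists (fun i => B i `&` C i).
    by move=> i; exact: measurableI.
  apply/seteqP; split => t /=.
    by move=> h; split => i; have [] := h i.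
  by move=> [h1 h2] i; split.
- by move=> _; exists (fun=> setT) => //; apply/seteqP; split.
- by rewrite bigcup_const.
- by move=> _ [B mB <-]; exact: m12.
Qed.

Lemma prodP_box n (nu : 'I_n -> probability V R) (B : 'I_n -> set V) :
  (forall i, measurable (B i)) -> prodP nu (box B) = (\prod_(i < n) nu i (B i))%E.
Proof.
elim: n nu B => [|n IH] nu B mB.
  rewrite big_ord0 /= diracE (_ : box B = setT) ?in_setT//.
  by apply/seteqP; split => // t _ [].
rewrite prodPS big_ord_recl /= -IH; last by move=> i; exact: mB.
rewrite -product_measure1E//; last exact: measurable_box.
congr (_ _); apply/seteqP; split => -[x t] /=.
  move=> h; split; first exact: (h ord0).
  by move=> i; have := h (lift ord0 i); rewrite tnthS.
move=> [Bx h] i; case: (unliftP ord0 i) => [j ->|->]; last exact: Bx.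
by rewrite tnthS; exact: h.
Qed.

End prodP.

Lemma measurable_integral {d d'} {T : measurableType d} {U : measurableType d'}
    {R : realType} (m : probability U R) (F : T -> U -> \bar R) :
  measurable_fun setT (fun z : T * U => F z.1 z.2) -> (forall x y, 0 <= F x y)%E ->
  measurable_fun setT (fun x => \int[m]_y F x y)%E.
Proof.
move=> mF F0.
by apply: (@measurable_fun_fubini_tonelli_F _ _ _ _ _ m (fun z => F z.1 z.2)).
Qed.

Lemma integral_swap {d d'} {T : measurableType d} {U : measurableType d'}
    {R : realType} (p : probability T R) (m : probability U R) (F : T -> U -> \bar R) :
  measurable_fun setT (fun z : T * U => F z.1 z.2) -> (forall x y, 0 <= F x y)%E ->
  (\int[p]_x \int[m]_y F x y = \int[m]_y \int[p]_x F x y)%E.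
Proof.
by move=> mF F0; rewrite (@fubini_tonelli _ _ _ _ _ p m (fun z => F z.1 z.2)).
Qed.

Lemma measurable_mktuple {d d'} {T : measurableType d} {V : measurableType d'} n
    (F : 'I_n -> T -> V) : (forall i, measurable_fun setT (F i)) ->
  measurable_fun setT (fun t => [tuple F i t | i < n]).
Proof.
move=> mF; apply/measurable_fun_tnthP => i.
by apply: (eq_measurable_fun (F i)) => // t _; rewrite /= tnth_mktuple.
Qed.

Lemma measurable_tnth_comp {d d'} {T : measurableType d} {V : measurableType d'} n
    (i : 'I_n) (f : T -> n.-tuple V) : measurable_fun setT f ->
  measurable_fun setT (fun t => tnth (f t) i).
Proof. by move=> mf; exact: (measurableT_comp (measurable_tnth i) mf). Qed.

Lemma measurable_comp2 {d d1 d2 d3} {T : measurableType d} {V : measurableType d1}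
    {W : measurableType d2} {U : measurableType d3} (h : V -> W -> U)
    (x : T -> V) (w : T -> W) :
  measurable_fun setT (fun z : V * W => h z.1 z.2) ->
  measurable_fun setT x -> measurable_fun setT w ->
  measurable_fun setT (fun t => h (x t) (w t)).
Proof.
by move=> mh mx mw; exact: (measurableT_comp mh (measurable_fun_pair mx mw)).
Qed.

Section resample_tuple.
Context {d d'} {V : measurableType d} {W : measurableType d'} {R : realType}.
Variables (g : probability W R) (res : V -> W -> V).
Hypothesis mres : measurable_fun setT (fun z => res z.1 z.2).

Definition zipres n (x : n.-tuple V) (w : n.-tuple W) :=
  [tuple res (tnth x i) (tnth w i) | i < n].

Lemma measurable_zipres n {d1} {T : measurableType d1} (x : T -> n.-tuple V)
   (w : T -> n.-tuple W) : measurable_fun setT x -> measurable_fun setT w ->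
  measurable_fun setT (fun t => zipres (x t) (w t)).
Proof.
move=> mx mw; apply: measurable_mktuple => i.
by apply: (measurable_comp2 mres); exact: measurable_tnth_comp.
Qed.

Lemma zipres_cons n x w (xs : n.-tuple V) (ws : n.-tuple W) :
  zipres [tuple of x :: xs] [tuple of w :: ws] = [tuple of res x w :: zipres xs ws].
Proof.
apply: eq_from_tnth => i; rewrite tnth_mktuple.
by case: (unliftP ord0 i) => [j ->|->]; rewrite ?tnthS ?tnth0// tnth_mktuple.
Qed.

(** Induction on the number of samples; by Tonelli the fresh draw for the head is moved past the
    integral over the remaining samples. *)
Lemma resample_tuple n (nu : 'I_n -> probability V R) :
  (forall i f, measurable_fun setT f -> (forall x, 0 <= f x)%E ->
     \int[nu i]_x f x = \int[nu i]_x \int[g]_w f (res x w))%E ->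
  forall f, measurable_fun setT f -> (forall x, 0 <= f x)%E ->
  (\int[prodP nu]_x f x = \int[prodP nu]_x \int[prodP (fun _ : 'I_n => g)]_w
     f (zipres x w))%E.
Proof.
elim: n nu => [|n IH] nu nuE f mf f0.
  rewrite !integral_prodP0//.
  - by congr f; apply: eq_from_tnth => -[].
  - by apply: (measurableT_comp mf); exact: measurable_zipres.
  - apply: measurable_integral => //.
    by apply: (measurableT_comp mf); exact: measurable_zipres.
  - by move=> x; exact: integral_ge0.
set nu' := fun i => nu (lift ord0 i).
have mfz d1 (T : measurableType d1) (x : T -> V) (xs : T -> n.-tuple V) :
    measurable_fun setT x -> measurable_fun setT xs ->
    measurable_fun setT (fun t => f [tuple of x t :: xs t]).
  by move=> mx mxs; apply: (measurableT_comp mf); exact: measurable_cons.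
have mr d1 (T : measurableType d1) (x : T -> V) (w : T -> W) :
    measurable_fun setT x -> measurable_fun setT w ->
    measurable_fun setT (fun t => res (x t) (w t)).
  by move=> mx mw; exact: (measurable_comp2 mres).
have swap x (p : probability (n.-tuple V) R) (q : probability (n.-tuple W) R) :
    (\int[g]_w \int[p]_xs \int[q]_ws f [tuple of res x w :: zipres xs ws] =
     \int[p]_xs \int[g]_w \int[q]_ws f [tuple of res x w :: zipres xs ws])%E.
  rewrite integral_swap//; last by move=> w xs; exact: integral_ge0.
  apply: (@measurable_integral _ _ (W * n.-tuple V)%type _ _ _
     (fun z ws => f [tuple of res x z.1 :: zipres z.2 ws])) => //.
  apply: mfz; first by apply: mr => //; exact: (measurableT_comp measurable_fst).
  apply: measurable_zipres => //; exact: (measurableT_comp measurable_snd).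
rewrite integral_prodPS// nuE; first last.
- by move=> x; exact: integral_ge0.
- by apply: measurable_integral => //; exact: mfz.
rewrite [RHS]integral_prodPS//; first last.
- by move=> x; exact: integral_ge0.
- apply: measurable_integral => //.
  by apply: (measurableT_comp mf); exact: measurable_zipres.
apply: eq_integral => x _.
transitivity (\int[g]_w \int[prodP nu']_xs \int[prodP (fun _ : 'I_n => g)]_ws
    f [tuple of res x w :: zipres xs ws])%E.
  apply: eq_integral => w _.
  rewrite (IH nu')//; first by move=> i; exact: nuE.
  by apply: mfz.
apply: (eq_trans (swap x _ _)).
apply: eq_integral => xs _.
have mz : measurable_fun setT (fun ws => f (zipres [tuple of x :: xs] ws)).
  by apply: (measurableT_comp mf); exact: measurable_zipres.
have -> := integral_prodPS (fun _ : 'I_n.+1 => g) mz (fun ws => f0 _).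
apply: eq_integral => w _; apply: eq_integral => ws _.
by rewrite zipres_cons.
Qed.

End resample_tuple.

Section law.
Context {d d'} {T : measurableType d} {V : measurableType d'} {R : realType}.
Variable P : probability T R.

Definition tupleRV n (X : 'I_n -> {RV P >-> V}) (t : T) : n.-tuple V :=
  [tuple X i t | i < n].

Lemma measurable_tupleRV n (X : 'I_n -> {RV P >-> V}) :
  measurable_fun setT (tupleRV X).
Proof. by apply: measurable_mktuple => i; exact: measurable_funP. Qed.

HB.instance Definition _ n (X : 'I_n -> {RV P >-> V}) :=
  isMeasurableFun.Build _ _ _ _ (tupleRV X) (measurable_tupleRV X).

Lemma indep_box n (X : 'I_n -> {RV P >-> V}) (B : 'I_n -> set V) (J : {set 'I_n}) :
  mutually_independent X -> (forall i, measurable (B i)) ->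
  P (\bigcap_(i in [set` J]) (X i @^-1` B i)) =
  (\prod_(i in J) distribution P (X i) (B i))%E.
Proof. by move=> /(_ J B) + mB => -> // i _. Qed.

Lemma law_tupleRV n (X : 'I_n -> {RV P >-> V}) : mutually_independent X ->
  forall A, measurable A ->
  distribution P (tupleRV X) A = prodP (fun i => distribution P (X i)) A.
Proof.
move=> indX; apply: tuple_measure_unique.
  by rewrite /= /distribution /pushforward preimage_setT probability_setT ltry.
move=> B mB; apply: (eq_trans _ (esym (prodP_box _ mB))).
have := indep_box [set: 'I_n]%SET indX mB.
rewrite (eq_bigl xpredT); last by move=> i; rewrite inE.
move=> <-; congr (P _); apply/seteqP; split => t /=.
  by move=> h i _; have := h i; rewrite tnth_mktuple.
by move=> h i; rewrite tnth_mktuple; apply: h; rewrite /= inE.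
Qed.

End law.

(** For fixed [E] both sides are finite measures in [A], so boxes suffice. Independence of two
    tuples follows by extending one factor at a time. *)
Lemma indep_extend {d d'} {T : measurableType d} {V : measurableType d'} {R : realType}
    (P : probability T R) n (U : T -> n.-tuple V) (E : set T)
    (mu : probability (n.-tuple V) R) :
  measurable_fun setT U -> measurable E ->
  (forall B : 'I_n -> set V, (forall i, measurable (B i)) ->
     P (U @^-1` box B `&` E) = mu (box B) * P E)%E ->
  forall A, measurable A -> (P (U @^-1` A `&` E) = mu A * P E)%E.
Proof.
move=> mU mE PB A mA.
have PEf : P E \is a fin_num by exact: fin_num_measure.
have PE0 : 0 <= fine (P E) by rewrite fine_ge0.
pose r : {nonneg R} := NngNum PE0.
pose m1 := pushforward (mrestr P mE) U.
pose m2 := mscale r mu.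
have m2E C : m2 C = (mu C * P E)%E by rewrite /m2 /mscale /= fineK// muleC.
rewrite -[LHS]/(m1 A) -m2E; have h := @tuple_measure_unique _ V R n m1 m2.
apply: h => //.
- change (P (U @^-1` setT `&` E) < +oo)%E.
  by rewrite preimage_setT setTI ltey_eq PEf.
- by move=> B mB; change (P (U @^-1` box B `&` E) = m2 (box B)); rewrite m2E PB.
Qed.

Lemma law_split {d d'} {T : measurableType d} {V : measurableType d'} {R : realType}
    (P : probability T R) h1 h2 (X : 'I_(h1 + h2) -> {RV P >-> V}) :
  mutually_independent X ->
  forall A B, measurable A -> measurable B ->
  P (tupleRV (fun i => X (lshift h2 i)) @^-1` A `&`
     tupleRV (fun i => X (rshift h1 i)) @^-1` B) =
  (prodP (fun i => distribution P (X (lshift h2 i))) A *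
   prodP (fun i => distribution P (X (rshift h1 i))) B)%E.
Proof.
move=> indX A B mA mB.
set U1 := tupleRV _; set U2 := tupleRV _.
set p1 := prodP _; set p2 := prodP _.
have mU1 : measurable_fun setT U1 by exact: measurable_tupleRV.
have mU2 : measurable_fun setT U2 by exact: measurable_tupleRV.
have boxes (B1 : 'I_h1 -> set V) (B2 : 'I_h2 -> set V) :
    (forall i, measurable (B1 i)) -> (forall i, measurable (B2 i)) ->
    P (U1 @^-1` box B1 `&` U2 @^-1` box B2) = (p1 (box B1) * p2 (box B2))%E.
  move=> mB1 mB2.
  pose B' i := match fintype.split i with inl j => B1 j | inr k => B2 k end.
  have mB' i : measurable (B' i) by rewrite /B'; case: (fintype.split i).
  have := indep_box [set: 'I_(h1 + h2)]%SET indX mB'.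
  rewrite (eq_bigl xpredT); last by move=> i; rewrite inE.
  rewrite big_split_ord /= !prodP_box// => e.
  transitivity (P (\bigcap_(i in [set` [set: 'I_(h1 + h2)]%SET]) X i @^-1` B' i)).
    congr (P _); apply/seteqP; split => t /=.
      move=> [k1 k2] i _; rewrite -[i]splitK /B'; case: (fintype.split i) => j /=.
        by rewrite (unsplitK (inl j)); have := k1 j; rewrite tnth_mktuple.
      by rewrite (unsplitK (inr j)); have := k2 j; rewrite tnth_mktuple.
    move=> k; split => j; rewrite tnth_mktuple.
      by have := k (lshift h2 j); rewrite /B' (unsplitK (inl j)); apply; rewrite /= inE.
    by have := k (rshift h1 j); rewrite /B' (unsplitK (inr j)); apply; rewrite /= inE.
  rewrite e; congr (_ * _)%E; apply: eq_bigr => j _.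
    by rewrite /B' (unsplitK (inl j)).
  by rewrite /B' (unsplitK (inr j)).
have mpre n (U : T -> n.-tuple V) C : measurable_fun setT U -> measurable C ->
    measurable (U @^-1` C).
  by move=> mU mC; rewrite -[X in measurable X]setTI; exact: mU.
have p1T : p1 setT = 1%E by rewrite probability_setT.
have e2 B2 : (forall i, measurable (B2 i)) -> P (U2 @^-1` box B2) = p2 (box B2).
  move=> mB2; have := boxes (fun=> setT) B2 (fun=> measurableT) mB2.
  rewrite (_ : box _ = setT); last by apply/seteqP; split.
  by rewrite preimage_setT setTI p1T mul1e.
(* The first factor becomes an arbitrary measurable set while the second is still a box; the roles
   are then exchanged. *)
have step1 B2 : (forall i, measurable (B2 i)) ->
    P (U1 @^-1` A `&` U2 @^-1` box B2) = (p1 A * p2 (box B2))%E.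
  move=> mB2; rewrite -e2//; apply: indep_extend => //.
    by apply: mpre => //; exact: measurable_box.
  by move=> B1 mB1; rewrite e2// boxes.
have e1 : P (U1 @^-1` A) = p1 A.
  have := step1 (fun=> setT) (fun=> measurableT).
  rewrite (_ : box _ = setT); last by apply/seteqP; split.
  by rewrite preimage_setT setIT probability_setT mule1.
rewrite setIC muleC -e1; apply: indep_extend => //; first exact: mpre.
by move=> B2 mB2; rewrite setIC step1// e1 muleC.
Qed.

(** * Standard Gaussian vectors *)

Section Gam.
Context {R : realType}.

(** Sealed like [gam]. *)
Lemma Gam_sig n : {p : probability (n.-tuple R) R | p = prodP (fun _ : 'I_n => gam)}.
Proof. by exists (prodP (fun=> gam)). Qed.

Definition Gam n : probability (n.-tuple R) R := sval (Gam_sig n).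

Lemma GamE n : Gam n = prodP (fun _ : 'I_n => gam).
Proof. exact: svalP (Gam_sig n). Qed.

Lemma integral_Gam0 f : measurable_fun setT f -> (forall x, 0 <= f x)%E ->
  (\int[Gam 0]_z f z = f [tuple])%E.
Proof. by move=> mf f0; rewrite GamE integral_prodP0. Qed.

Lemma integral_GamS n f : measurable_fun setT f -> (forall x, 0 <= f x)%E ->
  (\int[Gam n.+1]_z f z = \int[gam]_x \int[Gam n]_xs f [tuple of x :: xs])%E.
Proof. by move=> mf f0; rewrite !GamE integral_prodPS. Qed.

Definition dotf n (b : 'I_n -> R) (z : n.-tuple R) : R := \sum_i b i * tnth z i.

Definition shiftt n (b : 'I_n -> R) (z : n.-tuple R) (p : R) : n.-tuple R :=
  [tuple tnth z i + p * b i | i < n].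

Lemma measurable_dotf d (T : measurableType d) n (b : 'I_n -> R) (f : T -> n.-tuple R) :
  measurable_fun setT f -> measurable_fun setT (fun t => dotf b (f t)).
Proof.
move=> mf; apply: measurable_sum => i; apply: measurable_funM => //.
exact: measurable_tnth_comp.
Qed.

Lemma measurable_shiftt d (T : measurableType d) n (b : 'I_n -> R) (f : T -> n.-tuple R) p :
  measurable_fun setT f -> measurable_fun setT p ->
  measurable_fun setT (fun t => shiftt b (f t) (p t)).
Proof.
move=> mf mp; apply: measurable_mktuple => i; apply: measurable_funD.
  exact: measurable_tnth_comp.
exact: measurable_funM.
Qed.

Lemma dotf_shiftt n (b c : 'I_n -> R) z p :
  dotf c (shiftt b z p) = dotf c z + p * \sum_i c i * b i.
Proof.
rewrite /dotf mulr_sumr -big_split /=; apply: eq_bigr => i _.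
by rewrite tnth_mktuple mulrDr mulrCA.
Qed.

(** The Cameron-Martin formula in dimension n, by applying the scalar formula to each coordinate. *)
Lemma Gam_shift n (b : 'I_n -> R) p f : measurable_fun setT f ->
  (forall x, 0 <= f x)%E ->
  (\int[Gam n]_z f (shiftt b z p) =
   \int[Gam n]_z (f z * (expR (p * dotf b z - p ^+ 2 * (\sum_i b i ^+ 2) / 2))%:E))%E.
Proof.
elim: n b f => [|n IH] b f mf f0.
  rewrite !integral_Gam0//.
  - rewrite /dotf !big_ord0 !mulr0 mul0r subrr expR0 mule1.
    by congr f; apply: eq_from_tnth => -[].
  - apply: emeasurable_funM => //; apply/measurable_EFinP.
    apply: measurableT_comp => //; apply: measurable_funB => //.
    by apply: measurable_funM => //; exact: measurable_dotf.
  - by move=> z; rewrite mule_ge0// lee_fin expR_ge0.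
  - apply: (measurableT_comp mf); exact: measurable_shiftt.
pose b' i := b (lift ord0 i).
have mfz d1 (T : measurableType d1) (x : T -> R) (xs : T -> n.-tuple R) :
    measurable_fun setT x -> measurable_fun setT xs ->
    measurable_fun setT (fun t => f [tuple of x t :: xs t]).
  by move=> mx mxs; apply: (measurableT_comp mf); exact: measurable_cons.
pose e' (zs : n.-tuple R) := expR (p * dotf b' zs - p ^+ 2 * (\sum_i b' i ^+ 2) / 2).
have me' d1 (T : measurableType d1) (xs : T -> n.-tuple R) :
    measurable_fun setT xs -> measurable_fun setT (fun t => (e' (xs t))%:E).
  move=> mxs; apply/measurable_EFinP; apply: (@measurableT_comp _ _ _ _ _ _ (@expR R)) => //.
  apply: measurable_funB => //.
  by apply: measurable_funM => //; exact: measurable_dotf.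
pose G x := (\int[Gam n]_zs (f [tuple of x :: zs] * (e' zs)%:E))%E.
have mG : measurable_fun setT G.
  apply: measurable_integral.
    by apply: emeasurable_funM; [exact: mfz|exact: me'].
  by move=> x zs; rewrite mule_ge0// lee_fin expR_ge0.
have G0 x : (0 <= G x)%E.
  by apply: integral_ge0 => zs _; rewrite mule_ge0// lee_fin expR_ge0.
transitivity (\int[gam]_x G (x + p * b ord0)%R)%E.
  have mfs : measurable_fun setT (fun z => f (shiftt b z p)).
    by apply: (measurableT_comp mf); exact: measurable_shiftt.
  have -> := integral_GamS mfs (fun z => f0 _).
  apply: eq_integral => x _; rewrite /G -IH//; last exact: mfz.
  apply: eq_integral => zs _; congr f; apply: eq_from_tnth => i.
  rewrite tnth_mktuple; case: (unliftP ord0 i) => [j ->|->].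
    by rewrite !tnthS tnth_mktuple.
  by rewrite !tnth0.
rewrite gam_shift//.
have mfe : measurable_fun setT (fun z : n.+1.-tuple R => f z *
    (expR (p * dotf b z - p ^+ 2 * (\sum_i b i ^+ 2) / 2))%:E)%E.
  apply: emeasurable_funM => //; apply/measurable_EFinP.
  apply: measurableT_comp => //; apply: measurable_funB => //.
  by apply: measurable_funM => //; exact: measurable_dotf.
have fe0 z : (0 <= f z *
    (expR (p * dotf b z - p ^+ 2 * (\sum_i b i ^+ 2) / 2))%:E)%E.
  by rewrite mule_ge0// lee_fin expR_ge0.
apply: (etrans _ (esym (integral_GamS mfe fe0))).
apply: eq_integral => x _; rewrite /G -ge0_integralZr//.
- apply: eq_integral => zs _; rewrite -muleA -EFinM -expRD; congr (_ * (expR _)%:E)%E.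
  rewrite /dotf !big_ord_recl tnth0.
  under [X in _ = p * (_ + X) - _]eq_bigr do rewrite tnthS.
  rewrite /b'; set s := \sum_(i < n) _; set s2 := \sum_(i < n) _.
  by field.
- by apply: emeasurable_funM; [exact: mfz|exact: me'].
- by move=> zs _; rewrite mule_ge0// lee_fin expR_ge0.
Qed.

Lemma gam_exp_lin (u : R) : (\int[gam]_p (expR (u * p - u ^+ 2 / 2))%:E = 1)%E.
Proof.
have := @gam_shift R (cst 1%E) u (measurable_cst _) (fun=> lee01).
rewrite [X in X = _](_ : _ = 1%E); last first.
  transitivity (1 * gam (setT : set R))%E; first exact: integral_cst.
  by rewrite probability_setT mul1e.
by move=> ->; apply: eq_integral => x _; rewrite mul1e.
Qed.

(* Resampling the component of a standard Gaussian vector along a unit vector. *)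
Lemma Gam_resample n (b : 'I_n -> R) f : \sum_i b i ^+ 2 = 1 ->
  measurable_fun setT f -> (forall x, 0 <= f x)%E ->
  (\int[Gam n]_z f z = \int[Gam n]_z \int[gam]_g f (shiftt b z (g - dotf b z)%R))%E.
Proof.
move=> b1 mf f0.
have mexp d1 (T : measurableType d1) (h : T -> R) : measurable_fun setT h ->
    measurable_fun setT (fun t => (expR (h t))%:E).
  by move=> mh; apply/measurable_EFinP; exact: measurableT_comp.
have m1 : measurable_fun setT (fun z : n.-tuple R * R => dotf b z.1).
  by apply: measurable_dotf.
apply/esym.
(* Cameron-Martin is used twice: for the scalar, to replace g - <b, z> by p, and for the vector, to
   undo the shift of z by p b. The exponential weight that remains has integral one over p. *)
transitivity (\int[Gam n]_z \int[gam]_p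
    (f (shiftt b z p) * (expR (- dotf b z * p - dotf b z ^+ 2 / 2))%:E))%E.
  apply: eq_integral => z _.
  have mfs : measurable_fun setT (fun p => f (shiftt b z p)).
    by apply: (measurableT_comp mf); exact: measurable_shiftt.
  have -> := gam_shift (- dotf b z) mfs (fun p => f0 _).
  by apply: eq_integral => p _; rewrite sqrrN.
rewrite integral_swap; first last.
- by move=> z p; rewrite mule_ge0// lee_fin expR_ge0.
- apply: emeasurable_funM.
    by apply: (measurableT_comp mf); exact: measurable_shiftt.
  apply: mexp; apply: measurable_funB; apply: measurable_funM => //.
    exact: measurable_funN.
  exact: measurable_funX.
transitivity (\int[gam]_p \int[Gam n]_z
   (f z * (expR (p * dotf b z - dotf b z ^+ 2 / 2))%:E))%E.
  apply: eq_integral => p _.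
  pose H z := (f z * (expR ((p ^+ 2 - dotf b z ^+ 2) / 2))%:E)%E.
  transitivity (\int[Gam n]_z H (shiftt b z p))%E.
    apply: eq_integral => z _; rewrite /H dotf_shiftt; congr (_ * (expR _)%:E)%E.
    under eq_bigr do rewrite -expr2.
    by rewrite b1; field.
  rewrite Gam_shift.
  - apply: eq_integral => z _; rewrite -muleA -EFinM -expRD b1.
    by congr (_ * (expR _)%:E)%E; field.
  - apply: emeasurable_funM => //; apply: mexp; apply: measurable_funM => //.
    by apply: measurable_funB => //; apply: measurable_funX; exact: measurable_dotf.
  - by move=> z; rewrite mule_ge0// lee_fin expR_ge0.
rewrite integral_swap; first last.
- by move=> z p; rewrite mule_ge0// lee_fin expR_ge0.
- apply: emeasurable_funM.
    by apply: (measurableT_comp mf).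
  have m2 : measurable_fun setT (fun z : R * n.-tuple R => dotf b z.2).
    exact: measurable_dotf.
  apply: mexp; apply: measurable_funB; apply: measurable_funM => //.
  exact: measurable_funX.
apply: eq_integral => z _.
rewrite ge0_integralZl//.
  transitivity (f z * 1)%E; last by rewrite mule1.
  congr (_ * _)%E; rewrite -(gam_exp_lin (dotf b z)).
  by apply: eq_integral => p _; rewrite mulrC.
by apply: mexp; apply: measurable_funB => //; apply: measurable_funM.
Qed.

End Gam.

(** * Resampling a Gaussian vector along a direction *)

Section resX.
Context {R : realType} {n : nat}.
Implicit Types (Theta : 'M[R]_n) (p : 'I_n -> R).

Definition qf Theta p : R := \sum_i \sum_j p i * Theta i j * p j.

Definition posdef Theta := (forall i j, Theta i j = Theta j i) /\
  forall p, (exists i, p i != 0) -> 0 < qf Theta p.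

(** In the inner product defined by [Theta], for which X is a standard Gaussian vector, this
    replaces the coordinate of [x] along the unit vector p / sqrt(qf p) by [g]. *)
Definition resX Theta p (x : n.-tuple R) (g : R) : n.-tuple R :=
  shiftt (fun i => p i / Num.sqrt (qf Theta p)) x
    (g - dotf (fun j => (\sum_i p i * Theta i j) / Num.sqrt (qf Theta p)) x).

Lemma measurable_resX Theta p :
  measurable_fun setT (fun z : n.-tuple R * R => resX Theta p z.1 z.2).
Proof.
by apply: measurable_shiftt => //; apply: measurable_funB => //; exact: measurable_dotf.
Qed.

Definition pcol p : 'cV[R]_n := \col_i p i.

Lemma qfE Theta p : qf Theta p = ((pcol p)^T *m Theta *m pcol p) 0 0.
Proof.
rewrite /qf -mulmxA mxE; apply: eq_bigr => i _; rewrite !mxE mulr_sumr.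
by apply: eq_bigr => j _; rewrite !mxE mulrA.
Qed.

Section factor.
Variables (A Sigma : 'M[R]_n).
Hypotheses (AE : A *m A^T = Sigma) (Su : Sigma \in unitmx).

Let Au : A \in unitmx.
Proof.
move: Su; rewrite -AE !unitmxE det_mulmx det_tr unitrM => /andP[+ _].
by [].
Qed.

Let ThetaE : precision Sigma = (invmx A)^T *m invmx A.
Proof.
rewrite /precision -[RHS]mulmx1 -(mulmxV Su) mulmxA -[in RHS]AE.
rewrite -(mulmxA (_^T)) (mulmxA (invmx A)) mulVmx// mul1mx.
by rewrite -trmx_mul mulmxV// trmx1 mul1mx AE.
Qed.

Let sol p : 'cV[R]_n := invmx A *m pcol p.

Let qf_sol p : qf (precision Sigma) p = \sum_i sol p i 0 ^+ 2.
Proof.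
rewrite qfE ThetaE mulmxA -trmx_mul -mulmxA mxE; apply: eq_bigr => i _.
by rewrite mxE expr2.
Qed.

Lemma posdef_precision : posdef (precision Sigma).
Proof.
split=> [i j|p [i pi0]].
  have : (precision Sigma)^T = precision Sigma by rewrite ThetaE trmx_mul trmxK.
  by move=> /matrixP/(_ j i); rewrite mxE.
rewrite qf_sol lt_neqAle sumr_ge0 ?andbT; last by move=> k _; exact: sqr_ge0.
rewrite eq_sym psumr_neq0; last by move=> k _; exact: sqr_ge0.
apply/hasP.
have : sol p != 0.
  apply: contra_neq pi0 => s0.
  have : A *m sol p = 0 by rewrite s0 mulmx0.
  by rewrite /sol mulKVmx// => /matrixP/(_ i 0); rewrite !mxE.
case/cV0Pn => k sk; exists k; first by rewrite mem_index_enum.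
by rewrite /= exprn_even_gt0.
Qed.

Definition linmap (z : n.-tuple R) : n.-tuple R := [tuple \sum_k A i k * tnth z k | i < n].

Lemma measurable_linmap : measurable_fun setT linmap.
Proof.
apply: measurable_mktuple => i; apply: measurable_sum => k.
by apply: measurable_funM => //; exact: measurable_tnth.
Qed.

(** Under x = A z the direction [p] comes from the Euclidean unit vector b = A^-1 p / sqrt(qf p), to
    which [Gam_resample] applies. *)
Lemma resample_linmap p f : (exists i, p i != 0) ->
  measurable_fun setT f -> (forall x, 0 <= f x)%E ->
  (\int[Gam n]_z f (linmap z) =
   \int[Gam n]_z \int[gam]_g f (resX (precision Sigma) p (linmap z) g))%E.
Proof.
move=> p0 mf f0.
have q0 := posdef_precision.2 _ p0; set s := Num.sqrt (qf (precision Sigma) p).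
have s0 : 0 < s by rewrite sqrtr_gt0.
pose b i := sol p i 0 / s.
have b1 : \sum_i b i ^+ 2 = 1.
  under eq_bigr do rewrite exprMn exprVn.
  by rewrite -mulr_suml -qf_sol sqr_sqrtr ?ltW// divff ?gt_eqF.
have mfl : measurable_fun setT (fun z => f (linmap z)).
  exact: (measurableT_comp mf measurable_linmap).
have -> := Gam_resample b1 mfl (fun z => f0 _).
apply: eq_integral => z _; apply: eq_integral => g _; congr f.
apply: eq_from_tnth => i; rewrite !tnth_mktuple.
have -> : dotf (fun j => (\sum_i0 p i0 * precision Sigma i0 j) / s) (linmap z) = dotf b z.
  rewrite /dotf; under eq_bigr do rewrite tnth_mktuple mulr_sumr.
  rewrite exchange_big /=; apply: eq_bigr => k _.
  under eq_bigr do rewrite mulrA.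
  rewrite -mulr_suml; congr (_ * _).
  under eq_bigr do rewrite mulrAC.
  rewrite -mulr_suml; congr (_ / _).
  have -> : sol p = (precision Sigma *m A)^T *m pcol p.
    by rewrite ThetaE -mulmxA mulVmx// mulmx1 trmxK.
  rewrite mxE; transitivity (\sum_j \sum_l p l * precision Sigma l j * A j k).
    by apply: eq_bigr => j _; rewrite mulr_suml.
  rewrite exchange_big; apply: eq_bigr => j _; rewrite !mxE mulr_suml.
  by apply: eq_bigr => l _; ring.
have -> : p i / s = \sum_k A i k * b k.
  under eq_bigr do rewrite mulrA.
  rewrite -mulr_suml; congr (_ / _).
  have : A *m sol p = pcol p by rewrite mulKVmx.
  by move=> /matrixP/(_ i 0); rewrite !mxE => <-.
rewrite -/s mulr_sumr -big_split /=; apply: eq_bigr => k _.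
by rewrite tnth_mktuple mulrDr mulrCA.
Qed.

End factor.
End resX.

(* mu is invariant under replacing, in each sample, the component along p by a
   fresh draw from its conditional law given the rest. *)
Definition resample_inv {R : realType} {h n} (Theta : 'M[R]_n)
    (mu : probability (h.-tuple (n.-tuple R)) R) :=
  forall p f, (exists i, p i != 0) -> measurable_fun setT f -> (forall x, 0 <= f x)%E ->
  (\int[mu]_x f x = \int[mu]_x \int[Gam h]_v f (zipres (resX Theta p) x v))%E.

Section sample_law.
Context {d} {T : measurableType d} {R : realType} {P : probability T R}.
Context {n : nat}.

Lemma law_standard_normals (Z : 'I_n -> {RV P >-> R}) :
  mutually_independent Z -> (forall k, standard_normal (Z k)) ->
  forall A, measurable A -> distribution P (tupleRV Z) A = Gam n A.
Proof.
move=> indZ sZ A mA; rewrite law_tupleRV// GamE.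
apply: tuple_measure_unique => //.
  by rewrite (le_lt_trans (probability_le1 _ measurableT))// ltry.
move=> B mB; apply: (etrans (prodP_box _ mB)).
apply: (etrans _ (esym (prodP_box _ mB))).
by apply: eq_bigr => i _; rewrite gamE; exact: sZ.
Qed.

Lemma resample_gaussian (Sigma : 'M[R]_n) (X : {RV P >-> n.-tuple R}) :
  Sigma \in unitmx -> centered_gaussian Sigma X ->
  forall p f, (exists i, p i != 0) -> measurable_fun setT f -> (forall x, 0 <= f x)%E ->
  (\int[distribution P X]_x f x =
   \int[distribution P X]_x \int[gam]_g f (resX (precision Sigma) p x g))%E.
Proof.
move=> Su [A [Z [AE indZ sZ XE]]] p f p0 mf f0.
have XZ t : X t = linmap A (tupleRV Z t).
  apply: eq_from_tnth => i; rewrite XE tnth_mktuple.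
  by apply: eq_bigr => k _; rewrite tnth_mktuple.
have lawE (F : n.-tuple R -> \bar R) : measurable_fun setT F -> (forall x, 0 <= F x)%E ->
    (\int[distribution P X]_x F x = \int[Gam n]_z F (linmap A z))%E.
  move=> mF F0; rewrite ge0_integral_pushforward//.
  have mFl : measurable_fun setT (fun z => F (linmap A z)).
    exact: (measurableT_comp mF (measurable_linmap A)).
  transitivity (\int[distribution P (tupleRV Z)]_z F (linmap A z))%E.
    rewrite ge0_integral_pushforward//.
    by apply: eq_integral => t _; rewrite /= XZ.
  by apply: eq_measure_integral => B mB _; exact: law_standard_normals.
have mF : measurable_fun setT (fun x =>
    \int[gam]_g f (resX (precision Sigma) p x g))%E.
  apply: measurable_integral => //.
  by apply: (measurableT_comp mf); exact: measurable_resX.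
have -> := lawE _ mf f0.
have -> := lawE _ mF (fun x => integral_ge0 _ (fun g _ => f0 _)).
exact: resample_linmap.
Qed.

Lemma resample_inv_samples h (Sigma : 'M[R]_n) (X : 'I_h -> {RV P >-> n.-tuple R}) :
  Sigma \in unitmx -> (forall s, centered_gaussian Sigma (X s)) ->
  resample_inv (precision Sigma) (prodP (fun s => distribution P (X s))).
Proof.
move=> Su gX p f p0 mf f0; rewrite GamE.
apply: resample_tuple => //; first exact: measurable_resX.
by move=> i F mF F0; exact: resample_gaussian.
Qed.

End sample_law.

(** * Projections of Gaussian vectors *)

Section dotr.
Context {R : realType} {h : nat}.
Implicit Types (u v w q : 'rV[R]_h) (qs : seq 'rV[R]_h).

Definition dotr u v : R := \sum_s u 0 s * v 0 s.

Lemma dotrC u v : dotr u v = dotr v u.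
Proof. by apply: eq_bigr => s _; rewrite mulrC. Qed.

Lemma dotrDl u v w : dotr (u + v) w = dotr u w + dotr v w.
Proof. by rewrite /dotr -big_split; apply: eq_bigr => s _; rewrite mxE mulrDl. Qed.

Lemma dotrZl a u v : dotr (a *: u) v = a * dotr u v.
Proof. by rewrite /dotr mulr_sumr; apply: eq_bigr => s _; rewrite mxE mulrA. Qed.

Lemma dotrDr u v w : dotr w (u + v) = dotr w u + dotr w v.
Proof. by rewrite dotrC dotrDl !(dotrC w). Qed.

Lemma dotrZr a u v : dotr u (a *: v) = a * dotr u v.
Proof. by rewrite dotrC dotrZl dotrC. Qed.

Lemma dotrNl u v : dotr (- u) v = - dotr u v.
Proof. by rewrite -scaleN1r dotrZl mulN1r. Qed.

Lemma dotrNr u v : dotr u (- v) = - dotr u v.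
Proof. by rewrite dotrC dotrNl dotrC. Qed.

Lemma dotrBl u v w : dotr (u - v) w = dotr u w - dotr v w.
Proof. by rewrite dotrDl dotrNl. Qed.

Lemma dotrBr u v w : dotr w (u - v) = dotr w u - dotr w v.
Proof. by rewrite dotrDr dotrNr. Qed.

Lemma dot0r v : dotr 0 v = 0.
Proof. by rewrite /dotr big1// => s _; rewrite mxE mul0r. Qed.

Lemma dotr0 v : dotr v 0 = 0.
Proof. by rewrite dotrC dot0r. Qed.

Lemma dotr_suml I (r : seq I) (F : I -> 'rV_h) (p : pred I) v :
  dotr (\sum_(i <- r | p i) F i) v = \sum_(i <- r | p i) dotr (F i) v.
Proof.
elim/big_rec2: _ => [|i x y _ <-]; first exact: dot0r.
by rewrite dotrDl.
Qed.

Lemma dotr_sumr I (r : seq I) (F : I -> 'rV_h) (p : pred I) v :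
  dotr v (\sum_(i <- r | p i) F i) = \sum_(i <- r | p i) dotr v (F i).
Proof. by rewrite dotrC dotr_suml; apply: eq_bigr => i _; rewrite dotrC. Qed.

Lemma dotrr_ge0 u : 0 <= dotr u u.
Proof. by apply: sumr_ge0 => s _; rewrite -expr2 sqr_ge0. Qed.

Lemma dotrr_eq0 u : (dotr u u == 0) = (u == 0).
Proof.
apply/eqP/eqP => [|->]; last exact: dot0r.
move=> /eqP; rewrite psumr_eq0; last by move=> s _; rewrite -expr2 sqr_ge0.
move=> /allP u0; apply/rowP => s; rewrite mxE.
by have := u0 s (mem_index_enum s); rewrite /= mulf_eq0 orbb => /eqP.
Qed.

Lemma dotrr_gt0 u : (0 < dotr u u) = (u != 0).
Proof. by rewrite lt_neqAle dotrr_ge0 andbT eq_sym dotrr_eq0. Qed.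

Definition orthon qs := forall i j, (i < size qs)%N -> (j < size qs)%N ->
  dotr qs`_i qs`_j = (i == j)%:R.

(** For orthonormal [qs], the squared norm of the projection of [v]. *)
Definition energy qs v := \sum_(q <- qs) dotr q v ^+ 2.

Definition proj qs v := \sum_(q <- qs) dotr q v *: q.

Lemma dotr_proj qs u v : dotr (proj qs u) v = \sum_(q <- qs) dotr q u * dotr q v.
Proof. by rewrite dotr_suml; apply: eq_bigr => q _; rewrite dotrZl. Qed.

Lemma dotr_proj_sym qs u v : dotr (proj qs u) v = dotr u (proj qs v).
Proof.
by rewrite dotr_proj [RHS]dotrC dotr_proj; apply: eq_bigr => q _; rewrite mulrC.
Qed.

Lemma proj_id qs q : orthon qs -> q \in qs -> proj qs q = q.
Proof.
move=> on /(nthP 0)[i ilt <-].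
rewrite /proj (big_nth 0) big_mkord (bigD1 (Ordinal ilt))//= on// eqxx scale1r.
rewrite big1 ?addr0// => j ji; rewrite on//.
by rewrite (_ : (_ == _) = false) ?scale0r//; exact: negbTE ji.
Qed.

Lemma projD qs u v : proj qs (u + v) = proj qs u + proj qs v.
Proof.
by rewrite /proj -big_split; apply: eq_bigr => q _; rewrite dotrDr scalerDl.
Qed.

Lemma projZ qs a u : proj qs (a *: u) = a *: proj qs u.
Proof.
by rewrite /proj scaler_sumr; apply: eq_bigr => q _; rewrite dotrZr scalerA.
Qed.

Lemma proj0 qs : proj qs 0 = 0.
Proof. by rewrite -[X in proj _ X](scale0r 0) projZ scale0r. Qed.

Lemma energyE qs v : energy qs v = dotr (proj qs v) v.
Proof. by rewrite dotr_proj; apply: eq_bigr => q _; rewrite expr2. Qed.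

Lemma proj_proj qs v : orthon qs -> proj qs (proj qs v) = proj qs v.
Proof.
move=> on; rewrite {2}/proj (big_morph (proj qs) (projD qs) (proj0 qs)).
by apply: eq_big_seq => q qqs; rewrite projZ proj_id.
Qed.

Lemma energy_ge0 qs v : 0 <= energy qs v.
Proof. by apply: sumr_ge0 => q _; exact: sqr_ge0. Qed.

Lemma energy_cat qs qs' v : energy (qs ++ qs') v = energy qs v + energy qs' v.
Proof. by rewrite /energy big_cat. Qed.

Lemma energyZ qs a v : energy qs (a *: v) = a ^+ 2 * energy qs v.
Proof.
by rewrite /energy mulr_sumr; apply: eq_bigr => q _; rewrite dotrZr exprMn.
Qed.

End dotr.

(** * Exponential moments of Gaussian quadratic forms *)

Section GamC.
Context {R : realType}.

Definition rowt h (z : h.-tuple R) : 'rV[R]_h := \row_s tnth z s.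

Lemma dotr_rowt h (q : 'rV[R]_h) z : dotr q (rowt z) = dotf (fun s => q 0 s) z.
Proof. by apply: eq_bigr => s _; rewrite mxE. Qed.

Lemma measurable_dotr_rowt d (T : measurableType d) h (q : 'rV[R]_h) (f : T -> h.-tuple R) :
  measurable_fun setT f -> measurable_fun setT (fun t => dotr q (rowt (f t))).
Proof.
move=> mf; under eq_fun do rewrite dotr_rowt; exact: measurable_dotf.
Qed.

Lemma measurable_normsq_rowt d (T : measurableType d) h (f : T -> h.-tuple R) :
  measurable_fun setT f -> measurable_fun setT (fun t => dotr (rowt (f t)) (rowt (f t))).
Proof.
move=> mf; apply: measurable_sum => s; under eq_fun do rewrite !mxE.
by apply: measurable_funM; exact: measurable_tnth_comp.
Qed.

Lemma measurable_energy d (T : measurableType d) h (qs : seq 'rV[R]_h) (f : T -> h.-tuple R) :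
  measurable_fun setT f -> measurable_fun setT (fun t => energy qs (rowt (f t))).
Proof.
move=> mf; apply: measurable_sum => q.
by apply: measurable_funX; exact: measurable_dotr_rowt.
Qed.

Lemma Gam_exp_sum h (F : 'I_h -> R -> R) : (forall s, measurable_fun setT (F s)) ->
  (\int[Gam h]_z (expR (\sum_s F s (tnth z s)))%:E =
   \prod_(s < h) \int[gam]_x (expR (F s x))%:E)%E.
Proof.
elim: h F => [|h IH] F mF.
  rewrite integral_Gam0//; last by under eq_fun do rewrite big_ord0; exact: measurable_cst.
  by rewrite !big_ord0 expR0.
have me n (G : 'I_n -> R -> R) : (forall s, measurable_fun setT (G s)) ->
    measurable_fun setT (fun z : n.-tuple R => (expR (\sum_s G s (tnth z s)))%:E).
  move=> mG; apply/measurable_EFinP; apply: measurableT_comp => //.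
  apply: measurable_sum => s.
  exact: (measurableT_comp (mG s) (measurable_tnth s)).
have -> := integral_GamS (me _ _ mF) (fun z => expR_ge0 _ : (0 <= (expR _)%:E)%E).
pose F' s := F (lift ord0 s).
have mF' s : measurable_fun setT (F' s) by exact: mF.
rewrite big_ord_recl -IH//.
transitivity (\int[gam]_x ((expR (F ord0 x))%:E *
   \int[Gam h]_z (expR (\sum_s F' s (tnth z s)))%:E))%E.
  apply: eq_integral => x _; rewrite -ge0_integralZl//.
  - apply: eq_integral => zs _; rewrite -EFinM -expRD big_ord_recl tnth0.
    congr (expR (_ + _))%:E; apply: eq_bigr => s _.
    by rewrite tnthS.
  - exact: me.
rewrite ge0_integralZr//.
- by apply/measurable_EFinP; apply: measurableT_comp.
- by apply: integral_ge0 => z _; rewrite lee_fin expR_ge0.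
Qed.

Lemma Gam_exp_lin h (s : R) (c : 'rV[R]_h) : 0 < 1 + 2 * s ->
  (\int[Gam h]_z (expR (- s * dotr (rowt z) (rowt z) + dotr c (rowt z)))%:E =
   ((Num.sqrt (1 + 2 * s))^-1 ^+ h * expR (dotr c c / (2 * (1 + 2 * s))))%:E)%E.
Proof.
move=> s0.
transitivity (\int[Gam h]_z (expR (\sum_k (- s * tnth z k ^+ 2 + c 0 k * tnth z k)))%:E)%E.
  apply: eq_integral => z _; rewrite big_split /= -mulr_sumr.
  have -> : dotr (rowt z) (rowt z) = \sum_k tnth z k ^+ 2.
    by apply: eq_bigr => k _; rewrite mxE expr2.
  have -> // : dotr c (rowt z) = \sum_k c 0 k * tnth z k.
  by apply: eq_bigr => k _; rewrite mxE.
rewrite (@Gam_exp_sum h (fun k x => - s * x ^+ 2 + c 0 k * x)); last first.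
  move=> k; apply: measurable_funD; apply: measurable_funM => //.
under eq_bigr do rewrite gam_quad//.
rewrite -(big_morph _ (fun x y => EFinM x y) (erefl (1 : R)%:E)).
rewrite big_split /= prodr_const card_ord -expR_sum -mulr_suml.
have -> // : dotr c c = \sum_k c 0 k ^+ 2.
by apply: eq_bigr => k _; rewrite expr2.
Qed.

(* The quadratic form is linearised by an auxiliary Gaussian vector g:
   exp(t |Q v|^2) = E exp(sqrt(2 t) <g, Q v>). *)
Lemma Gam_exp_energy h (s t : R) (qs : seq 'rV[R]_h) : orthon qs ->
  0 <= t -> 2 * t < 1 + 2 * s ->
  (\int[Gam h]_z (expR (- s * dotr (rowt z) (rowt z) + t * energy qs (rowt z)))%:E =
   ((Num.sqrt (1 + 2 * s))^-1 ^+ h *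
    (Num.sqrt (1 - 2 * t / (1 + 2 * s)))^-1 ^+ size qs)%:E)%E.
Proof.
move=> on t0 ts; set r := size qs; pose k := Num.sqrt (2 * t).
have s0 : 0 < 1 + 2 * s by rewrite (le_lt_trans _ ts)// mulr_ge0.
have k2 : k ^+ 2 = 2 * t by rewrite sqr_sqrtr// mulr_ge0.
pose c (g : r.-tuple R) : 'rV[R]_h := \sum_(a < r) (k * tnth g a) *: qs`_a.
pose e (v : 'rV[R]_h) : 'rV[R]_r := \row_a (k * dotr qs`_a v).
have ce g v : dotr (c g) v = dotr (e v) (rowt g).
  rewrite /c dotr_suml; apply: eq_bigr => a _.
  by rewrite dotrZl !mxE mulrAC.
have cc g : dotr (c g) (c g) = 2 * t * dotr (rowt g) (rowt g).
  rewrite {1}/c dotr_suml mulr_sumr; apply: eq_bigr => a _.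
  rewrite dotrZl /c dotr_sumr (bigD1 a)//= dotrZr on// eqxx mulr1 big1.
    by rewrite !mxE -k2; ring.
  move=> b ba; rewrite dotrZr on//.
  by rewrite (_ : (_ == _) = false) ?mulr0//; rewrite eq_sym; exact: negbTE ba.
transitivity (\int[Gam h]_z \int[Gam r]_g
   (expR (- s * dotr (rowt z) (rowt z) + dotr (c g) (rowt z)))%:E)%E.
  apply: eq_integral => z _.
  have := @Gam_exp_lin r 0 (e (rowt z)) _.
  rewrite !(mulr0, addr0) sqrtr1 invr1 expr1n mul1r => /(_ ltr01) E.
  transitivity (\int[Gam r]_g ((expR (- s * dotr (rowt z) (rowt z)))%:E *
     (expR (dotr (c g) (rowt z)))%:E))%E; last first.
    by apply: eq_integral => g _; rewrite -EFinM -expRD.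
  rewrite ge0_integralZl//.
  - rewrite expRD EFinM; congr (_ * _)%E.
    transitivity (\int[Gam r]_g
        (expR (- 0 * dotr (rowt g) (rowt g) + dotr (e (rowt z)) (rowt g)))%:E)%E; last first.
      by apply: eq_integral => g _; rewrite ce oppr0 mul0r add0r.
    rewrite E; congr (expR _)%:E; rewrite mulr1.
    rewrite /energy (big_nth 0) big_mkord /dotr [X in _ = X / _](eq_bigr (fun a : 'I_r => 2 * t * dotr qs`_a (rowt z) ^+ 2)).
      by rewrite -mulr_sumr; field.
    by move=> a _; rewrite !mxE -k2; ring.
  - apply/measurable_EFinP; apply: measurableT_comp => //.
    by under eq_fun do rewrite ce; exact: measurable_dotr_rowt.
rewrite integral_swap; first last.
- by move=> z g; rewrite lee_fin expR_ge0.
- apply/measurable_EFinP; apply: measurableT_comp => //; apply: measurable_funD.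
    by apply: measurable_funM => //; exact: measurable_normsq_rowt.
  rewrite /c; under eq_fun do rewrite dotr_suml.
  apply: measurable_sum => a; under eq_fun do rewrite dotrZl.
  apply: measurable_funM; last exact: measurable_dotr_rowt.
  by apply: measurable_funM => //; exact: measurable_tnth_comp.
under eq_integral do rewrite Gam_exp_lin// cc.
set A := _ ^+ h.
transitivity (\int[Gam r]_g (A%:E * (expR (- (- (t / (1 + 2 * s))) * dotr (rowt g) (rowt g) + dotr 0 (rowt g)))%:E))%E.
  apply: eq_integral => g _; rewrite EFinM dot0r addr0; congr (_ * (expR _)%:E)%E.
  by field; rewrite gt_eqF.
rewrite ge0_integralZl//.
- rewrite Gam_exp_lin.
    rewrite dot0r mul0r expR0 mulr1 -EFinM; congr (_ * (Num.sqrt _)^-1 ^+ _)%:E.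
    by field; rewrite gt_eqF.
  rewrite mulrN subr_gt0 mulrA ltr_pdivrMr// mul1r//.
- apply/measurable_EFinP; apply: measurableT_comp => //; apply: measurable_funD.
    by apply: measurable_funM => //; exact: measurable_normsq_rowt.
  exact: measurable_dotr_rowt.
- by rewrite lee_fin /A exprn_ge0// invr_ge0 sqrtr_ge0.
Qed.

End GamC.

(** * Gram-Schmidt and distances to subspaces *)

Section orthonormal.
Context {R : realType} {h : nat}.
Implicit Types (u v w q : 'rV[R]_h) (qs ps : seq 'rV[R]_h).

(** A linear subspace given by a predicate. It serves to record that the vectors made by
    Gram-Schmidt are combinations of prescribed columns. *)
Definition span_closed (Pr : 'rV[R]_h -> Prop) :=
  Pr 0 /\ forall a u v, Pr u -> Pr v -> Pr (a *: u + v).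

Lemma orthon_rcons qs q : orthon qs -> dotr q q = 1 ->
  (forall p, p \in qs -> dotr p q = 0) -> orthon (rcons qs q).
Proof.
move=> on q1 qo i j; rewrite size_rcons !ltnS !nth_rcons (leq_eqVlt i) (leq_eqVlt j).
move=> /orP[/eqP->|ilt] /orP[/eqP->|jlt]; rewrite ?ltnn ?eqxx ?q1//.
- by rewrite jlt dotrC qo ?mem_nth// gtn_eqF.
- by rewrite ilt qo ?mem_nth// ltn_eqF.
- by rewrite ilt jlt on.
Qed.

Lemma proj_span qs ps u : orthon ps -> {subset qs <= ps} -> proj ps (proj qs u) = proj qs u.
Proof.
move=> on sub; rewrite {2}/proj (big_morph (proj ps) (projD ps) (proj0 ps)).
by apply: eq_big_seq => q qqs; rewrite projZ proj_id// sub.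
Qed.

Lemma span_closed_proj (Pr : 'rV[R]_h -> Prop) qs u : span_closed Pr ->
  (forall q, q \in qs -> Pr q) -> Pr (proj qs u).
Proof.
move=> [P0 PD] Pq; rewrite /proj; elim: qs Pq => [|q qs IH] Pq.
  by rewrite big_nil.
rewrite big_cons; apply: PD; first exact/Pq/mem_head.
by apply: IH => p ps; apply: Pq; rewrite in_cons ps orbT.
Qed.

(** Gram-Schmidt. A vector already in the span contributes nothing, whence only an upper bound on
    the number of new vectors: columns of data may be dependent. *)
Lemma orthon_extend qs (Ms : seq 'rV[R]_h) : orthon qs ->
  exists ps, [/\ (size ps <= size Ms)%N, orthon (qs ++ ps),
    (forall M, M \in Ms -> proj (qs ++ ps) M = M) &
    forall Pr, span_closed Pr -> (forall M, M \in qs ++ Ms -> Pr M) ->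
      forall q, q \in ps -> Pr q].
Proof.
elim: Ms qs => [|M Ms IH] qs on; first by exists [::]; split; rewrite ?cats0.
pose r := M - proj qs M.
have [r0|r0] := eqVneq r 0.
  have [ps [sz on' fix_ sp]] := IH qs on; exists ps; split => //.
  - exact: leq_trans sz _.
  - move=> N; rewrite in_cons => /orP[/eqP ->|]; last exact: fix_.
    have -> : M = proj qs M by apply/eqP; rewrite -subr_eq0 -/r r0.
    by apply: proj_span => // x xqs; rewrite mem_cat xqs.
  - move=> Pr cl PM; apply: (sp Pr cl) => N NN; apply: PM; move: NN.
    by rewrite !mem_cat in_cons => /orP[->//|->]; rewrite !orbT.
pose q := (Num.sqrt (dotr r r))^-1 *: r.
have rr : 0 < dotr r r by rewrite dotrr_gt0.
have q1 : dotr q q = 1.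
  rewrite dotrZl dotrZr mulrA -invfM -expr2 sqr_sqrtr ?ltW//.
  by rewrite mulVf// gt_eqF.
have qo p : p \in qs -> dotr p q = 0.
  move=> pq; have e : dotr p (proj qs M) = dotr p M.
    by rewrite -dotr_proj_sym (proj_id on pq).
  by rewrite dotrZr (_ : dotr p r = 0) ?mulr0// dotrBr e subrr.
have [ps [sz on' fix_ sp]] := IH _ (orthon_rcons on q1 qo).
rewrite cat_rcons in on' fix_.
exists (q :: ps); split => //.
- move=> N; rewrite in_cons => /orP[/eqP ->|]; last exact: fix_.
  have -> : M = proj qs M + Num.sqrt (dotr r r) *: q.
    by rewrite /q scalerA divff ?gt_eqF ?sqrtr_gt0// scale1r /r addrC subrK.
  rewrite projD projZ (proj_id (q := q)) ?mem_cat ?mem_head ?orbT//.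
  by rewrite proj_span// => x xqs; rewrite mem_cat xqs.
- move=> Pr cl PM.
  have Pq : Pr q.
    have [P0 PD] := cl; rewrite /q -[_ *: r]addr0; apply: (PD _ _ _ _ P0).
    rewrite /r addrC -scaleN1r; apply: cl.2.
      by apply: span_closed_proj => // x xq; apply: PM; rewrite mem_cat xq.
    by apply: PM; rewrite mem_cat mem_head orbT.
  move=> p; rewrite in_cons => /orP[/eqP->//|pps].
  apply: (sp Pr cl) pps => N; rewrite mem_cat mem_rcons in_cons.
  move=> /orP[/orP[/eqP->//|Nq]|Nq]; apply: PM; rewrite mem_cat.
    by rewrite Nq.
  by rewrite in_cons Nq !orbT.
Qed.

(** Pythagoras: the two sides differ by the squared norm of u - proj qs y. *)
Lemma dist_energy_le qs y u : orthon qs -> proj qs u = u ->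
  dotr y y - energy qs y <= dotr (y - u) (y - u).
Proof.
move=> on pu.
have := dotrr_ge0 (u - proj qs y).
rewrite !(dotrBl, dotrBr) (dotr_proj_sym _ y (proj _ _)) proj_proj//.
rewrite (dotrC _ (proj qs y)) energyE dotr_proj_sym pu.
rewrite (dotrC y (proj qs y)) (dotrC u y) (dotr_proj_sym _ y y) .
by rewrite (dotrC y (proj _ _)); lra.
Qed.

Lemma dist_proj qs y : orthon qs ->
  dotr (y - proj qs y) (y - proj qs y) = dotr y y - energy qs y.
Proof.
move=> on; rewrite !(dotrBl, dotrBr) (dotr_proj_sym _ y (proj _ _)) proj_proj//.
by rewrite energyE (dotrC y (proj _ _)); lra.
Qed.

Lemma energy_le_normsq qs y : orthon qs -> energy qs y <= dotr y y.
Proof. by move=> on; rewrite -subr_ge0 -dist_proj// dotrr_ge0. Qed.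

End orthonormal.

(** * Least squares *)

Section rho.
Context {R : realType} {h n : nat}.
Implicit Types (x : h.-tuple (n.-tuple R)) (w c : 'I_n -> R) (S : {set 'I_n})
  (y u : 'rV[R]_h) (qs ps : seq 'rV[R]_h).

Definition colv x k : 'rV[R]_h := \row_s tnth (tnth x s) k.

Definition comb x w : 'rV[R]_h := \sum_k w k *: colv x k.

Definition supported S w := forall j, j \notin S -> w j = 0.

Lemma combE x w s : comb x w 0 s = \sum_k w k * tnth (tnth x s) k.
Proof. by rewrite summxE; apply: eq_bigr => k _; rewrite !mxE. Qed.

Lemma comb_lin x a w c : comb x (fun k => a * w k + c k) = a *: comb x w + comb x c.
Proof.
rewrite /comb scaler_sumr -big_split; apply: eq_bigr => k _.
by rewrite scalerDl scalerA.
Qed.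

Lemma supported_lin S a w c : supported S w -> supported S c ->
  supported S (fun k => a * w k + c k).
Proof. by move=> sw sc j jS; rewrite sw// sc// mulr0 addr0. Qed.

Lemma comb_supported x x' S w : supported S w ->
  (forall j, j \in S -> colv x j = colv x' j) -> comb x w = comb x' w.
Proof.
move=> sw e; apply: eq_bigr => j _; have [jS|jS] := boolP (j \in S).
  by rewrite e.
by rewrite sw// !scale0r.
Qed.

Lemma colv_comb x j : colv x j = comb x (fun k => (k == j)%:R).
Proof.
rewrite /comb (bigD1 j)//= eqxx scale1r big1 ?addr0// => k kj.
by rewrite (negbTE kj) scale0r.
Qed.

Lemma supported_delta S j : j \in S -> supported S (fun k => (k == j)%:R).
Proof. by move=> jS k kS; case: eqP => // kj; rewrite kj jS in kS. Qed.

Definition dist2 x y w : R := dotr (y - comb x w) (y - comb x w).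

(** The response [y] is kept apart from the data [x], because resampling can change the response and
    leave the regressors alone, or conversely. *)
Definition rhov x y S : R := inf [set dist2 x y w | w in [set w | supported S w]].

(** The span of [qs] contains the columns in [S] but, in contrast to [onb], may be larger; this
    still bounds residuals from below. *)
Definition fixes x S qs := forall j, j \in S -> proj qs (colv x j) = colv x j.

Lemma fixes_comb x S qs w : fixes x S qs -> supported S w ->
  proj qs (comb x w) = comb x w.
Proof.
move=> fx sw; rewrite /comb (big_morph (proj qs) (projD qs) (proj0 qs)).
apply: eq_bigr => k _; rewrite projZ; have [kS|kS] := boolP (k \in S).
  by rewrite fx.
by rewrite sw// !scale0r.
Qed.

Definition onb x S qs := [/\ orthon qs, fixes x S qs &
  forall q, q \in qs -> exists2 w, supported S w & q = comb x w].

Lemma span_closed_comb x S : span_closed (fun u => exists2 w, supported S w & u = comb x w).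
Proof.
split.
  by exists (fun=> 0) => //; rewrite /comb big1// => k _; rewrite scale0r.
move=> a u v [w sw ->] [w' sw' ->]; exists (fun k => a * w k + w' k).
  exact: supported_lin.
by rewrite comb_lin.
Qed.

Lemma onb_exists x S : exists2 qs, onb x S qs & (size qs <= #|S|)%N.
Proof.
have on0 : orthon ([::] : seq 'rV[R]_h) by [].
have [ps [sz on fx sp]] := orthon_extend [seq colv x j | j <- enum S] on0.
exists ps; last by move: sz; rewrite size_map -cardE.
split => //.
  by move=> j jS; apply: fx; rewrite map_f// mem_enum.
apply: (sp _ (span_closed_comb x S)) => M /mapP[j]; rewrite mem_enum => jS ->.
by exists (fun k => (k == j)%:R); [exact: supported_delta|exact: colv_comb].
Qed.

Lemma onb_extend x S S' qs : onb x S qs -> S \subset S' ->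
  exists2 ps, onb x S' (qs ++ ps) & (size ps <= #|S' :\: S|)%N.
Proof.
move=> [on fx sp] SS'.
have [ps [sz on' fx' sp']] := orthon_extend [seq colv x j | j <- enum (S' :\: S)] on.
exists ps; last by move: sz; rewrite size_map -cardE.
have sub q : q \in qs -> exists2 w, supported S' w & q = comb x w.
  move=> /sp[w sw ->]; exists w => // j jS'; apply: sw.
  by apply: contra jS'; exact: (fintype.subsetP SS').
split => //.
  move=> j jS'; have [jS|jS] := boolP (j \in S).
    by rewrite -(fx _ jS) proj_span// => q qq; rewrite mem_cat qq.
  by apply: fx'; rewrite map_f// mem_enum inE jS.
move=> q; rewrite mem_cat => /orP[|]; first exact: sub.
apply: (sp' _ (span_closed_comb x S')) => M; rewrite mem_cat => /orP[|]; first exact: sub.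
move=> /mapP[j]; rewrite mem_enum inE => /andP[_ jS] ->.
by exists (fun k => (k == j)%:R); [exact: supported_delta|exact: colv_comb].
Qed.

Lemma has_inf_dist2 x y S :
  has_inf [set dist2 x y w | w in [set w | supported S w]].
Proof.
split.
  by exists (dist2 x y (fun=> 0)); exists (fun=> 0).
by exists 0 => _ [w _ <-]; exact: dotrr_ge0.
Qed.

Lemma rhov_le x y S w : supported S w -> rhov x y S <= dist2 x y w.
Proof.
move=> sw; apply: ge_inf; last by exists w.
by exists 0 => _ [v _ <-]; exact: dotrr_ge0.
Qed.

Lemma fixes_le_rhov x y S qs : orthon qs -> fixes x S qs ->
  dotr y y - energy qs y <= rhov x y S.
Proof.
move=> on fx; apply: lb_le_inf; first by have [] := has_inf_dist2 x y S.
by move=> _ [w sw <-]; apply: dist_energy_le => //; exact: fixes_comb sw.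
Qed.

Lemma proj_comb x S qs y : onb x S qs -> exists2 w, supported S w & proj qs y = comb x w.
Proof. by move=> [_ _ sp]; exact: (span_closed_proj _ (span_closed_comb x S)). Qed.

Lemma rhovE x y S qs : onb x S qs -> rhov x y S = dotr y y - energy qs y.
Proof.
move=> ob; have [on fx sp] := ob; apply/eqP; rewrite eq_le fixes_le_rhov// andbT.
have [w sw pw] := proj_comb y ob.
by rewrite -dist_proj// pw; exact: rhov_le.
Qed.

Lemma rhov_attained x y S : exists2 w, supported S w & dist2 x y w = rhov x y S.
Proof.
have [qs ob _] := onb_exists x S; have [w sw pw] := proj_comb y ob.
by exists w => //; rewrite (rhovE y ob) -dist_proj ?pw//; case: ob.
Qed.

Lemma rhov_ge0 x y S : 0 <= rhov x y S.
Proof. by have [w _ <-] := rhov_attained x y S; exact: dotrr_ge0. Qed.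

Lemma rhov_subset x y S S' : S \subset S' -> rhov x y S' <= rhov x y S.
Proof.
move=> SS'; have [w sw <-] := rhov_attained x y S; apply: rhov_le.
by move=> j jS'; apply: sw; apply: contra jS'; exact: (fintype.subsetP SS').
Qed.

Lemma dist2_addcomb x y w c :
  dist2 x (y + comb x c) (fun k => w k + c k) = dist2 x y w.
Proof.
rewrite /dist2; have -> : comb x (fun k => w k + c k) = comb x w + comb x c.
  rewrite -[X in X + _]scale1r -comb_lin; congr comb.
  by apply/funext => k; rewrite mul1r.
by rewrite opprD addrACA subrr addr0.
Qed.

Lemma comb_opp x c : comb x (fun k => - c k) = - comb x c.
Proof.
by rewrite /comb -sumrN; apply: eq_bigr => k _; rewrite scaleNr.
Qed.

Lemma rhov_addcomb x y S c : supported S c -> rhov x (y + comb x c) S = rhov x y S.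
Proof.
have half y' c' : supported S c' -> rhov x (y' + comb x c') S <= rhov x y' S.
  move=> sc; have [w sw <-] := rhov_attained x y' S.
  rewrite -(dist2_addcomb _ _ _ c'); apply: rhov_le => j jS.
  by rewrite sw// sc// addr0.
move=> sc; apply/eqP; rewrite eq_le half//=.
rewrite -{1}[y](addrK (comb x c)) -comb_opp; apply: half => j jS.
by rewrite sc// oppr0.
Qed.

Lemma rhov_eqcols x x' y S : (forall j, j \in S -> colv x j = colv x' j) ->
  rhov x y S = rhov x' y S.
Proof.
move=> e; have half z z' : (forall j, j \in S -> colv z j = colv z' j) ->
    rhov z y S <= rhov z' y S.
  move=> e'; have [w sw <-] := rhov_attained z' y S.
  by rewrite /dist2 -(comb_supported sw e'); exact: rhov_le.
by apply/eqP; rewrite eq_le !half// => j jS; rewrite e.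
Qed.

End rho.

(** * Measurability of residual sums of squares *)

Section measurability.
Context {R : realType} {h n : nat}.
Local Notation data := (h.-tuple (n.-tuple R)).

(** The response is a combination of columns: X_i itself for c = [delta i], its regression function
    for c = [wstar Theta i]. *)
Definition rho (c : 'I_n -> R) (S : {set 'I_n}) (x : data) : R := rhov x (comb x c) S.

Definition quant (k : nat) (r : R) : R := (Num.floor (r * k.+1%:R))%:~R / k.+1%:R.

Lemma quant0 k : quant k 0 = 0.
Proof. by rewrite /quant mul0r floor0 mul0r. Qed.

Lemma cvg_quant r : quant ^~ r @ \oo --> r.
Proof.
apply: (@squeeze_cvgr _ _ _ _ (fun k => r - k.+1%:R^-1) (cst r)).
- apply: nearW => k; rewrite /quant.
  have k0 : (0 : R) < k.+1%:R by rewrite ltr0n.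
  rewrite ler_pdivrMr// ler_pdivlMr//.
  rewrite mulrBl mulVf ?gt_eqF// floor_le andbT lerBlDr.
  by have := floorD1_gt (r * k.+1%:R); rewrite intrD => /ltW.
- rewrite -[X in _ --> X]subr0; apply: cvgB; first exact: cvg_cst.
  exact: cvg_harmonic.
- exact: cvg_cst.
Qed.

Lemma cvg_bigsum I (r : seq I) (f : I -> nat -> R) (a : I -> R) :
  (forall i, f i @ \oo --> a i) ->
  (fun k => \sum_(i <- r) f i k) @ \oo --> \sum_(i <- r) a i.
Proof.
move=> fa; elim: r => [|i r IH].
  by rewrite big_nil; under eq_fun do rewrite big_nil; exact: cvg_cst.
rewrite big_cons; under eq_fun do rewrite big_cons; exact: cvgD.
Qed.

Lemma dist2E (x : data) c w :
  dist2 x (comb x c) w = \sum_s (\sum_k (c k - w k) * tnth (tnth x s) k) ^+ 2.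
Proof.
apply: eq_bigr => s _; rewrite 2!mxE !combE -expr2 -sumrB.
by congr (_ ^+ 2); apply: eq_bigr => k _; rewrite mulrBl.
Qed.

Lemma cvg_dist2_quant (x : data) c w :
  (fun k => dist2 x (comb x c) (fun j => quant k (w j))) @ \oo --> dist2 x (comb x c) w.
Proof.
rewrite dist2E; under eq_fun do rewrite dist2E.
apply: cvg_bigsum => s; rewrite expr2; under eq_fun do rewrite expr2.
suff H : (fun k => \sum_k0 (c k0 - quant k (w k0)) * tnth (tnth x s) k0) @ \oo -->
   \sum_k (c k - w k) * tnth (tnth x s) k by exact: cvgM.
apply: cvg_bigsum => j; apply: cvgM; last exact: cvg_cst.
by apply: cvgB; [exact: cvg_cst|exact: cvg_quant].
Qed.

Lemma measurable_colv_entry s k : measurable_fun setT (fun x : data => tnth (tnth x s) k).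
Proof.
by apply: (@measurable_tnth_comp _ _ data R n k (fun x => tnth x s)); exact: measurable_tnth.
Qed.

Lemma measurable_dist2 c w : measurable_fun setT (fun x : data => dist2 x (comb x c) w).
Proof.
under eq_fun do rewrite dist2E.
apply: measurable_sum => s; apply: measurable_funX; apply: measurable_sum => k.
by apply: measurable_funM => //; exact: measurable_colv_entry.
Qed.

(** The infimum is over uncountably many weights. By continuity a value below [a] persists after
    rounding the optimal weights to multiples of 1 / (k + 1), which leaves a countable union.
    Rounding fixes 0 and so preserves supports. *)
Lemma measurable_rho c S : measurable_fun setT (rho c S).
Proof.
apply: (measurability _ (RGenInftyO.measurableE R)) => // _ [_ [a ->] <-].
rewrite setTI.
pose W (km : nat * {ffun 'I_n -> int}) (j : 'I_n) : R :=
  if j \in S then (km.2 j)%:~R / km.1.+1%:R else 0.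
rewrite (_ : _ @^-1` _ = \bigcup_km [set x : data | dist2 x (comb x c) (W km) < a]).
  apply: countable_bigcupT_measurable => [|km]; first exact: countableP.
  rewrite (_ : mkset _ = (fun x : data => dist2 x (comb x c) (W km)) @^-1` `]-oo, a[).
    rewrite -[X in measurable X]setTI; apply: measurable_dist2 => //.
  by apply/seteqP; split => x /=; rewrite in_itv.
apply/seteqP; split => x /=.
  rewrite in_itv /= => xa.
  have [w sw wE] := rhov_attained x (comb x c) S.
  have := @cvgr_lt _ _ _ _ _ _ (@cvg_dist2_quant x c w) a.
  rewrite wE => /(_ _ xa)[N _ /(_ N (leqnn N)) /= ltN].
  exists (N, [ffun j => Num.floor (w j * N.+1%:R)]) => //=.
  rewrite (_ : W _ = fun j => quant N (w j))//.
  apply/funext => j; rewrite /W /= ffunE; case: ifPn => // jS.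
  by rewrite sw// quant0.
move=> [km _ /= lta]; rewrite in_itv/=; apply: le_lt_trans lta.
by apply: rhov_le => j jS; rewrite /W (negbTE jS).
Qed.

End measurability.

(** * Effect of resampling on residuals *)

Lemma markov_exp {d} {T : measurableType d} {R : realType} (mu : probability T R)
    (G : T -> R) (A : set T) : measurable A -> measurable_fun setT G ->
  (forall x, A x -> 0 <= G x) -> (mu A <= \int[mu]_x (expR (G x))%:E)%E.
Proof.
move=> mA mG AG; rewrite -[mu A]mul1e -integral_cst//.
have me : measurable_fun setT (fun x => (expR (G x))%:E).
  by apply/measurable_EFinP; exact: measurableT_comp.
apply: (@le_trans _ _ (\int[mu]_(x in A) (expR (G x))%:E)%E).
  apply: ge0_le_integral => //.
  - exact: measurable_funTS.
  - by move=> x /AG G0; rewrite lee_fin -expR0 ler_expR.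
by apply: ge0_subset_integral.
Qed.

Lemma measurable_le_set {d} {T : measurableType d} {R : realType} (f g : T -> R) :
  measurable_fun setT f -> measurable_fun setT g -> measurable [set x | f x <= g x].
Proof.
move=> mf mg; rewrite (_ : mkset _ = (fun x => g x - f x) @^-1` `[0, +oo[).
  by rewrite -[X in measurable X]setTI; exact: measurable_funB.
by apply/seteqP; split => x /=; rewrite in_itv/= andbT subr_ge0.
Qed.

Lemma prob_le_expR {d} {T : measurableType d} {R : realType} (mu : probability T R)
    (G f g : T -> R) (b : \bar R) :
  measurable_fun setT f -> measurable_fun setT g -> measurable_fun setT G ->
  (forall x, f x <= g x -> 0 <= G x) -> (\int[mu]_x (expR (G x))%:E <= b)%E ->
  (mu [set x | (f x <= g x)%R] <= b)%E.
Proof.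
move=> mf mg mG fG; apply: le_trans; apply: markov_exp => //.
exact: measurable_le_set.
Qed.

Section resampled_columns.
Context {R : realType} {h n : nat}.
Variable Theta : 'M[R]_n.
Hypothesis pd : posdef Theta.
Implicit Types (x : h.-tuple (n.-tuple R)) (p c w : 'I_n -> R) (S W : {set 'I_n}).

Definition delta (i j : 'I_n) : R := (j == i)%:R.

Lemma comb_delta x i : comb x (delta i) = colv x i.
Proof. by rewrite colv_comb. Qed.

(** The components along [p] discarded by resampling, one for each sample. *)
Definition resa p x : 'rV[R]_h :=
  \row_s dotf (fun j => (\sum_i p i * Theta i j) / Num.sqrt (qf Theta p)) (tnth x s).

Lemma colv_res p x v k : colv (zipres (resX Theta p) x v) k =
  colv x k + (p k / Num.sqrt (qf Theta p)) *: (rowt v - resa p x).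
Proof.
by apply/rowP => s; rewrite !mxE !tnth_mktuple mulrC.
Qed.

Lemma colv_res0 p x v k : p k = 0 -> colv (zipres (resX Theta p) x v) k = colv x k.
Proof. by move=> pk; rewrite colv_res pk mul0r scale0r addr0. Qed.

Lemma comb_res p x v c : comb (zipres (resX Theta p) x v) c =
  comb x c + ((\sum_k c k * p k) / Num.sqrt (qf Theta p)) *: (rowt v - resa p x).
Proof.
rewrite /comb mulr_suml scaler_suml -big_split; apply: eq_bigr => k _.
by rewrite colv_res scalerDr scalerA mulrA.
Qed.

Lemma dotr_sqD (a b : 'rV[R]_h) :
  dotr (a + b) (a + b) = dotr a a + 2 * dotr a b + dotr b b.
Proof. by rewrite !(dotrDl, dotrDr) (dotrC b a); ring. Qed.

Lemma delta_notin i j S : i \notin S -> j \in S -> delta i j = 0.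
Proof. by move=> iS jS; rewrite /delta; case: eqP => // ji; rewrite -ji jS in iS. Qed.

Lemma delta_neq0 i : exists j, delta i j != 0.
Proof. by exists i; rewrite /delta eqxx oner_neq0. Qed.

Lemma sum_delta i (F : 'I_n -> R) : \sum_j delta i j * F j = F i.
Proof.
rewrite (bigD1 i)//= /delta eqxx mul1r big1 ?addr0// => j ji.
by rewrite (negbTE ji) mul0r.
Qed.

Lemma qf_delta i : qf Theta (delta i) = Theta i i.
Proof.
rewrite /qf; under eq_bigr => j _ do under eq_bigr do rewrite -mulrA.
under eq_bigr do rewrite -mulr_sumr.
by rewrite sum_delta; under eq_bigr do rewrite mulrC; rewrite sum_delta.
Qed.

Lemma Theta_gt0 i : 0 < Theta i i.
Proof. by rewrite -qf_delta; apply: pd.2; exact: delta_neq0. Qed.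

(* Coefficients of the regression of X_i on the other coordinates. *)
Definition wstar i j : R := if j == i then 0 else - (Theta i j / Theta i i).

Lemma supported_wstar i : supported (neighbors Theta i) (wstar i).
Proof.
move=> j; rewrite /wstar inE; case: eqP => //= _.
by rewrite negbK => /eqP ->; rewrite mul0r oppr0.
Qed.

(** Resampling along the i-th unit vector exhibits X_i as its regression on the other coordinates
    plus fresh noise of variance 1 / Theta_ii. *)
Lemma colv_res_self i x v : colv (zipres (resX Theta (delta i)) x v) i =
  comb x (wstar i) + (Num.sqrt (Theta i i))^-1 *: rowt v.
Proof.
have t0 := Theta_gt0 i.
have q0 : 0 < Num.sqrt (Theta i i) by rewrite sqrtr_gt0.
have dii : delta i i = 1 by rewrite /delta eqxx.
rewrite colv_res qf_delta dii mul1r scalerBr addrCA addrC; congr (_ + _).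
apply/rowP => s; rewrite !mxE combE /dotf.
under eq_bigr do rewrite sum_delta.
rewrite qf_delta mulr_sumr [in LHS](bigD1 i)//= [in RHS](bigD1 i)//=.
rewrite {1}/wstar eqxx mul0r add0r opprD addrA.
have -> : (Num.sqrt (Theta i i))^-1 * (Theta i i / Num.sqrt (Theta i i) * tnth (tnth x s) i)
    = tnth (tnth x s) i.
  by rewrite -{2}(sqr_sqrtr (ltW t0)); field; rewrite gt_eqF.
rewrite subrr add0r -sumrN; apply: eq_bigr => j ji.
rewrite /wstar (negbTE ji) -{3}(sqr_sqrtr (ltW t0)); field.
by rewrite gt_eqF.
Qed.

Lemma rho_res_self i S x v : i \notin S ->
  rho (delta i) S (zipres (resX Theta (delta i)) x v) =
  rhov x (comb x (wstar i) + (Num.sqrt (Theta i i))^-1 *: rowt v) S.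
Proof.
move=> iS; rewrite /rho comb_delta colv_res_self; apply: rhov_eqcols => j jS.
by rewrite colv_res0// (delta_notin iS).
Qed.

(** The regression function lies in the span of the columns in [W], hence only the residual of the
    noise remains. *)
Lemma rho_res_self_nb i W x v : i \notin W -> neighbors Theta i \subset W ->
  forall qs, onb x W qs ->
  Theta i i * rho (delta i) W (zipres (resX Theta (delta i)) x v) =
  dotr (rowt v) (rowt v) - energy qs (rowt v).
Proof.
move=> iW NW qs ob; have t0 := Theta_gt0 i.
rewrite rho_res_self// addrC rhov_addcomb; last first.
  by move=> j jW; apply: supported_wstar; apply: contra jW; exact: (fintype.subsetP NW).
rewrite (rhovE _ ob) dotrZl dotrZr energyZ mulrA -expr2 -mulrBr mulrA exprVn.
by rewrite sqr_sqrtr ?ltW// mulfV ?mul1r// gt_eqF.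
Qed.

(* The loss of accuracy when regressing on S instead of W, which contains all
   neighbors: signal, cross term, and overfitting on S \ W. *)
Lemma rho_diff_le i S W x : i \notin S -> i \notin W -> neighbors Theta i \subset W ->
  exists u : 'rV[R]_h, exists ps : seq 'rV[R]_h,
  [/\ orthon ps, (size ps <= #|S :\: W|)%N, dotr u u = Theta i i * rho (wstar i) S x &
  forall v, Theta i i * (rho (delta i) W (zipres (resX Theta (delta i)) x v) -
               rho (delta i) S (zipres (resX Theta (delta i)) x v)) <=
     - dotr u u - 2 * dotr u (rowt v) + energy ps (rowt v)].
Proof.
move=> iS iW NW; have t0 := Theta_gt0 i.
have q0 : 0 < Num.sqrt (Theta i i) by rewrite sqrtr_gt0.
pose y := comb x (wstar i).
have [qs obS _] := onb_exists x S.
have [qw obW _] := onb_exists x W.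
(* Extending a basis for W to one for W :|: S bounds the noise explained by S: at most what W
   explains plus the energy of [ps]. *)
have [ps obWS szps] := onb_extend obW (finset.subsetUl W S).
have [onS _ _] := obS; have [onWS fxWS _] := obWS.
pose u0 := y - proj qs y.
have Pu0 : proj qs u0 = 0.
  by rewrite /u0 -scaleN1r projD projZ proj_proj// scaleN1r subrr.
have u0E : dotr u0 u0 = rho (wstar i) S x.
  by rewrite /u0 dist_proj// /rho (rhovE _ obS).
exists (Num.sqrt (Theta i i) *: u0); exists ps; split.
- move=> a b ha hb; have := onWS (size qw + a)%N (size qw + b)%N.
  rewrite size_cat !ltn_add2l => /(_ ha hb).
  rewrite !nth_cat !ltnNge !leq_addr /= !addKn => ->.
  by rewrite eqn_add2l.
- apply: leq_trans szps _; apply: subset_leq_card; apply/fintype.subsetP => j.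
  by rewrite !inE; case: (j \in W).
- by rewrite dotrZl dotrZr u0E mulrA -expr2 sqr_sqrtr ?ltW.
move=> v; rewrite mulrBr (rho_res_self_nb v iW NW obW) rho_res_self// -/y.
set z := _ *: rowt v.
rewrite (rhovE _ obS).
have e1 : dotr (y + z) (y + z) - energy qs (y + z) =
    dotr u0 u0 + 2 * dotr u0 z + (dotr z z - energy qs z).
  have e : y + z - (proj qs y + proj qs z) = u0 + (z - proj qs z).
    by rewrite /u0 opprD addrACA.
  have c (w : 'rV[R]_h) : dotr u0 (proj qs w) = 0 by rewrite -dotr_proj_sym Pu0 dot0r.
  rewrite -!dist_proj// projD e.
  by rewrite dotr_sqD (dotrBr z) c subr0.
rewrite e1 /z !dotrZl !dotrZr u0E energyZ.
have en : energy qs (rowt v) <= energy qw (rowt v) + energy ps (rowt v).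
  rewrite -energy_cat.
  have fxS : fixes x S (qw ++ ps) by move=> j jS; apply: fxWS; rewrite inE jS orbT.
  have := fixes_le_rhov (rowt v) onWS fxS; rewrite (rhovE _ obS).
  by rewrite lerD2l lerN2.
have tq : Theta i i = Num.sqrt (Theta i i) ^+ 2 by rewrite sqr_sqrtr ?ltW.
set q := Num.sqrt _ in q0 tq *; rewrite tq.
rewrite exprVn (_ : q ^+ 2 * _ = q ^+ 2 * rho (wstar i) S x + 2 * q * dotr u0 (rowt v)
  + (dotr (rowt v) (rowt v) - energy qs (rowt v))); last first.
  by field; rewrite gt_eqF.
by lra.
Qed.

End resampled_columns.

(** * Signal of the missing neighbors *)

Section attractive.
Context {R : realType} {n : nat}.
Variables (Theta : 'M[R]_n) (kappa : R).
Hypotheses (pd : posdef Theta) (att : attractive Theta) (k0 : 0 < kappa)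
  (nd : nondegenerate kappa Theta).
Implicit Types (K S : {set 'I_n}).

Let t0 i : 0 < Theta i i := Theta_gt0 pd i.

Lemma partial_corr_ge i j : j \in neighbors Theta i ->
  kappa ^+ 2 <= Theta i j ^+ 2 / (Theta i i * Theta j j).
Proof.
rewrite inE => /andP[ji ij0]; have ij : i != j by rewrite eq_sym.
have := nd ij ij0 => kle.
have -> : Theta i j ^+ 2 / (Theta i i * Theta j j) =
    (`|Theta i j| / Num.sqrt (Theta i i * Theta j j)) ^+ 2.
  by rewrite expr_div_n real_normK ?num_real// sqr_sqrtr// mulr_ge0// ltW.
by rewrite ler_sqr ?nnegrE// ?divr_ge0 ?sqrtr_ge0// ltW.
Qed.

(** The sum of the squared partial correlations of X_i with the X_j, j in K. *)
Definition qpart i K := \sum_(j in K) Theta i j ^+ 2 / (Theta i i * Theta j j).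

Lemma qpart_ge i K : K \subset neighbors Theta i -> #|K|%:R * kappa ^+ 2 <= qpart i K.
Proof.
move=> KN; rewrite mulr_natl -sumr_const; apply: ler_sum => j jK.
by apply: partial_corr_ge; exact: (fintype.subsetP KN).
Qed.

(* The direction of resampling; attractiveness makes its entries nonnegative. *)
Definition beta i K j : R := if j \in K then - (Theta i j / Theta j j) else 0.

Lemma beta_ge0 i K j : K \subset neighbors Theta i -> 0 <= beta i K j.
Proof.
move=> KN; rewrite /beta; case: ifPn => // /(fintype.subsetP KN).
rewrite inE => /andP[ji _]; rewrite oppr_ge0; apply: mulr_le0_ge0; last by rewrite invr_ge0 ltW.
by rewrite att// eq_sym.
Qed.

Lemma Theta_beta i K : \sum_j Theta i j * beta i K j = - (Theta i i * qpart i K).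
Proof.
rewrite /qpart mulr_sumr -sumrN [RHS]big_mkcond /=; apply: eq_bigr => j _.
rewrite /beta; case: ifP => _; last by rewrite mulr0.
by field; rewrite !gt_eqF.
Qed.

Lemma wstar_beta i K : K \subset neighbors Theta i ->
  \sum_j wstar Theta i j * beta i K j = qpart i K.
Proof.
move=> KN; have iK : i \notin K.
  by apply/negP => /(fintype.subsetP KN); rewrite inE eqxx.
have -> : qpart i K = - (Theta i i)^-1 * \sum_j Theta i j * beta i K j.
  by rewrite Theta_beta mulNr mulrN opprK mulKf// gt_eqF.
rewrite mulr_sumr; apply: eq_bigr => j _; rewrite /wstar; case: eqP => [->|_].
  by rewrite /beta (negbTE iK) !mulr0.
by ring.
Qed.

Lemma qf_beta_le i K : K \subset neighbors Theta i ->
  qf Theta (beta i K) <= Theta i i * qpart i K.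
Proof.
move=> KN; rewrite -[leRHS]opprK -Theta_beta -sumrN; apply: ler_sum => j _.
rewrite (bigD1 j)//= -[leRHS]addr0; apply: lerD.
  rewrite /beta; case: ifP => _; last by rewrite !mulr0 oppr0.
  by rewrite le_eqVlt; apply/orP; left; apply/eqP; field; rewrite !gt_eqF.
apply: sumr_le0 => l lj; rewrite mulr_le0_ge0 ?beta_ge0//.
by rewrite mulr_ge0_le0 ?beta_ge0// att// eq_sym.
Qed.

(** Positive definiteness is tested on e_i + beta, where the form is at most Theta_ii (1 -
    qpart). *)
Lemma qpart_lt1 i K : K \subset neighbors Theta i -> qpart i K < 1.
Proof.
move=> KN; have iK : i \notin K.
  by apply/negP => /(fintype.subsetP KN); rewrite inE eqxx.
pose p j := (delta i j : R) + beta i K j.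
have p0 : 0 < qf Theta p.
  apply: pd.2; exists i; rewrite /p /delta eqxx /beta (negbTE iK) addr0.
  exact: oner_neq0.
have pE : qf Theta p = Theta i i + 2 * (\sum_j Theta i j * beta i K j) + qf Theta (beta i K).
  transitivity (\sum_j ((delta i j : R) * (\sum_l Theta j l * p l) +
       beta i K j * (\sum_l Theta j l * p l))).
    apply: eq_bigr => j _; rewrite -mulrDl mulr_sumr.
    by apply: eq_bigr => l _; rewrite mulrA.
  have e j : \sum_l Theta j l * p l = Theta j i + \sum_l Theta j l * beta i K l.
    under eq_bigr do rewrite mulrDr.
    rewrite big_split /=; congr (_ + _).
    by under eq_bigr do rewrite mulrC; rewrite sum_delta.
  rewrite big_split /= sum_delta e -!addrA; congr (_ + _).
  rewrite mulrDl mul1r -addrA; congr (_ + _).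
  under eq_bigr do rewrite e mulrDr.
  rewrite big_split /=; congr (_ + _).
    by apply: eq_bigr => j _; rewrite mulrC pd.1.
  by apply: eq_bigr => j _; rewrite mulr_sumr; apply: eq_bigr => l _; rewrite mulrA.
have := qf_beta_le KN; rewrite pE Theta_beta in p0 => le.
have : 0 < Theta i i * (1 - qpart i K) by lra.
by rewrite pmulr_rgt0// subr_gt0.
Qed.

Lemma card_kappa_lt1 i K : K \subset neighbors Theta i -> #|K|%:R * kappa ^+ 2 < 1.
Proof. by move=> KN; rewrite (le_lt_trans (qpart_ge KN))// qpart_lt1. Qed.

Section resampled.
Context {h : nat}.
Variable mu : probability (h.-tuple (n.-tuple R)) R.
Hypothesis mu_res : resample_inv Theta mu.
Implicit Types x : h.-tuple (n.-tuple R).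

Lemma measurable_expR_rho d (T : measurableType d) (F : T -> R) : measurable_fun setT F ->
  measurable_fun setT (fun t => (expR (F t))%:E).
Proof. by move=> mF; apply/measurable_EFinP; exact: measurableT_comp. Qed.

Lemma integral_res_le p (F : h.-tuple (n.-tuple R) -> \bar R) (B : h.-tuple (n.-tuple R) -> \bar R) :
  (exists i, p i != 0) -> measurable_fun setT F -> (forall x, 0 <= F x)%E ->
  measurable_fun setT B ->
  (forall x, \int[Gam h]_v F (zipres (resX Theta p) x v) <= B x)%E ->
  (\int[mu]_x F x <= \int[mu]_x B x)%E.
Proof.
move=> p0 mF F0 mB FB; rewrite (mu_res p0 mF F0).
have mI : measurable_fun setT (fun x => \int[Gam h]_v F (zipres (resX Theta p) x v))%E.
  apply: measurable_integral => //; apply: (measurableT_comp mF).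
  by apply: measurable_zipres => //; exact: measurable_resX.
apply: ge0_le_integral => //.
by move=> x _; exact: integral_ge0.
Qed.

Lemma integral_res_le_cst p (F : h.-tuple (n.-tuple R) -> \bar R) (b : \bar R) :
  (exists i, p i != 0) -> measurable_fun setT F -> (forall x, 0 <= F x)%E ->
  (forall x, \int[Gam h]_v F (zipres (resX Theta p) x v) <= b)%E ->
  (\int[mu]_x F x <= b)%E.
Proof.
move=> p0 mF F0 Fb.
have -> : b = (\int[mu]_x cst b x)%E.
  transitivity (b * mu setT)%E; first by rewrite probability_setT mule1.
  exact/esym/integral_cst.
exact: (integral_res_le p0).
Qed.

Lemma card_gt0_exists i K : K \subset neighbors Theta i -> K != finset.set0 ->
  exists j, beta i K j != 0.
Proof.
move=> KN /finset.set0Pn[j jK]; exists j; rewrite /beta jK oppr_eq0 mulf_neq0//.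
  by have := fintype.subsetP KN _ jK; rewrite inE => /andP[].
by rewrite invr_neq0// gt_eqF.
Qed.

(** Resampling along [beta i K] leaves the columns in [S] alone and turns the regression function
    into a fixed vector plus [tau] times a standard Gaussian [v]. Its residual is at least tau^2
    times the squared norm of [v] outside a subspace of dimension at most |S| + 1. *)
Lemma E_signal i S t X : i \notin S -> 0 <= t -> neighbors Theta i :\: S != finset.set0 ->
  X = 2 * (t * (#|neighbors Theta i :\: S|%:R * kappa ^+ 2)) ->
  (\int[mu]_x (expR (- (t * (Theta i i * rho (wstar Theta i) S x))))%:E <=
   ((Num.sqrt (1 + X))^-1 ^+ h * Num.sqrt (1 + X) ^+ #|S|.+1)%:E)%E.
Proof.
move=> iS tge; set K := _ :\: S => K0 XE.
have KN : K \subset neighbors Theta i by exact: finset.subsetDl.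
have b0 := card_gt0_exists KN K0.
set kk := #|K|%:R * kappa ^+ 2 in XE.
have kk0 : 0 <= kk by rewrite mulr_ge0// sqr_ge0.
have X0 : 0 <= X by rewrite XE mulr_ge0// mulr_ge0.
have qb0 : 0 < qf Theta (beta i K) by apply: pd.2.
have q_ge := qpart_ge KN.
have q0 : 0 < qpart i K.
  apply: lt_le_trans q_ge; rewrite mulr_gt0 ?exprn_gt0// ltr0n card_gt0//.
set rhs := (_ * _)%:E.
have mrho c T' : measurable_fun setT (fun x : h.-tuple (n.-tuple R) => rho c T' x).
  exact: measurable_rho.
apply: (integral_res_le_cst b0) => //.
  by apply: measurable_expR_rho; apply: measurable_funN; do 2 apply: measurable_funM => //.
move=> x.
set tau := (\sum_k wstar Theta i k * beta i K k) / Num.sqrt (qf Theta (beta i K)).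
pose a := comb x (wstar Theta i) - tau *: resa Theta (beta i K) x.
have [qs obS szS] := onb_exists x S.
have [onS fxS _] := obS.
(* The fixed part [a] is adjoined to the regressors, at the price of one dimension. *)
have [ps [sz on fx _]] := orthon_extend [:: a] onS.
have fxS' : fixes x S (qs ++ ps).
  by move=> j jS; rewrite -(fxS _ jS) proj_span// => q qq; rewrite mem_cat qq.
have key v : kk * (dotr (rowt v) (rowt v) - energy (qs ++ ps) (rowt v)) <=
    Theta i i * rho (wstar Theta i) S (zipres (resX Theta (beta i K)) x v).
  rewrite /rho comb_res -/tau.
  have -> : comb x (wstar Theta i) + tau *: (rowt v - resa Theta (beta i K) x) =
      tau *: rowt v + a.
    by rewrite /a scalerBr [RHS]addrC -addrA; congr (_ + _); rewrite addrC.
  rewrite (rhov_eqcols (x' := x)); last first.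
    by move=> j jS; rewrite colv_res0// /beta inE jS.
  have [w sw <-] := rhov_attained x (tau *: rowt v + a) S.
  apply: (@le_trans _ _ (Theta i i * (tau ^+ 2 *
      (dotr (rowt v) (rowt v) - energy (qs ++ ps) (rowt v))))).
    have d0 : 0 <= dotr (rowt v) (rowt v) - energy (qs ++ ps) (rowt v).
      by rewrite subr_ge0 energy_le_normsq.
    (* Theta_ii tau^2 >= qpart, because tau^2 = qpart^2 / qf(beta) and qf(beta) <= Theta_ii
       qpart. *)
    rewrite mulrA ler_wpM2r//; apply: (le_trans q_ge).
    have -> : tau ^+ 2 = qpart i K ^+ 2 / qf Theta (beta i K).
      by rewrite /tau wstar_beta// expr_div_n sqr_sqrtr ?ltW.
    rewrite mulrA ler_pdivlMr//.
    rewrite expr2 mulrA [leRHS]mulrC ler_pM2l//.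
    exact: qf_beta_le.
  rewrite ler_pM2l//.
  have e (u1 u2 u3 : 'rV[R]_h) : u1 + u2 - u3 = u1 - (u3 - u2) by rewrite opprB addrA.
  have -> : tau ^+ 2 * (dotr (rowt v) (rowt v) - energy (qs ++ ps) (rowt v)) =
     dotr (tau *: rowt v) (tau *: rowt v) - energy (qs ++ ps) (tau *: rowt v).
    by rewrite dotrZl dotrZr energyZ mulrA -expr2 mulrBr.
  have -> : dist2 x (tau *: rowt v + a) w =
     dotr (tau *: rowt v - (comb x w - a)) (tau *: rowt v - (comb x w - a)).
    by rewrite /dist2 e.
  apply: dist_energy_le => //.
  rewrite -scaleN1r projD projZ (fixes_comb fxS' sw).
  by rewrite fx ?mem_head.
apply: (@le_trans _ _ (\int[Gam h]_v (expR (- (t * kk) * dotr (rowt v) (rowt v) +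
    (t * kk) * energy (qs ++ ps) (rowt v)))%:E)%E).
  apply: ge0_le_integral => //.
  - apply: measurable_expR_rho; apply: measurable_funN; do 2 apply: measurable_funM => //.
    apply: (measurableT_comp (mrho (wstar Theta i) S)).
    by apply: measurable_zipres => //; exact: measurable_resX.
  - apply: measurable_expR_rho; apply: measurable_funD; apply: measurable_funM => //.
      exact: measurable_normsq_rowt.
    exact: measurable_energy.
  - by move=> v _; rewrite lee_fin ler_expR; have := ler_wpM2l tge (key v); lra.
have tk0 : 0 <= t * kk by rewrite mulr_ge0.
rewrite Gam_exp_energy//; last by rewrite ltrDr.
rewrite lee_fin /rhs -XE.
have X1 : 0 < 1 + X by lra.
have -> : 1 - X / (1 + X) = (1 + X)^-1 by field; rewrite gt_eqF.
rewrite sqrtrV ?(ltW X1)// invrK ler_wpM2l//.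
apply: ler_weXn2l.
  by apply: (@le_trans _ _ (Num.sqrt 1)); [rewrite sqrtr1|apply: ler_wsqrtr; rewrite lerDl].
by rewrite size_cat; apply: (leq_trans (leq_add szS sz)); rewrite /= addn1.
Qed.

End resampled.
End attractive.

(** * Tail bounds *)

Lemma expR_le_1D {R : realType} (X : R) : 0 <= X -> expR (X / (1 + X)) <= 1 + X.
Proof.
move=> X0; have X1 : 0 < 1 + X by lra.
have := expR_ge1Dx (- (X / (1 + X))); rewrite expRN.
have -> : 1 - X / (1 + X) = (1 + X)^-1 by field; rewrite gt_eqF.
by rewrite lef_pV2// posrE// expR_gt0.
Qed.

(** The inequality log(1 + X) >= X / (1 + X), multiplied by (h - r) / 2. *)
Lemma sqrt_pow_le {R : realType} (X : R) (h r : nat) : 0 <= X -> (r <= h)%N ->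
  (Num.sqrt (1 + X))^-1 ^+ h * Num.sqrt (1 + X) ^+ r <=
  expR (- ((h - r)%:R * (X / (2 * (1 + X))))).
Proof.
move=> X0 rh; have X1 : 0 < 1 + X by lra.
have a0 : 0 < Num.sqrt (1 + X) by rewrite sqrtr_gt0.
set y := X / (2 * (1 + X)).
have ya : expR y <= Num.sqrt (1 + X).
  rewrite -ler_sqr ?nnegrE ?sqrtr_ge0 ?expR_ge0// sqr_sqrtr ?(ltW X1)// -expRM_natl.
  have -> : 2%:R * y = X / (1 + X) by rewrite /y; field; rewrite gt_eqF.
  exact: expR_le_1D.
rewrite -{1}(subnK rh) exprD -mulrA -exprMn mulVf ?gt_eqF// expr1n mulr1.
rewrite -mulrN expRM_natl; apply: lerXn2r; rewrite ?nnegrE ?expR_ge0 ?invr_ge0 ?sqrtr_ge0//.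
by rewrite expRN lef_pV2// posrE// expR_gt0.
Qed.

Lemma signal_exponent_le {R : realType} (k h r X : R) : 0 <= k -> k < 1 -> 0 <= h ->
  h - h / 100 <= r -> X = 7 / 256 * k -> k * h / 80 <= r * (X / (2 * (1 + X))).
Proof.
move=> k0 k1 h0 hr XE.
(* Here k < 1 bounds 2 (1 + X) by 526 / 256. The target 1/80 is a little below 99/100 of 7/526. *)
have Xb : k * (7 / 526) <= X / (2 * (1 + X)).
  by rewrite ler_pdivlMr XE; [nra|lra].
apply: (@le_trans _ _ ((h - h / 100) * (k * (7 / 526)))).
  have kh : 0 <= k * h by rewrite mulr_ge0.
  by clear XE hr Xb; lra.
by apply: (ler_pM _ _ hr Xb); clear XE hr Xb; lra.
Qed.

Lemma natr_sub_frac {R : realType} (h r : nat) : (100 * r <= h)%N ->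
  h%:R - h%:R / 100 <= (h - r)%:R :> R.
Proof.
move=> hr; have rh : (r <= h)%N by rewrite (leq_trans _ hr)// leq_pmull.
have : (100 * r)%:R <= h%:R :> R by rewrite ler_nat.
by rewrite natrB// natrM => ?; lra.
Qed.

Section tails.
Context {R : realType} {n h : nat}.
Variables (Theta : 'M[R]_n) (kappa : R).
Hypotheses (pd : posdef Theta) (att : attractive Theta) (k0 : 0 < kappa)
  (nd : nondegenerate kappa Theta).
Variable mu : probability (h.-tuple (n.-tuple R)) R.
Hypothesis mu_res : resample_inv Theta mu.
Implicit Types (A S W : {set 'I_n}) (x : h.-tuple (n.-tuple R)).

Let t0 i : 0 < Theta i i := Theta_gt0 pd i.
Local Notation nb := (neighbors Theta).

Let mrho c S : measurable_fun setT (fun x : h.-tuple (n.-tuple R) => rho c S x).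
Proof. exact: measurable_rho. Qed.

Let mrhores i c S x : measurable_fun setT (fun v => rho c S (zipres (resX Theta (delta i)) x v)).
Proof.
apply: (measurableT_comp (mrho c S)).
by apply: measurable_zipres => //; exact: measurable_resX.
Qed.

(** At parameter 1/64 the signal U = |u|^2 gains exp(- U/64), the moment of the cross term costs
    exp(U/512), and 1/64 - 1/512 = 7/512. Each dimension of overfitting costs a factor at most 2. *)
Lemma E_rho_diff i S W : i \notin S -> i \notin W -> nb i \subset W ->
  (\int[mu]_x (expR (64^-1 * (Theta i i * (rho (delta i) W x - rho (delta i) S x))))%:E <=
   \int[mu]_x (2 ^+ #|S :\: W| *
     expR (- (7 / 512 * (Theta i i * rho (wstar Theta i) S x))))%:E)%E.
Proof.
move=> iS iW NW; have := integral_res_le mu_res (delta_neq0 (R := R) i); apply.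
- apply: measurable_expR_rho; do 2 apply: measurable_funM => //.
  exact: measurable_funB.
- by move=> x; rewrite lee_fin expR_ge0.
- apply/measurable_EFinP; apply: measurable_funM; first exact: measurable_cst.
  apply: (measurableT_comp (@measurable_expR R)).
  by apply: measurable_funN; do 2 apply: measurable_funM => //.
move=> x.
have [u [ps [on sz uE le]]] := rho_diff_le pd x iS iW NW.
set U := dotr u u in uE le; set r := #|_|.
have U0 : 0 <= U by exact: dotrr_ge0.
rewrite -uE.
(* convexity: exp(a + b) <= (exp(2 a) + exp(2 b)) / 2 *)
apply: (@le_trans _ _ (\int[Gam h]_v ((expR (- (U / 64)) / 2)%:E *
   ((expR (- 0 * dotr (rowt v) (rowt v) + dotr (- 16^-1 *: u) (rowt v)))%:E +
    (expR (- 0 * dotr (rowt v) (rowt v) + 32^-1 * energy ps (rowt v)))%:E)))%E).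
  apply: ge0_le_integral => //.
  - apply: measurable_expR_rho; do 2 apply: measurable_funM => //.
    exact: measurable_funB.
  - apply: emeasurable_funM => //; apply: emeasurable_funD; apply: measurable_expR_rho.
      apply: measurable_funD; last exact: measurable_dotr_rowt.
      by apply: measurable_funM => //; exact: measurable_normsq_rowt.
    apply: measurable_funD; apply: measurable_funM => //.
      exact: measurable_normsq_rowt.
    exact: measurable_energy.
  move=> v _; rewrite -EFinD -EFinM lee_fin oppr0 mul0r !add0r dotrZl.
  set a := dotr u (rowt v) in le *; set b := energy ps (rowt v) in le *.
  apply: (@le_trans _ _ (expR (- (U / 64)) * expR (- 32^-1 * a + 64^-1 * b))).
    rewrite -expRD ler_expR; have := le v; rewrite -/a -/b => lev.
    lra.
  rewrite -mulrA ler_wpM2l ?expR_ge0// expRD.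
  have e1 : expR (- 16^-1 * a) = expR (- 32^-1 * a) ^+ 2.
    by rewrite -expRM_natl; congr expR; field.
  have e2 : expR (32^-1 * b) = expR (64^-1 * b) ^+ 2.
    by rewrite -expRM_natl; congr expR; field.
  rewrite e1 e2; set A := expR _; set B := expR _.
  have := sqr_ge0 (A - B); nra.
rewrite ge0_integralZl//; first last.
- by move=> v _; rewrite adde_ge0 ?lee_fin ?expR_ge0.
- apply: emeasurable_funD; apply: measurable_expR_rho.
    apply: measurable_funD; last exact: measurable_dotr_rowt.
    by apply: measurable_funM => //; exact: measurable_normsq_rowt.
  apply: measurable_funD; apply: measurable_funM => //.
    exact: measurable_normsq_rowt.
  exact: measurable_energy.
rewrite ge0_integralD//; first last.
- apply: measurable_expR_rho; apply: measurable_funD; apply: measurable_funM => //.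
    exact: measurable_normsq_rowt.
  exact: measurable_energy.
- apply: measurable_expR_rho; apply: measurable_funD; last exact: measurable_dotr_rowt.
  by apply: measurable_funM => //; exact: measurable_normsq_rowt.
rewrite Gam_exp_lin; last by lra.
rewrite Gam_exp_energy//; last by lra.
rewrite -EFinD -EFinM lee_fin !mulr0 addr0 sqrtr1 invr1 !expr1n !mul1r !mulr1.
rewrite dotrZl dotrZr -/U.
set c := (Num.sqrt _)^-1.
(* c is the inverse square root of 15/16. *)
have c2 : c <= 2.
  rewrite /c -[leRHS]invrK lef_pV2 ?posrE ?invr_gt0 ?sqrtr_gt0//; last by lra.
  rewrite -[leLHS]ger0_norm; last by rewrite invr_ge0.
  by rewrite -sqrtr_sqr ler_wsqrtr//; lra.
have c0 : 0 <= c by rewrite invr_ge0 sqrtr_ge0.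
have cr : c ^+ size ps <= 2 ^+ r.
  apply: (@le_trans _ _ (2 ^+ size ps)); first by apply: lerXn2r; rewrite ?nnegrE.
  by apply: ler_weXn2l => //; lra.
have one2 : 1 <= 2 ^+ r :> R by apply: exprn_ege1; lra.
have eU : expR (- (U / 64)) * expR (- 16^-1 * (- 16^-1 * U) / 2) = expR (- (7 / 512 * U)).
  by rewrite -expRD; congr expR; field.
have e1 : 1 <= expR (- 16^-1 * (- 16^-1 * U) / 2).
  by rewrite -[leLHS]expR0 ler_expR; lra.
rewrite -eU; set E := expR (_ / 2) in e1 *; set E' := expR _.
have E'0 : 0 <= E' by exact: expR_ge0.
set D := 2 ^+ r in cr one2 *; set F := c ^+ _ in cr *.
have -> : E' / 2 * (E + F) = E' * ((E + F) / 2) by ring.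
have -> : D * (E' * E) = E' * (D * E) by ring.
by rewrite ler_wpM2l//; nra.
Qed.

(** Two resamplings in succession: along e_i for the noise, then along [beta] for the signal that
    survives in the exponent. The selection uses a = 0, the validation a = 3/4 kappa^2 h. *)
Lemma prob_rho_diff i S W (a : R) : i \notin S -> i \notin W -> nb i \subset W ->
  nb i :\: S != finset.set0 -> (100 * #|S|.+1 <= h)%N ->
  (mu [set x | Theta i i * (rho (delta i) S x - rho (delta i) W x) <= a]%R <=
   (2 ^+ #|S :\: W| *
     expR (a / 64 - #|nb i :\: S|%:R * kappa ^+ 2 * h%:R / 80))%:E)%E.
Proof.
move=> iS iW NW NS hS.
pose G x := 64^-1 * (Theta i i * (rho (delta i) W x - rho (delta i) S x)) + a / 64.
have mG : measurable_fun setT G.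
  apply: measurable_funD => //; do 2 apply: measurable_funM => //.
  exact: measurable_funB.
apply: (@prob_le_expR _ _ _ mu G) => //.
- by apply: measurable_funM => //; exact: measurable_funB.
- by move=> x /=; rewrite /G => ?; lra.
have mE : measurable_fun setT (fun x => (expR (64^-1 * (Theta i i *
    (rho (delta i) W x - rho (delta i) S x))))%:E).
  apply: measurable_expR_rho; do 2 apply: measurable_funM => //.
  exact: measurable_funB.
have mE2 : measurable_fun setT (fun x => (expR (- (7 / 512 *
    (Theta i i * rho (wstar Theta i) S x))))%:E).
  by apply: measurable_expR_rho; apply: measurable_funN; do 2 apply: measurable_funM => //.
under eq_integral do rewrite /G expRD EFinM.
rewrite ge0_integralZr//.
have E1 := E_rho_diff iS iW NW.
set kk := #|nb i :\: S|%:R * kappa ^+ 2.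
have kk0 : 0 <= kk by rewrite mulr_ge0// sqr_ge0.
have kk1 : kk < 1.
  by apply: (card_kappa_lt1 (i := i) pd att k0 nd); exact: finset.subsetDl.
have E2 : (\int[mu]_x (expR (- (7 / 512 * (Theta i i * rho (wstar Theta i) S x))))%:E <=
    (expR (- (kk * h%:R / 80)))%:E)%E.
  apply: (le_trans (E_signal pd att k0 nd mu_res (t := 7 / 512) iS _ NS (erefl _))); first by lra.
  rewrite lee_fin; set X := 2 * _.
  have XE : X = 7 / 256 * kk by rewrite /X -/kk; field.
  have X0 : 0 <= X by rewrite XE; lra.
  have Sh : (#|S|.+1 <= h)%N by rewrite (leq_trans _ hS)// leq_pmull.
  apply: (le_trans (sqrt_pow_le X0 Sh)); rewrite ler_expR lerN2.
  exact: (signal_exponent_le kk0 kk1 (ler0n _ _) (natr_sub_frac hS) XE).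
apply: (@le_trans _ _ (((2 ^+ #|S :\: W|)%:E * (expR (- (kk * h%:R / 80)))%:E) *
   (expR (a / 64))%:E)%E).
  rewrite lee_wpmul2r ?lee_fin ?expR_ge0//; apply: (le_trans E1).
  under eq_integral do rewrite EFinM.
  have p0 : (0 <= (2 ^+ #|S :\: W|)%:E :> \bar R)%E by rewrite lee_fin exprn_ge0.
  rewrite (ge0_integralZl mu measurableT mE2 (fun x _ => expR_ge0 _) p0).
  by apply: lee_wpmul2l; [exact: p0|exact: E2].
rewrite -!EFinM lee_fin -mulrA -expRD [X in expR X]addrC.
exact: lexx.
Qed.

(** Chernoff bound at parameter 1/20 for the squared norm of the noise: the moment is (10/9)^(h/2)
    <= exp(h/18), and 1/16 - 1/18 = 1/144. *)
Lemma prob_rho_upper i W : i \notin W -> nb i \subset W ->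
  (mu [set x | (5 / 4 * h%:R <= Theta i i * rho (delta i) W x)%R] <=
   (expR (- (h%:R / 144)))%:E)%E.
Proof.
move=> iW NW.
pose G x := 20^-1 * (Theta i i * rho (delta i) W x) - h%:R / 16.
have mG : measurable_fun setT G by apply: measurable_funB => //; do 2 apply: measurable_funM => //.
apply: (@prob_le_expR _ _ _ mu G) => //.
- by apply: measurable_funM => //.
- by move=> x; rewrite /G => ?; lra.
apply: (integral_res_le_cst mu_res (delta_neq0 (R := R) i)) => //.
  exact: measurable_expR_rho.
move=> x; have [qs ob _] := onb_exists x W.
have on : orthon qs by case: ob.
pose F (v : h.-tuple R) := (expR (- (- 20^-1) * dotr (rowt v) (rowt v) + dotr 0 (rowt v)))%:E.
have mF : measurable_fun setT F.
  apply: measurable_expR_rho; apply: measurable_funD; last exact: measurable_dotr_rowt.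
  by apply: measurable_funM => //; exact: measurable_normsq_rowt.
have F0 v : (0 <= F v)%E by rewrite lee_fin expR_ge0.
have e0 : (0 <= (expR (- (h%:R / 16)))%:E :> \bar R)%E by rewrite lee_fin expR_ge0.
apply: (@le_trans _ _ (\int[Gam h]_v ((expR (- (h%:R / 16)))%:E * F v))%E).
  apply: ge0_le_integral => //.
  - apply: measurable_expR_rho; apply: measurable_funB => //.
    by do 2 apply: measurable_funM => //.
  - by apply: emeasurable_funM.
  move=> v _; rewrite -EFinM lee_fin -expRD ler_expR /G (rho_res_self_nb pd v iW NW ob).
  have := energy_ge0 qs (rowt v); rewrite dot0r; lra.
rewrite (ge0_integralZl (Gam h) measurableT mF (fun v _ => F0 v) e0) Gam_exp_lin; last by lra.
rewrite -EFinM lee_fin dot0r mul0r expR0 mulr1.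
set c := (Num.sqrt _)^-1.
have c0 : 0 <= c by rewrite invr_ge0 sqrtr_ge0.
have cE : c <= expR (18^-1).
  rewrite -ler_sqr ?nnegrE ?expR_ge0// /c exprVn sqr_sqrtr; last by lra.
  have -> : (1 + 2 * - 20^-1)^-1 = 10 / 9 :> R by field.
  rewrite -expRM_natl; apply: le_trans (expR_ge1Dx _); lra.
have : c ^+ h <= expR (h%:R / 18).
  by rewrite expRM_natl; apply: lerXn2r; rewrite ?nnegrE ?expR_ge0.
move=> cE2; apply: (@le_trans _ _ (expR (- (h%:R / 16)) * expR (h%:R / 18))).
  by rewrite ler_wpM2l ?expR_ge0.
by rewrite -expRD ler_expR; lra.
Qed.

(** Chernoff bound at parameter -1/2. At least 99/100 of the dimensions remain after the projection,
    so the exponent is at most h/8 - 99 h/400. *)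
Lemma prob_rho_lower i W : i \notin W -> nb i \subset W -> (100 * #|W| <= h)%N ->
  (mu [set x | (Theta i i * rho (delta i) W x <= h%:R / 4)%R] <=
   (expR (- (h%:R / 10)))%:E)%E.
Proof.
move=> iW NW hW.
pose G x := h%:R / 8 - 2^-1 * (Theta i i * rho (delta i) W x).
have mG : measurable_fun setT G by apply: measurable_funB => //; do 2 apply: measurable_funM => //.
apply: (@prob_le_expR _ _ _ mu G) => //.
- by apply: measurable_funM => //.
- by move=> x; rewrite /G => ?; lra.
apply: (integral_res_le_cst mu_res (delta_neq0 (R := R) i)) => //.
  exact: measurable_expR_rho.
move=> x; have [qs ob sz] := onb_exists x W.
have on : orthon qs by case: ob.
pose F (v : h.-tuple R) := (expR (- 2^-1 * dotr (rowt v) (rowt v) + 2^-1 * energy qs (rowt v)))%:E.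
have mF : measurable_fun setT F.
  apply: measurable_expR_rho; apply: measurable_funD; apply: measurable_funM => //.
    exact: measurable_normsq_rowt.
  exact: measurable_energy.
have F0 v : (0 <= F v)%E by rewrite lee_fin expR_ge0.
have e0 : (0 <= (expR (h%:R / 8))%:E :> \bar R)%E by rewrite lee_fin expR_ge0.
have -> : (\int[Gam h]_v (expR (G (zipres (resX Theta (delta i)) x v)))%:E =
    \int[Gam h]_v ((expR (h%:R / 8))%:E * F v))%E.
  apply: eq_integral => v _; rewrite -EFinM -expRD /G (rho_res_self_nb pd v iW NW ob).
  by congr (expR _)%:E; field.
rewrite (ge0_integralZl (Gam h) measurableT mF (fun v _ => F0 v) e0) Gam_exp_energy//; last by lra.
rewrite -EFinM lee_fin.
have -> : 1 - 2 / 2 / (1 + 2 / 2) = (1 + 1)^-1 :> R by field.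
have -> : 1 + 2 / 2 = 1 + 1 :> R by field.
rewrite sqrtrV// invrK.
have szh : (100 * size qs <= h)%N by rewrite (leq_trans _ hW)// leq_mul2l.
have sh : (size qs <= h)%N by rewrite (leq_trans _ szh)// leq_pmull.
have le1 := @sqrt_pow_le R 1 h (size qs) ler01 sh.
apply: (le_trans (ler_wpM2l (expR_ge0 _) le1)).
rewrite -expRD ler_expR.
have -> : 1 / (2 * (1 + 1)) = 4^-1 :> R by field.
have := @natr_sub_frac R _ _ szh; have : 0 <= h%:R :> R by []; lra.
Qed.

(** The gain is the square of the noise in at most one direction; the moment of a squared standard
    normal at parameter 1/4 is sqrt 2 <= 2. *)
Lemma prob_rho_gain i A W (a : R) : i \notin W -> nb i \subset A -> A \subset W ->
  (#|W :\: A| <= 1)%N ->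
  (mu [set x | (a <= Theta i i * (rho (delta i) A x - rho (delta i) W x))%R] <=
   (2 * expR (- (a / 4)))%:E)%E.
Proof.
move=> iW NA AW card1.
have NW : nb i \subset W by exact: fintype.subset_trans AW.
have iA : i \notin A by apply: contra iW; exact: (fintype.subsetP AW).
pose G x := 4^-1 * (Theta i i * (rho (delta i) A x - rho (delta i) W x)) - a / 4.
have mD : measurable_fun setT
   (fun x : h.-tuple (n.-tuple R) => Theta i i * (rho (delta i) A x - rho (delta i) W x)).
  by apply: measurable_funM => //; exact: measurable_funB.
have mG : measurable_fun setT G by apply: measurable_funB => //; apply: measurable_funM.
apply: (@prob_le_expR _ _ _ mu G) => //.
- by move=> x; rewrite /G => ?; lra.
apply: (integral_res_le_cst mu_res (delta_neq0 (R := R) i)) => //.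
  exact: measurable_expR_rho.
move=> x; have [qs ob _] := onb_exists x A.
have [ps ob' sz] := onb_extend ob AW.
have on : orthon ps.
  have [onWS _ _] := ob'; move=> b c hb hc.
  have := onWS (size qs + b)%N (size qs + c)%N.
  rewrite size_cat !ltn_add2l => /(_ hb hc).
  rewrite !nth_cat !ltnNge !leq_addr /= !addKn => ->.
  by rewrite eqn_add2l.
pose F (v : h.-tuple R) := (expR (- 0 * dotr (rowt v) (rowt v) + 4^-1 * energy ps (rowt v)))%:E.
have mF : measurable_fun setT F.
  apply: measurable_expR_rho; apply: measurable_funD; apply: measurable_funM => //.
    exact: measurable_normsq_rowt.
  exact: measurable_energy.
have F0 v : (0 <= F v)%E by rewrite lee_fin expR_ge0.
have e0 : (0 <= (expR (- (a / 4)))%:E :> \bar R)%E by rewrite lee_fin expR_ge0.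
have -> : (\int[Gam h]_v (expR (G (zipres (resX Theta (delta i)) x v)))%:E =
    \int[Gam h]_v ((expR (- (a / 4)))%:E * F v))%E.
  apply: eq_integral => v _; rewrite -EFinM -expRD /G mulrBr.
  rewrite (rho_res_self_nb pd v iA NA ob) (rho_res_self_nb pd v iW NW ob') energy_cat.
  by congr (expR _)%:E; field.
rewrite (ge0_integralZl (Gam h) measurableT mF (fun v _ => F0 v) e0) Gam_exp_energy//; last by lra.
rewrite -EFinM lee_fin !mulr0 addr0 sqrtr1 invr1 expr1n mul1r mulrC.
apply: ler_wpM2r; first exact: expR_ge0.
set c := (Num.sqrt _)^-1.
have c2 : c <= 2.
  rewrite /c -[leRHS]invrK lef_pV2 ?posrE ?invr_gt0 ?sqrtr_gt0//; last by lra.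
  rewrite -[leLHS]ger0_norm; last by rewrite invr_ge0.
  by rewrite -sqrtr_sqr ler_wsqrtr//; lra.
have := leq_trans sz card1; case: (size ps) => [|[|//]] _.
  by rewrite expr0; lra.
by rewrite expr1.
Qed.

End tails.

(** * Ties have probability zero *)

Lemma exists_perp {R : realType} {h : nat} (us : seq 'rV[R]_h) : (size us < h)%N ->
  exists2 e : 'rV[R]_h, dotr e e = 1 & forall u, u \in us -> dotr u e = 0.
Proof.
move=> sh; pose M : 'M[R]_(h, size us) := \matrix_(s, a) us`_a 0 s.
have : kermx M != 0.
  rewrite -mxrank_eq0 mxrank_ker -lt0n subn_gt0.
  by rewrite (leq_ltn_trans (rank_leq_col M)).
case/rowV0Pn => v /sub_kermxP vM v0.
have vv : 0 < dotr v v by rewrite dotrr_gt0.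
exists ((Num.sqrt (dotr v v))^-1 *: v).
  rewrite dotrZl dotrZr mulrA -invfM -expr2 sqr_sqrtr ?(ltW vv)//.
  by rewrite mulVf// gt_eqF.
move=> u /(nthP 0)[a al <-]; rewrite dotrZr.
have : (v *m M) 0 (Ordinal al) = 0 by rewrite vM mxE.
rewrite mxE => va; rewrite (_ : dotr us`_a v = 0) ?mulr0// -[RHS]va.
by apply: eq_bigr => s _; rewrite mxE mulrC.
Qed.

Lemma dotrr_subZ {R : realType} {h : nat} (a u : 'rV[R]_h) t :
  dotr (a - t *: u) (a - t *: u) = dotr a a - 2 * t * dotr a u + t ^+ 2 * dotr u u.
Proof. by rewrite dotrBl !dotrBr !dotrZl !dotrZr (dotrC u a); ring. Qed.

Lemma gam_null_pair {R : realType} (a b : R) (B : set R) : measurable B ->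
  (forall g, B g -> g = a \/ g = b) -> gam B = 0%E.
Proof.
move=> mB Bab; apply/eqP; rewrite -measure_le0.
apply: (@le_trans _ _ (gam ([set a] `|` [set b]))).
  apply: le_measure; rewrite ?inE//; first by apply: measurableU; exact: measurable_set1.
apply: (@le_trans _ _ (gam [set a] + gam [set b])%E).
  by apply: measureU2; exact: measurable_set1.
by rewrite !gam_set1 adde0.
Qed.

Section null.
Context {R : realType} {n h : nat}.
Variable Theta : 'M[R]_n.
Hypothesis pd : posdef Theta.
Variable mu : probability (h.-tuple (n.-tuple R)) R.
Hypothesis mu_res : resample_inv Theta mu.
Local Notation data := (h.-tuple (n.-tuple R)).
Implicit Types (S V : {set 'I_n}) (x : data).

Lemma rowt_shiftt (e : 'rV[R]_h) z q :
  rowt (shiftt (fun s => e 0 s) z q) = rowt z + q *: e.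
Proof. by apply/rowP => s; rewrite !mxE tnth_mktuple. Qed.

(* Resampling first along p and then, in sample space, along the unit vector e
   reduces the claim to sections of dimension one. *)
Lemma null_by_lines p (B : set data) : (exists i, p i != 0) -> measurable B ->
  (forall x, exists2 e : 'rV[R]_h, dotr e e = 1 & forall z, exists a b, forall g,
     B (zipres (resX Theta p) x (shiftt (fun s => e 0 s) z g)) -> g = a \/ g = b) ->
  mu B = 0%E.
Proof.
move=> p0 mB null; rewrite -[B in mu B]setIT -integral_indic//.
have mI : measurable_fun setT (fun x : data => (\1_B x : R)%:E).
  by apply/measurable_EFinP; exact: measurable_indic.
have I0 x : (0 <= (\1_B x : R)%:E)%E by rewrite lee_fin.
rewrite (mu_res p0 mI I0); apply: integral0_eq => x _.
have mIx : measurable_fun setT (fun v => (\1_B (zipres (resX Theta p) x v) : R)%:E).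
  apply: (measurableT_comp mI).
  by apply: measurable_zipres => //; exact: measurable_resX.
have [e e1 He] := null x.
have e1' : \sum_s e 0 s ^+ 2 = 1 by rewrite -e1; apply: eq_bigr => s _; rewrite expr2.
have -> := Gam_resample e1' mIx (fun v => I0 _).
apply: integral0_eq => z _.
pose C : set R := [set g | B (zipres (resX Theta p) x
   (shiftt (fun s => e 0 s) z (g - dotf (fun s => e 0 s) z)))].
have mphi : measurable_fun setT (fun g : R => zipres (resX Theta p) x
   (shiftt (fun s => e 0 s) z (g - dotf (fun s => e 0 s) z))).
  apply: measurable_zipres => //; first exact: measurable_resX.
  by apply: measurable_shiftt => //; exact: measurable_funB.
have mC : measurable C by rewrite -[X in measurable X]setTI; exact: mphi.
transitivity (\int[gam]_g (\1_C g : R)%:E)%E.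
  by apply: eq_integral => g _.
rewrite integral_indic// setIT.
have [a [b ab]] := He z.
apply: (@gam_null_pair R (a + dotf (fun s => e 0 s) z) (b + dotf (fun s => e 0 s) z)) => //.
by move=> g /ab[<-|<-]; [left|right]; rewrite subrK.
Qed.

Lemma measurable_rho_le c c' S S' : measurable [set x : data | rho c S x <= rho c' S' x].
Proof. by apply: measurable_le_set; exact: measurable_rho. Qed.

(** Take e orthogonal to the columns in V. A vanishing residual makes the resampled X_i orthogonal
    to e, which determines g. *)
Lemma rho_null0 i V : i \notin V -> (#|V| < h)%N ->
  mu [set x | rho (delta i) V x <= 0] = 0%E.
Proof.
move=> iV Vh; apply: (null_by_lines (delta_neq0 (R := R) i)).
  by apply: measurable_le_set => //; exact: measurable_rho.
move=> x; have szV : (size [seq colv x j | j <- enum V] < h)%N by rewrite size_map -cardE.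
have [e e1 eV] := exists_perp szV; exists e => // z.
have t0 : 0 < Theta i i := Theta_gt0 pd i.
set sg := (Num.sqrt (Theta i i))^-1.
have sg0 : sg != 0 by rewrite invr_neq0// gt_eqF// sqrtr_gt0.
pose y0 := comb x (wstar Theta i) + sg *: rowt z.
exists (- dotr e y0 / sg), 0 => g /=; rewrite rho_res_self// rowt_shiftt -/sg => le0; left.
have [w sw wE] := rhov_attained x (comb x (wstar Theta i) + sg *: (rowt z + g *: e)) V.
have : dist2 x (comb x (wstar Theta i) + sg *: (rowt z + g *: e)) w == 0.
  by rewrite wE eq_le le0 rhov_ge0.
rewrite /dist2 dotrr_eq0 subr_eq0 => /eqP ye.
have : dotr e (comb x w) = 0.
  rewrite dotr_sumr big1// => j _; rewrite dotrZr dotrC.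
  have [jV|jV] := boolP (j \in V); last by rewrite sw// mul0r.
  by rewrite eV ?mulr0// map_f// mem_enum.
rewrite -ye scalerDr addrA -/y0 dotrDr !dotrZr e1 mulr1 => /eqP.
by rewrite addr_eq0 => /eqP ->; rewrite opprK [sg * g]mulrC mulfK.
Qed.

Lemma comb_res_delta k x v w : comb (zipres (resX Theta (delta k)) x v) w =
  comb x w + w k *: (colv (zipres (resX Theta (delta k)) x v) k - colv x k).
Proof.
rewrite /comb (bigD1 k)//= [in RHS](bigD1 k)//= scalerBr.
set s1 := \sum_(_ | _) _; set s2 := \sum_(_ | _) _.
have -> : s1 = s2.
  apply: eq_bigr => j jk; rewrite colv_res0//.
  by rewrite /delta (negbTE jk).
by rewrite [RHS]addrAC; congr (_ + _); rewrite addrC subrK.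
Qed.

(** Column [k] is resampled: it enters the regression on S, but not those on S' and V. It remains to
    see that a tie leaves at most two values for its position on a suitable line. *)
Lemma rho_null_eq i k S S' : i \notin S -> i \notin S' -> k \in S -> k \notin S' ->
  (#|S| < h)%N ->
  mu [set x | rho (delta i) S x = rho (delta i) S' x /\
              ~ (rho (delta i) (S :\ k) x <= 0)] = 0%E.
Proof.
move=> iS iS' kS kS' Sh; set V := S :\ k.
have ki : k != i by apply: contraNneq iS => <-.
have kV : k \notin V by rewrite !inE eqxx.
have iV : i \notin V by rewrite !inE negb_and iS orbT.
have VS : V \subset S by exact: finset.subsetDl.
have cV : (#|V|.+1 = #|S|)%N by rewrite (cardsD1 k S) kS.
apply: (null_by_lines (delta_neq0 (R := R) k)).
  rewrite (_ : mkset _ = [set x | rho (delta i) S x <= rho (delta i) S' x] `&`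
     [set x | rho (delta i) S' x <= rho (delta i) S x] `&`
     ~` [set x | rho (delta i) V x <= 0]).
    apply: measurableI; first by apply: measurableI; exact: measurable_rho_le.
    by apply: measurableC; apply: measurable_le_set => //; exact: measurable_rho.
  apply/seteqP; split => x /=.
    by move=> [-> h0]; rewrite lexx.
  by move=> [[h1 h2] h3]; split => //; apply/eqP; rewrite eq_le h1 h2.
move=> x; pose y := colv x i.
set X' := fun v => zipres (resX Theta (delta k)) x v.
have colX v j : j != k -> colv (X' v) j = colv x j.
  by move=> jk; rewrite colv_res0// /delta (negbTE jk).
have rhoX v (U : {set 'I_n}) : k \notin U -> rho (delta i) U (X' v) = rhov x y U.
  move=> kU; rewrite /rho comb_delta colX 1?eq_sym//; apply: rhov_eqcols => j jU.
  by rewrite colX//; apply: contraNneq kU => <-.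
have rhoXS v : rho (delta i) S (X' v) = rhov (X' v) y S.
  by rewrite /rho comb_delta colX 1?eq_sym.
set sg := (Num.sqrt (Theta k k))^-1.
have sg0 : sg != 0 by rewrite invr_neq0// gt_eqF// sqrtr_gt0 (Theta_gt0 pd).
pose x0 z := comb x (wstar Theta k) + sg *: rowt z.
have colk (e : 'rV[R]_h) z g :
    colv (X' (shiftt (fun s => e 0 s) z g)) k = x0 z + (sg * g) *: e.
  by rewrite colv_res_self// rowt_shiftt -/sg scalerDr addrA scalerA.
have combX v w : comb (X' v) w = comb x w + w k *: (colv (X' v) k - colv x k).
  exact: comb_res_delta.
have [qs obV _] := onb_exists x V.
have [onV _ _] := obV.
pose a := y - proj qs y.
have aE : dotr a a = rhov x y V by rewrite dist_proj// (rhovE _ obV).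
(* Nothing to prove on such lines: they do not meet the set, by its second condition. *)
have [a0|a0] := eqVneq (rhov x y V) 0.
  have [e e1 _] := @exists_perp R h [::] (leq_ltn_trans (leq0n _) Sh).
  by exists e => // z; exists 0, 0 => g [_]; rewrite rhoX// a0 lexx.
have aa : 0 < dotr a a by rewrite aE lt_neqAle eq_sym a0 rhov_ge0.
(* If S' does exactly as well as V, a tie says that column k does not improve on V. Then it is
   orthogonal to the residual [a], and moving it along [a] allows one value only. *)
have [cV0|cV0] := eqVneq (rhov x y S') (rhov x y V).
- exists ((Num.sqrt (dotr a a))^-1 *: a).
    rewrite dotrZl dotrZr mulrA -invfM -expr2 sqr_sqrtr ?(ltW aa)//.
    by rewrite mulVf// gt_eqF.
  set e := _ *: a => z.
  have ae : dotr a e != 0.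
    by rewrite dotrZr mulf_neq0 ?invr_neq0 ?gt_eqF ?sqrtr_gt0.
  exists (- dotr a (x0 z) / (sg * dotr a e)), 0 => g [].
  rewrite rhoXS rhoX// cV0 => eqV _; left; set v := shiftt _ _ _ in eqV *.
  set xk := colv (X' v) k.
  suff axk : dotr a xk = 0.
    move: axk; rewrite /xk colk dotrDr dotrZr mulrAC => /eqP.
    rewrite addr_eq0 => /eqP ->; rewrite opprK mulrC mulKf//.
    by rewrite mulf_neq0.
  apply/eqP; apply/negP => /negP axk.
  have xk0 : 0 < dotr xk xk.
    by rewrite dotrr_gt0; apply: contraNneq axk => ->; rewrite dotr0.
  have [w sw pw] := proj_comb y obV.
  pose t := dotr a xk / dotr xk xk.
  pose w' j := t * delta k j + w j.
  have sw' : supported S w'.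
    apply: supported_lin.
      exact: supported_delta.
    by move=> j jS; apply: sw; apply: contra jS; exact: (fintype.subsetP VS).
  have : rhov (X' v) y S <= dotr (a - t *: xk) (a - t *: xk).
    apply: (le_trans (rhov_le _ _ sw')); rewrite /dist2.
    have -> : y - comb (X' v) w' = a - t *: xk; last by [].
    rewrite /w' comb_lin comb_delta -/xk combX (sw k kV) scale0r addr0 -pw.
    by rewrite /a opprD addrCA addrC.
  rewrite eqV -aE.
  have -> : dotr (a - t *: xk) (a - t *: xk) = dotr a a - dotr a xk ^+ 2 / dotr xk xk.
    rewrite dotrr_subZ /t; field.
    by rewrite gt_eqF.
  rewrite lerBrDr gerDl leNgt => /negP; apply.
  by rewrite divr_gt0// lt_neqAle eq_sym sqrf_eq0 axk sqr_ge0.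
(* Otherwise column k moves orthogonally to y and to the columns in V, so that for fixed weights the
   error depends on g only through (al + sg g)^2. *)
have szy : (size (y :: [seq colv x j | j <- enum V]) < h)%N.
  by rewrite /= size_map -cardE cV.
have [e e1 eV] := exists_perp szy; exists e => // z.
have ey : dotr y e = 0 by apply: eV; exact: mem_head.
have ej j : j \in V -> dotr (colv x j) e = 0.
  by move=> jV; apply: eV; rewrite in_cons map_f ?orbT// mem_enum.
pose al := dotr (x0 z) e.
pose X g := X' (shiftt (fun s => e 0 s) z g).
have distE w : supported S w -> exists r : R,
    forall g', dist2 (X g') y w = r + w k ^+ 2 * (al + sg * g') ^+ 2.
  move=> sw; pose r := y - comb x w + w k *: (colv x k - x0 z).
  have re : dotr r e = - (w k * al).
    rewrite /r dotrDl dotrBl ey sub0r dotrZl dotrBl /comb dotr_suml (bigD1 k)//= big1.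
      by rewrite addr0 dotrZl /al; ring.
    move=> j jk; rewrite dotrZl; have [jS|jS] := boolP (j \in S).
      by rewrite ej ?mulr0// !inE jk.
    by rewrite sw// mul0r.
  exists (dotr r r - w k ^+ 2 * al ^+ 2) => g'.
  have -> : dist2 (X g') y w = dotr (r - (w k * (sg * g')) *: e) (r - (w k * (sg * g')) *: e).
    suff E : y - comb (X g') w = r - (w k * (sg * g')) *: e by rewrite /dist2 E.
    rewrite combX colk /r.
    move: (comb x w) (x0 z) (colv x k) (w k) (sg * g') => A B C p q.
    by apply/rowP => s; rewrite !mxE; ring.
  rewrite dotrr_subZ re e1; ring.
(* At a tie the optimal weight of column k is nonzero, as V alone does not attain the value of S'. A
   smaller square would then give a strictly smaller residual, so the square is determined. *)
have uniq_abs g1 g2 : rhov (X g1) y S = rhov x y S' -> rhov (X g2) y S = rhov x y S' ->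
    (al + sg * g2) ^+ 2 <= (al + sg * g1) ^+ 2.
  move=> E1 E2; rewrite leNgt; apply/negP => lt12.
  have [w sw wE] := rhov_attained (X g2) y S.
  have wk : w k != 0.
    apply: contra_neq cV0 => wk.
    have swV : supported V w.
      move=> j; rewrite !inE negb_and negbK => /orP[/eqP->//|]; exact: sw.
    have dE : dist2 (X g2) y w = dist2 x y w by rewrite /dist2 combX wk scale0r addr0.
    apply/eqP; rewrite -E2 -wE eq_le; apply/andP; split; last by rewrite dE rhov_le.
    rewrite wE; apply: (le_trans (rhov_subset _ _ VS)).
    by rewrite (rhov_eqcols (x' := x))// => j jV; rewrite colX//; apply: contraNneq kV => <-.
  have [r rE] := distE w sw.
  have := rhov_le (X g1) y sw; rewrite E1 -E2 -wE !rE lerD2l leNgt => /negP; apply.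
  by rewrite ltr_pM2l// exprn_even_gt0.
have [[g1 B1]|nB] := pselect (exists g, rhov (X g) y S = rhov x y S'); last first.
  exists 0, 0 => g [E _]; exfalso; apply: nB; exists g.
  by move: E; rewrite -/(X' _) rhoXS rhoX.
exists g1, (- (2 * al + sg * g1) / sg) => g [E _].
have Bg : rhov (X g) y S = rhov x y S' by move: E; rewrite -/(X' _) rhoXS rhoX.
have : (al + sg * g) ^+ 2 == (al + sg * g1) ^+ 2.
  by rewrite eq_le !uniq_abs.
rewrite eqf_sqr => /orP[|] /eqP eg; [left|right].
  by apply: (mulfI sg0); apply: (addrI al).
have -> : g = (al + sg * g - al) / sg by field.
by rewrite eg; congr (_ / _); ring.
Qed.

End null.

(** * Correctness on good data *)

Section algorithm.
Context {R : realType} {n h : nat}.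
Implicit Types (x : h.-tuple (n.-tuple R)) (i : 'I_n) (S V W : {set 'I_n}).
Local Notation datam x := (data_matrix (tnth x)).

Lemma rssE x i w : rss (datam x) i w = dist2 x (colv x i) (fun j => w j ord0).
Proof.
apply: eq_bigr => s _; rewrite !mxE combE expr2.
by congr ((_ - _) * (_ - _)); apply: eq_bigr => j _; rewrite mxE.
Qed.

Lemma supported_supp (w : 'cV[R]_n) S :
  supp w \subset S -> supported S (fun j => w j ord0).
Proof.
move=> /fintype.subsetP sw j jS; apply/eqP; apply: contraNT jS => wj.
by apply: sw; rewrite inE.
Qed.

Lemma supp_supported (w : 'I_n -> R) S :
  supported S w -> supp (\col_j w j) \subset S.
Proof.
move=> sw; apply/fintype.subsetP => j; rewrite inE mxE.
by apply: contraR => /sw ->.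
Qed.

Lemma col_fun (w : 'I_n -> R) : (fun j => (\col_k w k) j ord0) = w.
Proof. by apply/funext => j; rewrite mxE. Qed.

Lemma ols_varE x i S :
  ols_var (datam x) i S = (h%:R - #|S|%:R)^-1 * rho (delta i) S x.
Proof.
rewrite /ols_var /rho comb_delta /rhov; congr (_ * inf _).
apply/seteqP; split => _ [w sw <-].
  by exists (fun j => w j ord0); [exact: supported_supp|rewrite rssE].
exists (\col_j w j); first exact: supp_supported.
by rewrite rssE col_fun.
Qed.

(** Stated for supports, since the validation sees the minimizers only through them. *)
Definition selects x i (d : nat) S :=
  [/\ i \notin S, (#|S| <= d)%N &
   forall V, i \notin V -> (#|V| <= d)%N -> rho (delta i) S x <= rho (delta i) V x].

Lemma sparse_minimizer_selects x i d w : (0 < h)%N ->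
  sparse_minimizer (datam x) i d w -> selects x i d (supp w).
Proof.
move=> h0 [wi sw wmin]; split => //; first by rewrite inE wi eqxx.
move=> V iV cV; rewrite {2}/rho comb_delta.
have [v sv <-] := rhov_attained x (colv x i) V.
have vV := supp_supported sv.
apply: (@le_trans _ _ (rss (datam x) i w)).
  by rewrite rssE /rho comb_delta; apply: rhov_le; exact: supported_supp.
rewrite -[v in leRHS]col_fun -rssE.
have := wmin (\col_j v j); rewrite /emp_risk ler_pM2l ?invr_gt0 ?ltr0n//; apply.
  by rewrite mxE sv.
by rewrite (leq_trans _ cV)// subset_leq_card.
Qed.

Variable Theta : 'M[R]_n.
Local Notation nb := (neighbors Theta).

Definition rejection x nu i j W :=
  ols_var (datam x) i (W :\ j) - ols_var (datam x) i W > nu * ols_var (datam x) i W.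

(** Only unions with [nb i] occur: a round d' < |N| is rejected by comparison with d'' = |N|, and
    the round d' = |N| has to survive every d''. *)
Definition validates x nu i S :=
  (forall j, j \in nb i :\: S -> rejection x nu i j (nb i :|: S)) /\
  (forall j, j \in S :\: nb i -> ~~ rejection x nu i j (nb i :|: S)).

Lemma search_and_validate_correct x1 x2 i d nu out : (0 < h)%N -> (#|nb i| <= d)%N ->
  (forall S, selects x1 i #|nb i| S -> S = nb i) ->
  (forall d' S, (d' <= d)%N -> selects x1 i d' S -> validates x2 nu i S) ->
  search_and_validate (datam x1) (datam x2) i d nu out -> out = Some (nb i).
Proof.
move=> h0 nbd sel val [w wmin ->].
have wsel d' : (d' <= d)%N -> selects x1 i d' (supp (w d')).
  by move=> /wmin; exact: sparse_minimizer_selects.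
have wnb : supp (w #|nb i|) = nb i by apply: sel; exact: wsel.
have nrej : ~~ rejects (datam x2) i d nu w #|nb i|.
  apply/hasPn => d''; rewrite mem_iota add0n ltnS => /= d''d.
  rewrite negb_and; apply/orP; right; apply/existsPn => j; apply/negP => /andP[].
  rewrite wnb => jS; apply/negP.
  by case: (val d'' _ d''d (wsel _ d''d)) => _; exact.
have rej d' : (d' < #|nb i|)%N -> rejects (datam x2) i d nu w d'.
  move=> d'nb; have d'd : (d' <= d)%N by rewrite (leq_trans _ nbd)// ltnW.
  have [iS cS _] := wsel _ d'd.
  have : ~~ (nb i \subset supp (w d')).
    by apply/negP => /subset_leq_card; rewrite leqNgt (leq_ltn_trans cS).
  case/fintype.subsetPn => j jnb jS.
  apply/hasP; exists #|nb i|; first by rewrite mem_iota add0n ltnS.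
  rewrite neq_ltn d'nb orbT /=; apply/existsP; exists j; rewrite wnb.
  have jD : j \in nb i :\: supp (w d') by rewrite finset.in_setD jS.
  rewrite jD /=; case: (val d' _ d'd (wsel _ d'd)) => /(_ j jD) + _.
  by rewrite /rejection finset.setUC.
(* The output is the first survivor, so the rounds after |N| need no analysis. *)
rewrite /validate (_ : iota 0 d.+1 = iota 0 #|nb i| ++ iota #|nb i| (d - #|nb i|).+1).
  have none : [seq d' <- iota 0 #|nb i| | ~~ rejects (datam x2) i d nu w d'] = [::].
    apply/eqP; rewrite -size_eq0 size_filter -leqn0 leqNgt -has_count; apply/hasPn => d'.
    by rewrite mem_iota add0n => /= /rej ->.
  by rewrite filter_cat none /= nrej /= wnb.
by rewrite -[X in iota X _.+1]add0n -iotaD addnS subnKC.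
Qed.

End algorithm.

(** * Probability of bad data *)

Section finite_unions.
Context {d} {T : measurableType d} {R : realType} (mu : probability T R).
Context {I : finType} (P : pred I) (A : I -> set T).
Hypothesis mA : forall i, P i -> measurable (A i).

Lemma exists_bigsetU : [set x | exists2 i, P i & A i x] = \big[setU/set0]_(i | P i) A i.
Proof.
rewrite -bigcup_seq_cond; apply/seteqP; split => x.
  by case=> i Pi Ai; exists i => //=; rewrite mem_index_enum.
by case=> i /= /andP[_ Pi] Ai; exists i.
Qed.

Lemma measurable_exists : measurable [set x | exists2 i, P i & A i x].
Proof. by rewrite exists_bigsetU; exact: bigsetU_measurable. Qed.

Lemma prob_exists_le (b : I -> \bar R) : (forall i, P i -> mu (A i) <= b i)%E ->
  (mu [set x | exists2 i, P i & A i x] <= \sum_(i | P i) b i)%E.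
Proof.
move=> mub; rewrite exists_bigsetU.
suff [] : (measurable (\big[setU/set0]_(i | P i) A i) /\
   mu (\big[setU/set0]_(i | P i) A i) <= \sum_(i | P i) b i)%E by [].
apply: (big_rec2 (fun X (r : \bar R) => measurable X /\ (mu X <= r)%E)).
  by split => //; rewrite measure0.
move=> i X r Pi [mX Xr]; split; first by apply: measurableU => //; exact: mA.
apply: (@le_trans _ _ (mu (A i) + mu X)%E); first by apply: measureU2 => //; exact: mA.
by apply: leeD => //; exact: mub.
Qed.

Lemma sum_disjoint_le1 : (forall i j, P i -> P j -> (A i `&` A j !=set0)%classic -> i = j) ->
  (\sum_(i | P i) mu (A i) <= 1)%E.
Proof.
move=> dA; suff <- : mu (\big[setU/set0]_(i | P i) A i) = (\sum_(i | P i) mu (A i))%E.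
  by apply: probability_le1; exact: bigsetU_measurable.
elim: (index_enum I) (index_enum_uniq I) => [_|i s IH /= /andP[si us]].
  by rewrite !big_nil measure0.
rewrite !big_cons; case: ifPn => Pi; last exact: IH.
have mS : measurable (\big[setU/set0]_(j <- s | P j) A j) by exact: bigsetU_measurable.
have mAi := mA Pi; rewrite measureU//; first by congr (_ + _)%E; exact: IH.
rewrite -bigcup_seq_cond; apply/seteqP; split => // x [Ax [j /= /andP[js Pj] Aj]].
have ij : i = j by apply: dA => //; exists x.
by move: si; rewrite ij js.
Qed.

End finite_unions.

Lemma prob_exists_cst {d} {T : measurableType d} {R : realType} (mu : probability T R)
    {I : finType} (P : pred I) (A : I -> set T) (b : R) :
  (forall i, P i -> measurable (A i)) -> 0 <= b ->
  (forall i, P i -> mu (A i) <= b%:E)%E ->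
  (mu [set x | exists2 i, P i & A i x] <= (#|I|%:R * b)%:E)%E.
Proof.
move=> mA b0 Ab; apply: (le_trans (prob_exists_le mA Ab)).
by rewrite sumEFin lee_fin sumr_const -[leLHS]mulr_natl ler_wpM2r// ler_nat max_card.
Qed.

(** Here u and v are Theta_ii times the residual sums without and with the column, and p = |W|. The
    gap 3/4 k h exceeds the threshold k/2 * 5/4 h by k h / 8. This margin pays for the change of
    normalisation from h - p to h - p + 1 as soon as k (h - p) > 15. *)
Lemma ols_gap_large {R : realType} (k h p u v : R) : 0 < k -> k <= 1 -> 16 <= k * h ->
  1 <= p -> 100 * p <= h -> 0 <= v -> v < 5 / 4 * h -> 3 / 4 * (k * h) < u - v ->
  k / 2 * ((h - p)^-1 * v) < (h - (p - 1))^-1 * u - (h - p)^-1 * v.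
Proof.
move=> k0 k1 kh p1 ph v0 vh uv; have q0 : 0 < h - p by lra.
have q1 : 0 < h - (p - 1) by lra.
have kq : 15 < k * (h - p).
  have : k * (100 * p) <= k * h by rewrite ler_pM2l.
  by rewrite mulrBr; lra.
have hpos : 0 < h by lra.
have main : 0 < (h - p) * u - (1 + k / 2) * v * (h - p + 1).
  have hk : h * (15 - k * (h - p)) < 0 by rewrite nmulr_llt0 //; lra.
  nra.
have -> : h - (p - 1) = h - p + 1 by ring.
rewrite -subr_gt0; set q := h - p in main q0 *.
have -> : (q + 1)^-1 * u - q^-1 * v - k / 2 * (q^-1 * v) =
   (q * u - (1 + k / 2) * v * (q + 1)) / (q * (q + 1)).
  by field; rewrite !gt_eqF//; lra.
by rewrite divr_gt0// mulr_gt0//; lra.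
Qed.

(** The change of normalisation helps here: with 1 / (h - p) in both terms the claim reduces to u -
    v < k h / 8 < k v / 2. *)
Lemma ols_gap_small {R : realType} (k h p u v : R) : 0 < k ->
  1 <= p -> p < h -> h / 4 < v -> 0 <= u -> u - v < k * h / 8 ->
  (h - (p - 1))^-1 * u - (h - p)^-1 * v <= k / 2 * ((h - p)^-1 * v).
Proof.
move=> k0 p1 ph vh u0 uv; have q0 : 0 < h - p by lra.
apply: (@le_trans _ _ ((h - p)^-1 * u - (h - p)^-1 * v)).
  by rewrite lerD2r ler_wpM2r// lef_pV2 ?posrE; lra.
rewrite -mulrBr mulrCA ler_pM2l ?invr_gt0//.
have : k * (h / 4) < k * v by rewrite ltr_pM2l.
by lra.
Qed.

Section events.
Context {R : realType} {n h : nat}.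
Variables (Theta : 'M[R]_n) (kappa : R).
Hypotheses (pd : posdef Theta) (att : attractive Theta) (k0 : 0 < kappa)
  (nd : nondegenerate kappa Theta) (k1 : kappa <= 1).
Variable mu : probability (h.-tuple (n.-tuple R)) R.
Hypothesis mu_res : resample_inv Theta mu.
Local Notation data := (h.-tuple (n.-tuple R)).
Implicit Types (A S W : {set 'I_n}) (x : data).
Local Notation nb := (neighbors Theta).

Let t0 i : 0 < Theta i i := Theta_gt0 pd i.
Let k20 : 0 < kappa ^+ 2. Proof. by rewrite exprn_gt0. Qed.
Let k21 : kappa ^+ 2 <= 1. Proof. by rewrite exprn_ile1// ltW. Qed.

Let mrho c S : measurable_fun setT (fun x : data => rho c S x).
Proof. exact: measurable_rho. Qed.

Let mgap i S W : measurable_fun setT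
  (fun x : data => Theta i i * (rho (delta i) S x - rho (delta i) W x)).
Proof. by apply: measurable_funM => //; exact: measurable_funB. Qed.

Let mtrho i W : measurable_fun setT (fun x : data => Theta i i * rho (delta i) W x).
Proof. by apply: measurable_funM. Qed.

Lemma nb_notin i : i \notin nb i.
Proof. by rewrite inE eqxx. Qed.

(* The thresholds separate the two hypotheses: removing a neighbor of i from W
   increases the residual sum of squares by about kappa^2 h / Theta_ii, removing
   a non-neighbor by O(1 / Theta_ii). *)
Definition bad_column i S j : set data :=
  let W := nb i :|: S in
  if j \in nb i
  then [set x | Theta i i * (rho (delta i) (W :\ j) x - rho (delta i) W x) <=
                3 / 4 * (kappa ^+ 2 * h%:R)]
  else [set x | kappa ^+ 2 * h%:R / 8 <=
                Theta i i * (rho (delta i) (W :\ j) x - rho (delta i) W x)].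

Definition bad_validation i S : set data :=
  [set x | exists2 j, j \in (nb i :\: S) :|: (S :\: nb i) & bad_column i S j x] `|`
  ([set x | 5 / 4 * h%:R <= Theta i i * rho (delta i) (nb i :|: S) x] `|`
   [set x | Theta i i * rho (delta i) (nb i :|: S) x <= h%:R / 4]).

Lemma measurable_bad_column i S j : measurable (bad_column i S j).
Proof. by rewrite /bad_column; case: ifP => _; exact: measurable_le_set. Qed.

Lemma measurable_bad_validation i S : measurable (bad_validation i S).
Proof.
apply: measurableU; last by apply: measurableU; exact: measurable_le_set.
by apply: measurable_exists => j _; exact: measurable_bad_column.
Qed.

Lemma rejectionE x i j W : j \in W -> rejection x (kappa ^+ 2 / 2) i j W =
  (kappa ^+ 2 / 2 * ((h%:R - #|W|%:R)^-1 * (Theta i i * rho (delta i) W x)) <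
   (h%:R - (#|W|%:R - 1))^-1 * (Theta i i * rho (delta i) (W :\ j) x) -
   (h%:R - #|W|%:R)^-1 * (Theta i i * rho (delta i) W x)).
Proof.
move=> jW; have -> : #|W|%:R - 1 = #|W :\ j|%:R :> R.
  by rewrite (cardsD1 j W) jW natrD addrC addKr.
rewrite /rejection !ols_varE.
rewrite -[LHS](ltr_pM2l (t0 i)); congr (_ < _); ring.
Qed.

Lemma validates_of_not_bad i S x : (100 * #|nb i :|: S| <= h)%N ->
  16 <= kappa ^+ 2 * h%:R -> ~ bad_validation i S x ->
  validates Theta x (kappa ^+ 2 / 2) i S.
Proof.
move=> cW kh /not_orP[nB /not_orP[/negP + /negP]]; rewrite -!ltNge => up low.
have hW : 100 * #|nb i :|: S|%:R <= h%:R :> R by rewrite -natrM ler_nat.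
have W1 j : j \in nb i :|: S -> 1 <= #|nb i :|: S|%:R :> R.
  by move=> jW; rewrite ler1n card_gt0; apply/finset.set0Pn; exists j.
have r0 W : 0 <= Theta i i * rho (delta i) W x.
  by rewrite mulr_ge0 ?(ltW (t0 i))//; exact: rhov_ge0.
have nBj j : j \in (nb i :\: S) :|: (S :\: nb i) -> ~ bad_column i S j x.
  by move=> jD jB; apply: nB; exists j.
split=> j jD; have := nBj j; rewrite finset.in_setU jD ?orbT => /(_ isT).
- have [jnb jS] : j \in nb i /\ j \notin S by move: jD; rewrite finset.in_setD => /andP[].
  have jW : j \in nb i :|: S by rewrite finset.in_setU jnb.
  rewrite /bad_column jnb /= => /negP; rewrite -ltNge mulrBr => gap.
  rewrite rejectionE//; apply: ols_gap_large gap => //; exact: W1 jW.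
- have [jS jnb] : j \in S /\ j \notin nb i by move: jD; rewrite finset.in_setD => /andP[].
  have jW : j \in nb i :|: S by rewrite finset.in_setU jS orbT.
  rewrite /bad_column (negbTE jnb) /= => /negP; rewrite -ltNge mulrBr => gap.
  rewrite rejectionE// -leNgt; apply: ols_gap_small gap => //; first exact: W1 jW.
  by have := W1 _ jW; lra.
Qed.

(** The exponent of [prob_rho_diff] at the threshold 3/4 kappa^2 h: 1/80 - 3/256 = 1/1280. The other
    tail bounds have larger exponents. *)
Local Notation q := (expR (- (kappa ^+ 2 * h%:R / 1280))).

Lemma prob_bad_column i S j : i \notin S -> (100 * #|nb i :|: S| <= h)%N ->
  j \in (nb i :\: S) :|: (S :\: nb i) ->
  (mu (bad_column i S j) <= (2 * q)%:E)%E.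
Proof.
move=> iS cW jD; set W := nb i :|: S in cW *.
have iW : i \notin W by rewrite finset.in_setU negb_or nb_notin.
have nbW : nb i \subset W by exact: finset.subsetUl.
have jW : j \in W.
  by move: jD; rewrite !finset.in_setU !finset.in_setD => /orP[]/andP[_ ->]; rewrite ?orbT.
have iWj : i \notin W :\ j by rewrite finset.in_setD negb_and iW orbT.
have x0 : 0 <= kappa ^+ 2 * h%:R by rewrite mulr_ge0// ltW.
rewrite /bad_column -/W; case: ifPn => jnb.
  have nbD : nb i :\: (W :\ j) = [set j]%SET.
    apply/finset.setP => a; rewrite finset.in_setD finset.in_setD1 finset.in_set1 negb_and negbK.
    have [->|aj] /= := eqVneq a j; first by rewrite jnb.
    by apply/negP => /andP[aW anb]; rewrite (fintype.subsetP nbW _ anb) in aW.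
  have WD : (W :\ j) :\: W = finset.set0.
    by apply/eqP; rewrite finset.setD_eq0; exact: finset.subsetDl.
  have := @prob_rho_diff R n h Theta kappa pd att k0 nd mu mu_res i (W :\ j) W
    (3 / 4 * (kappa ^+ 2 * h%:R)) iWj iW nbW.
  rewrite nbD WD cards0 cards1 expr0 !mul1r => H; apply: (le_trans (H _ _)).
  - by apply/finset.set0Pn; exists j; rewrite finset.in_set1.
  - by move: cW; rewrite (cardsD1 j W) jW.
  rewrite lee_fin; apply: (@le_trans _ _ q); first by rewrite ler_expR; lra.
  by rewrite mulrDl mul1r lerDl expR_ge0.
have := @prob_rho_gain R n h Theta pd mu mu_res i (W :\ j) W
    (kappa ^+ 2 * h%:R / 8) iW.
move=> H; apply: (le_trans (H _ _ _)).
- apply/fintype.subsetP => a anb; rewrite finset.in_setD1 (fintype.subsetP nbW)// andbT.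
  by apply: contraNneq jnb => <-.
- exact: finset.subsetDl.
- rewrite (_ : _ :\: _ = [set j]%SET) ?cards1//.
  apply/finset.setP => a; rewrite finset.in_setD finset.in_setD1 finset.in_set1 negb_and negbK.
  by have [->|aj] /= := eqVneq a j; [rewrite jW|case: (a \in W)].
by rewrite lee_fin ler_pM2l// ler_expR; lra.
Qed.

Lemma prob_bad_validation i S : i \notin S -> (100 * #|nb i :|: S| <= h)%N ->
  (mu (bad_validation i S) <= (4 * n%:R * q)%:E)%E.
Proof.
move=> iS cW.
have n1 : 1 <= n%:R :> R by rewrite ler1n (leq_ltn_trans _ (ltn_ord i)).
have q0 : 0 <= q by exact: expR_ge0.
have h0 : 0 <= h%:R :> R by rewrite ler0n.
have kh : kappa ^+ 2 * h%:R <= h%:R by rewrite ler_piMl.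
have iW : i \notin nb i :|: S by rewrite finset.in_setU negb_or nb_notin.
have nbW : nb i \subset nb i :|: S by exact: finset.subsetUl.
have mlow : measurable [set x : data | Theta i i * rho (delta i) (nb i :|: S) x <= h%:R / 4].
  exact: measurable_le_set.
have mup : measurable [set x : data | 5 / 4 * h%:R <= Theta i i * rho (delta i) (nb i :|: S) x].
  exact: measurable_le_set.
apply: (@le_trans _ _ ((n%:R * (2 * q))%:E + (q%:E + q%:E))%E); last first.
  rewrite -!EFinD lee_fin; nra.
apply: (le_trans (measureU2 _ _ _)).
- by apply: measurable_exists => j _; exact: measurable_bad_column.
- exact: measurableU.
apply: leeD.
  pose D := (nb i :\: S) :|: (S :\: nb i).
  have mD j : j \in D -> measurable (bad_column i S j) by move=> _; exact: measurable_bad_column.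
  have q2 : 0 <= 2 * q by rewrite mulr_ge0// ler0n.
  have := @prob_exists_cst _ _ R mu 'I_n (mem D) (bad_column i S) (2 * q) mD q2
    (fun j => prob_bad_column iS cW).
  by rewrite card_ord.
apply: (le_trans (measureU2 _ _ _)) => //; apply: leeD.
  apply: le_trans (prob_rho_upper pd mu_res iW nbW) _.
  by rewrite lee_fin ler_expR; lra.
apply: le_trans (prob_rho_lower pd mu_res iW nbW cW) _.
by rewrite lee_fin ler_expR; lra.
Qed.

End events.

(** Expand the product over j in I of two summands, 1 if S agrees with N at j and y if it does
    not. *)
Lemma sum_symdiff {R : comNzRingType} {I : finType} (y : R) (N : {set I}) :
  \sum_(S : {set I}) y ^+ (#|N :\: S| + #|S :\: N|) = (1 + y) ^+ #|I|.
Proof.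
pose F j := if j \in N then 1 else y; pose G j := if j \in N then y else 1.
have -> : (1 + y) ^+ #|I| = \prod_j (F j + G j).
  rewrite -prodr_const; apply: eq_bigr => j _.
  by rewrite /F /G; case: ifP => // _; rewrite addrC.
rewrite bigA_distr; apply: eq_bigr => S _.
rewrite exprD -!prodr_const big_mkcond [X in _ * X]big_mkcond -big_split.
apply: eq_bigr => j _; rewrite !finset.in_setD /F /G.
by case: (j \in N); case: (j \in S); rewrite /= ?mulr1 ?mul1r.
Qed.

Lemma expR_le_1D2 {R : realType} (x : R) : 0 <= x -> x <= 1 / 2 -> expR x <= 1 + 2 * x.
Proof.
move=> x0 x1; have := expR_ge1Dx (- x); rewrite expRN => H.
have e0 := expR_gt0 x; have : (1 - x) * expR x <= 1.
  by rewrite -ler_pdivlMr// mul1r.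
by nra.
Qed.

Lemma sum_symdiff_neq_le {R : realType} {I : finType} (y : R) (N : {set I}) :
  0 <= y -> #|I|%:R * y <= 1 / 2 ->
  \sum_(S : {set I} | S != N) y ^+ (#|N :\: S| + #|S :\: N|) <= 2 * (#|I|%:R * y).
Proof.
move=> y0 yI; have := sum_symdiff y N.
rewrite (bigD1 N)//= finset.setDv cards0 expr0 => /(canRL (addKr _)) ->.
rewrite addrC lerBlDr [leRHS]addrC.
apply: le_trans (expR_le_1D2 _ yI); last by rewrite mulr_ge0.
by rewrite mulrC expRM_natr lerXn2r ?nnegrE ?expR_ge1Dx ?expR_ge0//; lra.
Qed.

(** * Ties and wrong selections in the first sample *)

Section selection.
Context {R : realType} {n h : nat}.
Variables (Theta : 'M[R]_n) (kappa : R).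
Hypotheses (pd : posdef Theta) (att : attractive Theta) (k0 : 0 < kappa)
  (nd : nondegenerate kappa Theta) (k1 : kappa <= 1).
Variable mu : probability (h.-tuple (n.-tuple R)) R.
Hypothesis mu_res : resample_inv Theta mu.
Local Notation data := (h.-tuple (n.-tuple R)).
Implicit Types (A S W : {set 'I_n}) (x : data).
Local Notation nb := (neighbors Theta).

Let mrho c S : measurable_fun setT (fun x : data => rho c S x).
Proof. exact: measurable_rho. Qed.

Lemma measurable_rho_eq i S S' : measurable [set x : data | rho (delta i) S x = rho (delta i) S' x].
Proof.
rewrite (_ : mkset _ = [set x | rho (delta i) S x <= rho (delta i) S' x] `&`
     [set x | rho (delta i) S' x <= rho (delta i) S x]).
  by apply: measurableI; exact: measurable_le_set.
apply/seteqP; split => x /=; first by move=> ->; rewrite lexx.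
by move=> [a b]; apply/eqP; rewrite eq_le a b.
Qed.

Lemma rho_null_neq i S S' : i \notin S -> i \notin S' -> S != S' ->
  (#|S| < h)%N -> (#|S'| < h)%N ->
  mu [set x : data | rho (delta i) S x = rho (delta i) S' x] = 0%E.
Proof.
wlog : S S' / exists2 k, k \in S & k \notin S' => [H iS iS' SS' cS cS'|[k kS kS'] iS iS' _ cS _].
  have [SS|/fintype.subsetPn[k kS kS']] := boolP (S \subset S'); last by apply: H => //; exists k.
  have : ~~ (S' \subset S) by move: SS'; rewrite finset.eqEsubset SS.
  case/fintype.subsetPn => k kS' kS; rewrite (_ : mkset _ =
    [set x : data | rho (delta i) S' x = rho (delta i) S x]).
    by apply: H; rewrite 1?eq_sym//; exists k.
  by apply/seteqP; split => x /= ->.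
have iV : i \notin S :\ k by rewrite finset.in_setD1 negb_and iS orbT.
have cV : (#|S :\ k| < h)%N.
  by rewrite (leq_ltn_trans _ cS)// subset_leq_card// finset.subsetDl.
have mV : measurable [set x : data | rho (delta i) (S :\ k) x <= 0].
  exact: measurable_le_set.
have mE : measurable [set x : data | rho (delta i) S x = rho (delta i) S' x /\
                                     ~ (rho (delta i) (S :\ k) x <= 0)].
  rewrite (_ : mkset _ = [set x : data | rho (delta i) S x = rho (delta i) S' x] `&`
    ~` [set x : data | rho (delta i) (S :\ k) x <= 0]) //.
  by apply: measurableI; [exact: measurable_rho_eq|exact: measurableC].
apply/eqP; rewrite -measure_le0.
rewrite -[leRHS](adde0 0%E) -{1}(rho_null_eq pd mu_res iS iS' kS kS' cS).
rewrite -(rho_null0 pd mu_res iV cV).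
apply: le_trans (measureU2 _ mE mV); apply: le_measure.
- by rewrite inE; exact: measurable_rho_eq.
- by rewrite inE; exact: measurableU.
- by move=> x /= e; case: (pselect (rho (delta i) (S :\ k) x <= 0)) => H; [right|left].
Qed.

Definition ties (d : nat) : set data :=
  [set x | exists2 p : 'I_n * ({set 'I_n} * {set 'I_n}),
     [&& p.1 \notin p.2.1, p.1 \notin p.2.2, p.2.1 != p.2.2,
         (#|p.2.1| <= d)%N & (#|p.2.2| <= d)%N] &
     rho (delta p.1) p.2.1 x = rho (delta p.1) p.2.2 x].

Lemma measurable_ties d : measurable (ties d).
Proof. by apply: measurable_exists => p _; exact: measurable_rho_eq. Qed.

Lemma prob_ties d : (d < h)%N -> mu (ties d) = 0%E.
Proof.
move=> dh; apply/eqP; rewrite -measure_le0.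
apply: le_trans (prob_exists_le _ _) _.
- by move=> p _; exact: measurable_rho_eq.
- move=> p /and5P[iS iS' SS' cS cS']; rewrite (rho_null_neq iS iS' SS' _ _).
  + exact: lexx.
  + exact: leq_ltn_trans dh.
  + exact: leq_ltn_trans dh.
by rewrite big1.
Qed.

(* Strict, hence disjoint for distinct S. *)
Definition strictly_selects i d S : set data :=
  [set x | ~ exists2 V : {set 'I_n}, [&& i \notin V, (#|V| <= d)%N & V != S] &
     rho (delta i) V x <= rho (delta i) S x].

Lemma measurable_strictly_selects i d S : measurable (strictly_selects i d S).
Proof.
by apply: measurableC; apply: measurable_exists => V _; exact: measurable_le_set.
Qed.

Lemma selects_strictly i d d' S x : (d' <= d)%N -> ~ ties d x -> selects x i d' S ->
  strictly_selects i d' S x.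
Proof.
move=> dd nt [iS cS min] [V /and3P[iV cV VS] le]; apply: nt.
exists (i, (V, S)) => /=; last by apply/eqP; rewrite eq_le le min.
by rewrite iS iV VS !(leq_trans _ dd).
Qed.

Lemma sum_strictly_selects_le1 i d :
  (\sum_(S : {set 'I_n} | (i \notin S) && (#|S| <= d)%N) mu (strictly_selects i d S) <= 1)%E.
Proof.
apply: sum_disjoint_le1 => [S _|S S' /andP[iS cS] /andP[iS' cS'] [x [sS sS']]].
  exact: measurable_strictly_selects.
apply/eqP; apply: contra_notT sS => SS'.
have [le|/ltW le] := leP (rho (delta i) S' x) (rho (delta i) S x).
  by exists S' => //; rewrite iS' cS' eq_sym.
by exfalso; apply: sS'; exists S => //; rewrite iS cS.
Qed.

Definition wrong_selection_at i : set data :=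
  [set x | exists2 S : {set 'I_n}, [&& i \notin S, (#|S| <= #|nb i|)%N & S != nb i] &
     Theta i i * (rho (delta i) S x - rho (delta i) (nb i) x) <= 0].

Definition wrong_selection : set data :=
  [set x | exists2 i, true & wrong_selection_at i x].

Let mdiff i S : measurable [set x : data |
  Theta i i * (rho (delta i) S x - rho (delta i) (nb i) x) <= 0].
Proof.
by apply: measurable_le_set => //; apply: measurable_funM => //; exact: measurable_funB.
Qed.

Lemma measurable_wrong_selection_at i : measurable (wrong_selection_at i).
Proof.
by apply: (@measurable_exists _ _ _ _ (fun S : {set 'I_n} => [set x : data |
  Theta i i * (rho (delta i) S x - rho (delta i) (nb i) x) <= 0])) => S _.
Qed.

Lemma measurable_wrong_selection : measurable wrong_selection.
Proof. by apply: measurable_exists => i _; exact: measurable_wrong_selection_at. Qed.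

Lemma selects_nb i S x : ~ wrong_selection x -> selects x i #|nb i| S -> S = nb i.
Proof.
move=> nw [iS cS min]; apply/eqP; apply: contra_notT nw => SN.
exists i => //; exists S; first by rewrite iS cS.
rewrite pmulr_rle0 ?(Theta_gt0 pd)// subr_le0; apply: min => //.
by rewrite inE eqxx.
Qed.

Local Notation q := (expR (- (kappa ^+ 2 * h%:R / 1280))).

Lemma prob_wrong_selection (d : nat) : (forall i, #|nb i| <= d)%N ->
  (100 * d.+1 <= h)%N -> 4 * (n%:R * q) <= 1 ->
  (mu wrong_selection <= (4 * n%:R ^+ 2 * q)%:E)%E.
Proof.
move=> nbd dh nq; have q0 : 0 <= q by exact: expR_ge0.
have x0 : 0 <= kappa ^+ 2 * h%:R by rewrite mulr_ge0// ltW// exprn_gt0.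
(* As |S \ N| <= |N \ S|, the exponent |N \ S| / 80 can be shared evenly among the elements of the
   symmetric difference, 1/160 for each; this makes the bounds summable by [sum_symdiff_neq_le]. *)
pose y := 2 * expR (- (kappa ^+ 2 * h%:R / 160)).
have y0 : 0 <= y by rewrite mulr_ge0// expR_ge0.
have yq : y <= 2 * q by rewrite ler_pM2l// ler_expR; lra.
have ny : n%:R * y <= 1 / 2.
  by have := ler_wpM2l (ler0n R n) yq; lra.
have -> : (4 * n%:R ^+ 2 * q)%:E = (#|'I_n|%:R * (4 * (n%:R * q)))%:E :> \bar R.
  by rewrite card_ord; congr EFin; ring.
apply: prob_exists_cst.
- by move=> i _; exact: measurable_wrong_selection_at.
- by rewrite !mulr_ge0.
move=> i _.
pose b S : \bar R := (y ^+ (#|nb i :\: S| + #|S :\: nb i|))%:E.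
pose A S := [set x : data | Theta i i * (rho (delta i) S x - rho (delta i) (nb i) x) <= 0].
have mA S : [&& i \notin S, (#|S| <= #|nb i|)%N & S != nb i] -> measurable (A S) by move=> _; exact: mdiff.
apply: (le_trans (prob_exists_le (b := b) mA _)).
  move=> S /and3P[iS cS SN].
  have Nm : nb i :\: S != finset.set0.
    apply: contraNneq SN => /eqP; rewrite finset.setD_eq0 => NS.
    by rewrite eq_sym finset.eqEcard NS.
  have hS : (100 * #|S|.+1 <= h)%N.
    by rewrite (leq_trans _ dh)// leq_mul// ltnS (leq_trans cS).
  have iN : i \notin nb i by rewrite inE eqxx.
  have := @prob_rho_diff R n h Theta kappa pd att k0 nd mu mu_res i S (nb i) 0 iS iN
     (fintype.subxx _) Nm hS.
  move=> H; apply: (le_trans H); rewrite lee_fin mul0r sub0r.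
  have ab : (#|S :\: nb i| <= #|nb i :\: S|)%N.
    rewrite -(leq_add2l #|S :&: nb i|) cardsID finset.setIC cardsID.
    exact: cS.
  move: ab; set a := #|S :\: nb i|; set c := #|nb i :\: S| => ab.
  rewrite /y exprMn -expRM_natl; apply: ler_pM.
  + by rewrite exprn_ge0.
  + exact: expR_ge0.
  + by rewrite ler_weXn2l ?leq_addl// ler1n.
  rewrite ler_expR natrD; have : a%:R <= c%:R :> R by rewrite ler_nat.
  by move=> ac; nra.
rewrite sumEFin lee_fin.
apply: (@le_trans _ _ (2 * (n%:R * y))); last first.
  by have := ler_wpM2l (ler0n R n) yq; lra.
rewrite -[in leRHS](card_ord n).
apply: (@le_trans _ _ (\sum_(S : {set 'I_n} | S != nb i)
    y ^+ (#|nb i :\: S| + #|S :\: nb i|))).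
  rewrite big_mkcond [leRHS]big_mkcond; apply: ler_sum => S _.
  case: ifP => [/and3P[_ _ ->]//|_]; case: ifP => // _; exact: exprn_ge0.
by apply: sum_symdiff_neq_le => //; rewrite card_ord.
Qed.

End selection.

(** * Combination of the two samples *)

Section two_samples.
Context {disp} {T : measurableType disp} {R : realType} (P : probability T R).
Context {n h d : nat}.
Variables (Sigma : 'M[R]_n) (kappa : R) (X : 'I_(h + h) -> {RV P >-> n.-tuple R}).
Local Notation Theta := (precision Sigma).
Hypotheses (k0 : 0 < kappa) (k1 : kappa <= 1) (Sigma_unit : Sigma \in unitmx)
  (nd : nondegenerate kappa Theta) (att : attractive Theta) (pd : posdef Theta)
  (gX : forall s, centered_gaussian Sigma (X s)) (indX : mutually_independent X).
Local Notation nb := (neighbors Theta).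
Local Notation q := (expR (- (kappa ^+ 2 * h%:R / 1280))).

Let X1 s := X (lshift h s).
Let X2 s := X (rshift h s).
Let U1 := tupleRV X1.
Let U2 := tupleRV X2.
Let mu1 := prodP (fun s => distribution P (X1 s)).
Let mu2 := prodP (fun s => distribution P (X2 s)).
Let mu1_res : resample_inv Theta mu1.
Proof. by apply: resample_inv_samples => // s; exact: gX. Qed.
Let mu2_res : resample_inv Theta mu2.
Proof. by apply: resample_inv_samples => // s; exact: gX. Qed.

Let mU1 A : measurable A -> measurable (U1 @^-1` A).
Proof. by move=> mA; rewrite -[X in measurable X]setTI; exact: measurable_tupleRV. Qed.

Let mU2 A : measurable A -> measurable (U2 @^-1` A).
Proof. by move=> mA; rewrite -[X in measurable X]setTI; exact: measurable_tupleRV. Qed.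

Let law12 A B : measurable A -> measurable B ->
  P (U1 @^-1` A `&` U2 @^-1` B) = (mu1 A * mu2 B)%E.
Proof. exact: law_split. Qed.

Let law1 A : measurable A -> P (U1 @^-1` A) = mu1 A.
Proof.
move=> mA; rewrite -[U1 @^-1` A]setIT -(preimage_setT U2) law12//.
by rewrite probability_setT mule1.
Qed.

Definition wrong_validation : set T :=
  [set t | exists2 i, true & (exists2 d' : 'I_d.+1, true &
    (exists2 S : {set 'I_n}, (i \notin S) && (#|S| <= d')%N &
      (U1 @^-1` strictly_selects i d' S `&` U2 @^-1` bad_validation Theta kappa i S) t))].

Hypotheses (nbd : forall i, (#|nb i| <= d)%N) (dh : (200 * d.+1 <= h)%N).

Lemma prob_wrong_validation : measurable wrong_validation /\
  (P wrong_validation <= (n%:R * (d.+1%:R * (4 * n%:R * q)))%:E)%E.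
Proof.
have q0 : 0 <= q by exact: expR_ge0.
have b0 : 0 <= 4 * n%:R * q by rewrite !mulr_ge0.
pose A i (d' : 'I_d.+1) (S : {set 'I_n}) :=
  U1 @^-1` strictly_selects i d' S `&` U2 @^-1` bad_validation Theta kappa i S.
have mA i d' S : measurable (A i d' S).
  apply: measurableI; [apply: mU1; exact: measurable_strictly_selects|].
  by apply: mU2; exact: measurable_bad_validation.
pose F i (d' : 'I_d.+1) := [set t | exists2 S : {set 'I_n}, (i \notin S) && (#|S| <= d')%N & A i d' S t].
have mF i d' : measurable (F i d') by apply: measurable_exists => S _; exact: mA.
have PF i d' : (P (F i d') <= (4 * n%:R * q)%:E)%E.
  pose b S := (mu1 (strictly_selects i d' S) * (4 * n%:R * q)%:E)%E.
  apply: (le_trans (@prob_exists_le _ _ _ P _ _ (A i d') (fun S _ => mA i d' S) b _)).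
    move=> S /andP[iS cS]; rewrite law12.
    - rewrite lee_wpmul2l//; apply: prob_bad_validation => //.
      (* The union of N and S has up to 2 d elements, which explains 200 against the 100 in the tail
         bounds. *)
      rewrite (leq_trans _ dh)// (_ : 200 = 100 * 2)%N// -mulnA leq_mul2l /=.
      rewrite (leq_trans (leq_card_setU _ _))// mul2n -addnn leq_add//.
        by rewrite (leq_trans (nbd i)).
      by rewrite (leq_trans cS)// ltnW// ltn_ord.
    - exact: measurable_strictly_selects.
    - exact: measurable_bad_validation.
  rewrite /b -ge0_sume_distrl; last by move=> S _; exact: measure_ge0.
  rewrite -[leRHS]mul1e; apply: lee_wpmul2r; first by rewrite lee_fin.
  exact: sum_strictly_selects_le1.
pose G i := [set t | exists2 d', true & F i d' t].
have mG i : measurable (G i) by apply: measurable_exists => d' _; exact: mF.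
have PG i : (P (G i) <= (d.+1%:R * (4 * n%:R * q))%:E)%E.
  have := @prob_exists_cst _ _ _ P _ xpredT (F i) _ (fun d' _ => mF i d') b0
    (fun d' _ => PF i d').
  by rewrite card_ord.
split; first by apply: (@measurable_exists _ _ _ xpredT G) => i _; exact: mG.
have b1 : 0 <= d.+1%:R * (4 * n%:R * q) by rewrite mulr_ge0.
have := @prob_exists_cst _ _ _ P _ xpredT G _ (fun i _ => mG i) b1 (fun i _ => PG i).
by rewrite card_ord.
Qed.

Lemma search_and_validate_event (delta : R) : 16 <= kappa ^+ 2 * h%:R ->
  4 * (n%:R * q) <= 1 -> 4 * n%:R ^+ 2 * d.+2%:R * q <= delta ->
  exists E : set T,
    [/\ measurable E, ((1 - delta)%:E <= P E)%E
      & forall t, E t ->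
          let XX1 := data_matrix (fun s : 'I_h => X (lshift h s) t) in
          let XX2 := data_matrix (fun s : 'I_h => X (rshift h s) t) in
          forall (i : 'I_n) (out : option {set 'I_n}),
            search_and_validate XX1 XX2 i d (kappa ^+ 2 / 2) out ->
            out = Some (nb i)].
Proof.
move=> kh nq total; have [mV PV] := prob_wrong_validation.
have dlt : (d < h)%N by rewrite (leq_trans _ dh)// leq_pmull.
have d1 : (100 * d.+1 <= h)%N by rewrite (leq_trans _ dh)// leq_mul2r orbT.
pose W := U1 @^-1` wrong_selection Theta.
pose N := U1 @^-1` ties d.
have mW : measurable W by apply: mU1; exact: measurable_wrong_selection.
have mN : measurable N by apply: mU1; exact: measurable_ties.
have PW : (P W <= (4 * n%:R ^+ 2 * q)%:E)%E.
  rewrite law1; last exact: measurable_wrong_selection.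
  exact: prob_wrong_selection nq.
have PN : (P N <= 0)%E.
  rewrite law1; last exact: measurable_ties.
  by rewrite (prob_ties pd mu1_res dlt).
exists (~` (W `|` (N `|` wrong_validation))); split.
- by apply: measurableC; do 2 apply: measurableU => //.
- rewrite probability_setC; last by do 2 apply: measurableU => //.
  rewrite EFinB leeB//; apply: (@le_trans _ _ (4 * n%:R ^+ 2 * d.+2%:R * q)%:E); last first.
    by rewrite lee_fin.
  (* The factor d + 2 counts one share for the selection and d + 1 for the validation, one for each
     d'. *)
  apply: (@le_trans _ _ ((4 * n%:R ^+ 2 * q)%:E +
    (0 + (n%:R * (d.+1%:R * (4 * n%:R * q)))%:E))%E); last first.
    by rewrite add0e -EFinD lee_fin [d.+2%:R]mulrSr le_eqVlt; apply/orP; left; apply/eqP; ring.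
  apply: le_trans (measureU2 _ mW _) _; first exact: measurableU.
  apply: leeD => //; apply: le_trans (measureU2 _ mN mV) _.
  exact: leeD.
move=> t /not_orP[nW /not_orP[nN nV]] XX1 XX2 i out.
have E1 : XX1 = data_matrix (tnth (U1 t)).
  by apply/matrixP => s j; rewrite !mxE tnth_mktuple.
have E2 : XX2 = data_matrix (tnth (U2 t)).
  by apply/matrixP => s j; rewrite !mxE tnth_mktuple.
rewrite E1 E2; apply: search_and_validate_correct => //.
- by rewrite (leq_trans _ dlt).
- by move=> S; exact: selects_nb.
move=> d' S d'd sel; have [iS cS _] := sel.
have cW : (100 * #|nb i :|: S| <= h)%N.
  rewrite (leq_trans _ dh)// (_ : 200 = 100 * 2)%N// -mulnA leq_mul2l /=.
  rewrite (leq_trans (leq_card_setU _ _))// mul2n -addnn leq_add//.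
    by rewrite (leq_trans (nbd i)).
  by rewrite (leq_trans cS)// ltnW.
apply: validates_of_not_bad => // bad; apply: nV.
exists i => //; exists (Ordinal (d'd : (d' < d.+1)%N)) => //.
exists S; first by rewrite iS.
by split => //=; exact: (selects_strictly d'd nN).
Qed.

End two_samples.

(** * Sample size and constants *)

Lemma half_le_ln2 {R : realType} (x : R) : 2 <= x -> 1 / 2 <= ln x.
Proof.
move=> x2; have x0 : 0 < x by lra.
rewrite -ler_expR lnK ?posrE//; apply: le_trans x2.
have half0 : (0 : R) <= 1 / 2 by lra.
by have := expR_le_1D2 half0 (lexx _); lra.
Qed.

(** The union bounds cost up to 12 N^3, with D = d + 2. A fourth power of delta / (2 N) absorbs
    this: 12 / 16 < 1 and a factor 1 / N is left. *)
Lemma failure_prob_le {R : realType} (delta q N D : R) : 0 < delta -> delta < 1 -> 1 <= N ->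
  0 <= D -> D <= 3 * N -> 0 <= q -> q <= ((2 * N / delta) ^+ 4)^-1 ->
  4 * (N * q) <= 1 /\ 4 * N ^+ 2 * D * q <= delta.
Proof.
move=> d0 d1 N1 D0 DN q0 qle.
have N0 : 0 < N by lra.
have NN : 1 <= N ^+ 3 by rewrite exprn_ege1.
have key : 12 * N ^+ 3 * q <= delta.
  apply: (@le_trans _ _ (12 * N ^+ 3 * ((2 * N / delta) ^+ 4)^-1)).
    by rewrite ler_pM2l// mulr_gt0// exprn_gt0.
  have -> : 12 * N ^+ 3 * ((2 * N / delta) ^+ 4)^-1 = delta * (delta ^+ 3 * (3 / (4 * N))).
    by field; rewrite !gt_eqF.
  rewrite -[leRHS]mulr1 ler_pM2l// mulr_ile1 ?divr_ge0 ?exprn_ge0 ?(ltW d0)//.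
  - by rewrite mulr_ge0// ltW.
  - by rewrite exprn_ile1// ltW.
  - by rewrite ler_pdivrMr; lra.
split; last first.
  apply: le_trans key; rewrite ler_wpM2r//.
  have : N ^+ 2 * D <= N ^+ 2 * (3 * N) by rewrite ler_pM2l// exprn_gt0.
  by rewrite exprSr; lra.
have : N * q <= N ^+ 3 * q by rewrite ler_wpM2r// exprS ler_peMr ?(ltW N0)// exprn_ege1.
by lra.
Qed.

Lemma max_degree_kappa_le1 {R : realType} {n : nat} (Theta : 'M[R]_n) (kappa : R) :
  posdef Theta -> attractive Theta -> 0 < kappa -> nondegenerate kappa Theta ->
  (max_degree Theta)%:R * kappa ^+ 2 <= 1.
Proof.
move=> pd att k0 nd; rewrite /max_degree.
apply: (big_ind (fun m : nat => m%:R * kappa ^+ 2 <= 1)).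
- by rewrite mul0r.
- by move=> a b Ha Hb; rewrite /maxn; case: ifP.
- by move=> i _; apply: ltW; exact: (card_kappa_lt1 pd att k0 nd (fintype.subxx _)).
Qed.

Theorem theorem11 (R : realType) :
  exists C : R, 0 < C /\
  forall (disp : measure_display) (T : measurableType disp)
    (P : probability T R) (delta kappa : R) (n d h : nat)
    (Sigma : 'M[R]_n) (X : 'I_(h + h) -> {RV P >-> n.-tuple R}),
    0 < delta -> delta < 1 ->
    0 < kappa -> kappa <= 1 ->
    Sigma \in unitmx ->
    nondegenerate kappa (precision Sigma) ->
    attractive (precision Sigma) ->
    d = max_degree (precision Sigma) ->
    (forall s, centered_gaussian Sigma (X s)) ->
    mutually_independent X ->
    C * (ln n%:R / kappa ^+ 2 + ln (2 / delta) / kappa ^+ 2) <= (h + h)%:R ->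
    exists E : set T,
      [/\ measurable E,
          ((1 - delta)%:E <= P E)%E
        & forall t, E t ->
            let XX1 := data_matrix (fun s : 'I_h => X (lshift h s) t) in
            let XX2 := data_matrix (fun s : 'I_h => X (rshift h s) t) in
            forall (i : 'I_n) (out : option {set 'I_n}),
              search_and_validate XX1 XX2 i d (kappa ^+ 2 / 2) out ->
              out = Some (neighbors (precision Sigma) i)].
Proof.
(* With m = 2 h this gives kappa^2 h / 1280 >= 4 L for L = ln n + ln (2 / delta), that is, q <=
   (delta / (2 n))^4. *)
exists (8 * 1280); split; first by apply: mulr_gt0; rewrite ltr0n.
move=> disp T P delta kappa [|n'] d h Sigma X d0 d1 k0 k1 Su nd att dE gX indX hC.
  (* Without nodes the claim is void; from here on n >= 1, so that ln n >= 0. *)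
  exists setT; split => //; last by move=> t _ ? ? [].
  by rewrite probability_setT lee_fin gerBl ltW.
move En : n'.+1 => n in Sigma X Su nd att dE gX indX hC *.
have N1 : 1 <= n%:R :> R by rewrite -En ler1n.
have k20 : 0 < kappa ^+ 2 by rewrite exprn_gt0.
have k21 : kappa ^+ 2 <= 1 by rewrite exprn_ile1// ltW.
have d2 : 2 <= 2 / delta by rewrite ler_pdivlMr// ler_piMr// ltW.
pose L := ln n%:R + ln (2 / delta).
(* The 2 in ln (2 / delta) keeps L away from 0 even for n = 1 and delta close to 1; hence kappa^2 h
   >= 2560. *)
have L0 : 1 / 2 <= L.
  by have := half_le_ln2 d2; have := ln_ge0 N1; rewrite /L; lra.
have kh : 4 * L <= kappa ^+ 2 * h%:R / 1280.
  move: hC; rewrite -mulrDl -/L mulrA ler_pdivrMr// natrD => hC.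
  rewrite ler_pdivlMr; lra.
clear hC.
have h0 : (0 < h)%N.
  rewrite lt0n; apply: contraTneq kh => ->; rewrite mulr0 mul0r -ltNge; lra.
have pd : posdef (precision Sigma).
  (* Positive definiteness comes from the factor A of Sigma supplied by any one sample; there is one
     because h > 0. *)
  have [A [_ [AE _ _ _]]] := gX (lshift h (Ordinal h0)).
  exact: posdef_precision AE Su.
have dk : d%:R * kappa ^+ 2 <= 1 by rewrite dE; exact: max_degree_kappa_le1.
have nbd i : (#|neighbors (precision Sigma) i| <= d)%N.
  by rewrite dE /max_degree; exact: leq_bigmax.
have dn : (d <= n)%N.
  by rewrite dE; apply/bigmax_leqP => i _; rewrite -[X in (_ <= X)%N](card_ord n) max_card.
(* By d kappa^2 <= 1 and kappa <= 1, 200 (d + 1) kappa^2 <= 400, well below kappa^2 h. *)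
have dh : (200 * d.+1 <= h)%N.
  rewrite -(ler_nat R) natrM -(ler_pM2r k20) mulrSr; lra.
set q := expR (- (kappa ^+ 2 * h%:R / 1280)).
have qle : q <= ((2 * n%:R / delta) ^+ 4)^-1.
  have n0 : (0 : R) < n%:R by lra.
  have -> : ((2 * n%:R / delta) ^+ 4)^-1 = expR (- (4 * L)).
    rewrite expRN expRM_natl expRD !lnK ?posrE ?divr_gt0//.
    by congr (_ ^+ _)^-1; rewrite mulrCA mulrA.
  by rewrite ler_expR; lra.
have dD : d.+2%:R <= 3 * n%:R :> R.
  have : d%:R <= n%:R :> R by rewrite ler_nat.
  by rewrite -addn2 natrD; lra.
have [nq total] := failure_prob_le d0 d1 N1 (ler0n R d.+2) dD (expR_ge0 _) qle.
apply: (search_and_validate_event k0 k1 Su nd att pd gX indX nbd dh _ nq total).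
by lra.
Qed.
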